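(* Let $G$ be any discrete group, and let $\Gamma\subset G$ be a subset containing the unit element and generating $G$ in the sense that every element of $G$ can be written as a product of elements of $\Gamma$. Let $K\ge0$ be a fixed constant and $H$ a Hilbert space. The following properties of a function $f\colon G\to B(H)$ are equivalent: (i) There are a unitary representation $\pi\colon G\to B(H_\pi)$ and operators $\xi\colon H_\pi\to H$ and $\eta\colon H\to H_\pi$ such that $f(t)=\xi\pi(t)\eta$ for any $t$ in $G$ and $\|\xi\|\,\|\eta\|\le K$. (ii) For each $N\ge1$, the function $f_N\colon\Gamma^N\to B(H)$ defined by $f_N(t_1,\dots,t_N)=f(t_1t_2\cdots t_N)$ extends (with the obvious identification) to an element of $cb(\ell_1(\Gamma)\otimes_h\cdots\otimes_h\ell_1(\Gamma),B(H))$ (where the tensor product is $N$-fold) with norm $\le K$. (iii) Same as (ii) with $\Gamma=G$. (iv) For any $N\ge1$, there are bounded functions $F_i\colon\Gamma\to B(H_{i+1},H_i)$ ($1\le i\le N$), with $\sup_\Gamma\|F_i\|\le1$ for all $i$, where $H_i$ are Hilbert spaces with $H_{N+1}=H$ and $H_1=H$, such that $$f(t_1t_2\cdots t_N)=K\,F_1(t_1)F_2(t_2)\cdots F_N(t_N)\qquad\forall t_1,\dots,t_N\in\Gamma.$$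
   Context: $\ell_1(\Gamma)$ carries its maximal operator space structure (every bounded linear $u\colon\ell_1(\Gamma)\to B(H)$ satisfies $\|u\|_{cb}=\|u\|$), with canonical basis $(\delta_t)_{t\in\Gamma}$; $\otimes_h$ is the Haagerup tensor product of operator spaces and $cb(X,Y)$ the space of completely bounded maps with the cb-norm. The ''obvious identification'' is $\delta_{t_1}\otimes\cdots\otimes\delta_{t_N}\mapsto f_N(t_1,\dots,t_N)$, extended linearly. *)

(* Defs.v *)
From mathcomp Require Import all_boot all_order all_algebra complex.
From mathcomp Require Import all_classical all_reals all_analysis.

Set Implicit Arguments.
Unset Strict Implicit.
Unset Printing Implicit Defensive.

Import Order.TTheory GRing.Theory Num.Theory.
Import numFieldNormedType.Exports.

Local Open Scope classical_set_scope.
Local Open Scope ring_scope.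
Local Open Scope complex_scope.

(* Scalars are R[i].  The norm of a normed space over R[i] takes its values in
   the nonnegative real elements of R[i]; rnorm is the same norm read in R. *)
Definition rnorm (R : realType) (V : normedZmodType R[i]) (x : V) : R :=
  complex.Re `|x|.

Record hilbert (R : realType) : Type := Hilbert {
  hilbert_space :> completeNormedModType R[i];
  hdot : {dot hilbert_space for (@Num.conj R[i])};
  hnormE : forall x : hilbert_space, `|x| ^+ 2 = hdot x x }.

Section BoundedOperators.
Context {R : realType}.
Implicit Types H : hilbert R.

(* An operator is a function H1 -> H2 satisfying bounded_op. *)
Definition bounded_op H1 H2 (u : H1 -> H2) : Prop :=
  linear u /\ exists M : R, forall x, rnorm (u x) <= M * rnorm x.

Definition opnorm H1 H2 (u : H1 -> H2) : R :=
  sup [set rnorm (u x) | x in [set x : H1 | rnorm x <= 1]].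

(* The norm of a matrix of operators, as an operator from the Hilbertian
   direct sum H1^n to H2^m. *)
Definition opmx_norm H1 H2 m n (T : 'M[H1 -> H2]_(m, n)) : R :=
  sup [set Num.sqrt (\sum_i rnorm (\sum_j T i j (h j)) ^+ 2) |
       h in [set h : 'I_n -> H1 | \sum_j rnorm (h j) ^+ 2 <= 1]].

Definition unitary_op H (u : H -> H) : Prop :=
  [/\ linear u, forall x y, hdot H (u x) (u y) = hdot H x y & bijective u].

Definition unitary_rep (G : groupType) H (pi : G -> H -> H) : Prop :=
  [/\ forall t, unitary_op (pi t), forall x, pi 1%g x = x
    & forall s t x, pi (s * t)%g x = pi s (pi t x)].

End BoundedOperators.

Definition linear_on (K : pzRingType) (V W : lmodType K) (D : set V)
    (u : V -> W) : Prop :=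
  forall (a : K) (x y : V), D x -> D y -> u (a *: x + y) = a *: u x + u y.

(* The data of an operator space: a set of vectors osp_set in an ambient vector
   space, and a gauge on the (rectangular) matrices with entries in osp_set.
   The ambient space and the values of osp_norm on matrices with entries
   outside osp_set play no role.  The gauges below are seminorms on osp_set;
   null vectors need not be quotiented out, since a map of finite cb-norm
   vanishes on them. *)
Record opspace (R : realType) : Type := Opspace {
  osp_vect :> lmodType R[i];
  osp_set : set osp_vect;
  osp_norm : forall m n, 'M[osp_vect]_(m, n) -> R }.

Section OperatorSpaces.
Context {R : realType}.
Implicit Types E F X Y : opspace R.

Definition mx_in E m n (x : 'M[E]_(m, n)) : Prop :=
  forall i j, osp_set (x i j).

Definition BH (H1 H2 : hilbert R) : opspace R :=
  @Opspace R (H1 -> H2) [set u | bounded_op u] (@opmx_norm R H1 H2).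

Definition cbnorm X Y (u : X -> Y) : \bar R :=
  ereal_sup [set z | exists (n : nat) (x : 'M[X]_n),
    [/\ mx_in x, osp_norm x <= 1 & z = (osp_norm (map_mx u x))%:E]].

Definition cb X Y (u : X -> Y) : Prop :=
  [/\ linear_on (@osp_set R X) u, forall x, osp_set x -> osp_set (u x)
    & (cbnorm u < +oo)%E].

(* The maximal operator space structure on a normed space (D, nu). *)
Definition max_opspace (V : lmodType R[i]) (D : set V) (nu : V -> R) :
    opspace R :=
  @Opspace R V D (fun m n x =>
    sup [set r | exists (H : hilbert R) (u : V -> BH H H),
      [/\ linear_on D u,
          forall v, D v -> bounded_op (u v) /\ opnorm (u v) <= nu v
        & r = opmx_norm (map_mx u x)]]).

Definition ell1 (T : choiceType) : opspace R :=
  @max_opspace (T -> R[i]^o)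
    [set x | summable [set: T] (fun t => (rnorm (x t : R[i]))%:E)]
    (fun x => fine (\esum_(t in [set: T]) (rnorm (x t : R[i]))%:E)).

Definition delta (T : choiceType) (t : T) : ell1 T := fun s => (s == t)%:R.

Record bilform E F : Type := Bilform {
  bilform_fun :> E -> F -> R[i]^o;
  bilform_linl : forall y, osp_set y ->
    linear_on (@osp_set R E) (fun x => bilform_fun x y);
  bilform_linr : forall x, osp_set x ->
    linear_on (@osp_set R F) (bilform_fun x) }.

(* The algebraic tensor product is realized inside the dual of the space of
   bilinear forms, x (x) y being evaluation at (x, y); two finite sums of
   elementary tensors have the same values on all bilinear forms iff they are
   equal in the algebraic tensor product. *)
Definition tens_alg E F (x : E) (y : F) : bilform E F -> R[i]^o :=
  fun phi => phi x y.

Definition haagerup_alg E F : opspace R :=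
  @Opspace R (bilform E F -> R[i]^o)
    [set t | exists (r : nat) (e : 'I_r -> E) (f : 'I_r -> F),
      [/\ forall l, osp_set (e l), forall l, osp_set (f l)
        & t = \sum_l tens_alg (e l) (f l)]]
    (fun m n x =>
      inf [set c | exists (r : nat) (a : 'M[E]_(m, r)) (b : 'M[F]_(r, n)),
        [/\ mx_in a, mx_in b,
            forall i j, x i j = \sum_l tens_alg (a i l) (b l j)
          & c = osp_norm a * osp_norm b]]).

(* The completion: Cauchy sequences, with the limit matrix norms. *)
Definition completion X : opspace R :=
  @Opspace R (nat -> X)
    [set s | (forall k, osp_set (s k)) /\
      forall eps : R, 0 < eps -> exists N, forall k l,
        (N <= k)%N -> (N <= l)%N ->
        osp_norm (const_mx (s k - s l) : 'M[X]_1) < eps]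
    (fun m n x => limn (fun k => osp_norm (\matrix_(i, j) x i j k))).

Definition haagerup E F : opspace R := completion (haagerup_alg E F).

Definition tens E F (x : E) (y : F) : haagerup E F := fun=> tens_alg x y.

(* The (n+1)-fold product ((E (x)_h E) (x)_h ...) (x)_h E. *)
Fixpoint haagerup_pow E (n : nat) : opspace R :=
  if n is n'.+1 then haagerup (haagerup_pow E n') E else E.

(* x 0 (x) x 1 (x) ... (x) x n; the later values of x are not used. *)
Fixpoint tens_pow E (x : nat -> E) (n : nat) : haagerup_pow E n :=
  match n return haagerup_pow E n with
  | 0 => x 0%N
  | n'.+1 => tens (tens_pow x n') (x n'.+1)
  end.

(* For every N = n + 1 >= 1, the function
   (t_1, ..., t_N) |-> f (t_1 ... t_N) on Gamma^N extends to a completely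
   bounded map of norm <= K.  Tuples are the initial segments of sequences
   t : nat -> Gamma. *)
Definition cb_extendable (G : groupType) (Gamma : set G) (H : hilbert R)
    (f : G -> H -> H) (K : R) : Prop :=
  forall n : nat, exists u : haagerup_pow (ell1 Gamma) n -> BH H H,
    [/\ cb u, (cbnorm u <= K%:E)%E
      & forall t : nat -> Gamma,
          u (tens_pow (fun i => delta (t i)) n) =
          f (\prod_(i < n.+1) val (t i))%g].

(* F 0 (t 0) \o ... \o F (N - 1) (t (N - 1)) *)
Fixpoint op_prod (T : Type) (Hs : nat -> hilbert R)
    (F : forall i, T -> Hs i.+1 -> Hs i) (t : nat -> T) (N : nat) :
    Hs N -> Hs 0%N :=
  match N return Hs N -> Hs 0%N with
  | 0 => id
  | N'.+1 => fun h => op_prod F t (F N' (t N') h)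
  end.

Definition hcast (H1 H2 : hilbert R) (e : H1 = H2) (x : H1) : H2 :=
  let: erefl := e in x.

End OperatorSpaces.

Arguments ell1 {R} T.
Arguments delta {R T} t.

(* Main.v *)
From HB Require Import structures.
Require Import Defs.
From mathcomp Require Import all_boot perm all_order all_algebra complex.
From mathcomp Require Import all_classical all_reals all_analysis.
From mathcomp Require Import ring lra.
Import Order.TTheory GRing.Theory Num.Theory.
Import numFieldNormedType.Exports.
Local Open Scope classical_set_scope.
Local Open Scope ring_scope.
Local Open Scope complex_scope.

Set Implicit Arguments.
Unset Strict Implicit.
Unset Printing Implicit Defensive.

(** An equivalent form of (i) is the existence of a positive quadratic form P on
the span V of the coefficients x |-> f(xt)h, invariant under right translations,
with |v(1)|^2 <= P(v) and P(x |-> f(x)h) <= K^2 |h|^2: the Hilbert space of the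
representation is then the dual of (V, P).

Call a finite family in V admissible with energy E if it is obtained from
vectors h_j with K^2 sum |h_j|^2 = E by alternating isometric scalar matrices and
diagonal matrices of unimodular multiples of elements of Gamma.  Either of (ii),
(iii), (iv) gives the inequality sum |v_i(1)|^2 <= E for admissible families.
Such an inequality yields P by Zorn's lemma: a minimal subadditive functional q on
finite families that is invariant under plane rotations and under Gamma, and that
satisfies q(x) + sum |z_i(1)|^2 <= q(x, z), is additive, so that P(v) = q(v).
The invariance under plane rotations gives the parallelogram law.

Conversely a representation t |-> pi(t) extends to ell_1, to the Haagerup
products by multiplying operators, and to the completions by density. *)

(** * Hilbertian quadratic forms *)

(** The hypotheses come separately for each N, with unrelated maps or intermediate spaces, so a
    direct construction of the representation would need a limit over N. None is taken: an
    admissible family arises from finitely many moves, one sufficiently large N bounds it, and the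
    resulting energy inequality no longer mentions N. The unit in Gamma lets one vector move while
    the others wait, and fills the factors that remain.

    Families replace single vectors because the given norms are matrix norms. Of all isometries,
    plane reflections, permutations and phases are enough; the phases supply complex homogeneity, as
    the reflections have real coefficients.

    The lower bound has the form [q x + Gs z <= q (x ++ z)], with Gs the sum of the |z_i(1)|^2,
    rather than [Gs x <= q x]: it makes q monotone, which bounds from below the infimum that lowers
    q at a vector.

    The dual of (V, P) is used because null vectors vanish in it without a quotient and because it
    is complete as it stands, limits of functionals being pointwise. *)

Section ComplexNorm.
Context {R : realType}.
Implicit Types (V : normedZmodType R[i]) (W : normedModType R[i]).

Lemma rnormE V (x : V) : `|x| = (rnorm x)%:C.
Proof. by rewrite /rnorm RRe_real // realE normr_ge0. Qed.

Lemma rnorm_ge0 V (x : V) : 0 <= rnorm x.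
Proof. by rewrite -ler0c -rnormE. Qed.

Lemma rnormD V (x y : V) : rnorm (x + y) <= rnorm x + rnorm y.
Proof. by rewrite -lecR rmorphD /= -!rnormE ler_normD. Qed.

Lemma rnormN V (x : V) : rnorm (- x) = rnorm x.
Proof. by rewrite /rnorm normrN. Qed.

Lemma rnorm0 V : rnorm (0 : V) = 0.
Proof. by rewrite /rnorm normr0. Qed.

Lemma rnorm0_eq0 V (x : V) : rnorm x = 0 -> x = 0.
Proof. by move=> x0; apply/eqP; rewrite -normr_eq0 rnormE x0. Qed.

Lemma rnormBC V (x y : V) : rnorm (x - y) = rnorm (y - x).
Proof. by rewrite -opprB rnormN. Qed.

Lemma rnormB_triangle V (x y z : V) :
  rnorm (x - z) <= rnorm (x - y) + rnorm (y - z).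
Proof. by rewrite -(subrKA y); exact: rnormD. Qed.

Lemma rnorm_sum V (I : Type) (r : seq I) (P : pred I) (F : I -> V) :
  rnorm (\sum_(i <- r | P i) F i) <= \sum_(i <- r | P i) rnorm (F i).
Proof.
elim/big_rec2: _ => [|i y1 y2 _ le]; first by rewrite rnorm0.
by apply: le_trans (rnormD _ _) _; rewrite lerD2l.
Qed.

Lemma rnormZ W (a : R[i]) (x : W) : rnorm (a *: x) = rnorm a * rnorm x.
Proof. by apply: complexI; rewrite rmorphM /= -!rnormE normrZ. Qed.

Lemma rnormM (a b : R[i]) : rnorm (a * b) = rnorm a * rnorm b.
Proof. by apply: complexI; rewrite rmorphM /= -!rnormE normrM. Qed.

Lemma rnormR (a : R) : rnorm (a%:C : R[i]) = `|a|.
Proof. by rewrite /rnorm normc_def /= expr0n addr0 sqrtr_sqr. Qed.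

Lemma rnorm_sqr (z : R[i]) :
  rnorm z ^+ 2 = complex.Re z ^+ 2 + complex.Im z ^+ 2.
Proof. by apply: complexI; rewrite add_Re2_Im2 rnormE rmorphXn. Qed.

Lemma rnormJ (z : R[i]) : rnorm (z^*)%C = rnorm z.
Proof.
apply/eqP; rewrite -(@eqrXn2 _ 2) ?rnorm_ge0 //.
by rewrite !rnorm_sqr; case: z => a b /=; rewrite sqrrN.
Qed.

Lemma mulJc (z : R[i]) : (z^*)%C * z = (rnorm z ^+ 2)%:C.
Proof.
by rewrite rnorm_sqr; case: z => a b /=; apply/eqP; rewrite eq_complex /=;
   apply/andP; split; apply/eqP; ring.
Qed.

End ComplexNorm.

Section HilbertianForm.
Context {R : realType}.

(* The first identity is invariance of Q v + Q w under the reflections of the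
   plane spanned by v and w; it contains the parallelogram law, and the
   homogeneity of the polarization without any continuity argument. *)
Definition hilbertian (V : lmodType R[i]) (Q : V -> R) : Prop :=
  [/\ forall (c s : R) (v w : V), c ^+ 2 + s ^+ 2 = 1 ->
        Q (c%:C *: v + s%:C *: w) + Q (s%:C *: v - c%:C *: w) = Q v + Q w,
      forall (z : R[i]) v, Q (z *: v) = rnorm z ^+ 2 * Q v
    & forall v, 0 <= Q v].

Variables (V : lmodType R[i]) (Q : V -> R).
Hypothesis HQ : hilbertian Q.

(** The real part of the sesquilinear form of Q. The imaginary part is recovered by inserting ['i],
    so that the identities below are between real numbers. *)
Definition polar (v w : V) : R := (Q (v + w) - Q (v - w)) / 4.

Let refl c s v w : c ^+ 2 + s ^+ 2 = 1 ->
  Q (c%:C *: v + s%:C *: w) + Q (s%:C *: v - c%:C *: w) = Q v + Q w.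
Proof. by case: HQ => h _ _; exact: h. Qed.

Lemma hilbertianZ (z : R[i]) v : Q (z *: v) = rnorm z ^+ 2 * Q v.
Proof. by case: HQ. Qed.

Lemma hilbertian_ge0 v : 0 <= Q v.
Proof. by case: HQ. Qed.

Lemma hilbertianZr (a : R) v : Q (a%:C *: v) = a ^+ 2 * Q v.
Proof. by rewrite hilbertianZ rnormR real_normK ?num_real. Qed.

Lemma hilbertian0 : Q 0 = 0.
Proof. by rewrite -(scale0r 0) hilbertianZ rnorm0 expr0n mul0r. Qed.

Lemma hilbertianN v : Q (- v) = Q v.
Proof. by rewrite -scaleN1r hilbertianZ rnormN /rnorm normr1 expr1n mul1r. Qed.

Lemma hilbertianB v w : Q (v - w) = Q (w - v).
Proof. by rewrite -hilbertianN opprB. Qed.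

(** The reflection identity at the angle of cosine sqrt (t / (1 + t)), applied to suitable multiples
    of v and w. The free parameter t gives real homogeneity of [polar] directly; the case t = 1, the
    parallelogram law, would give rational scalars only. *)
Lemma hilbertian_balance (t : R) v w : 0 <= t ->
  Q (t%:C *: v + w) + t * Q (v - w) = t * (1 + t) * Q v + (1 + t) * Q w.
Proof.
move=> t0; have t1 : 0 < 1 + t by rewrite ltr_wpDr.
set r := Num.sqrt (1 + t); set q := Num.sqrt t.
have r0 : r != 0 by rewrite gt_eqF // sqrtr_gt0.
have rr : r ^+ 2 = 1 + t by rewrite sqr_sqrtr // ltW.
have qq : q ^+ 2 = t by rewrite sqr_sqrtr.
have cs : (q / r) ^+ 2 + r^-1 ^+ 2 = 1.
  by rewrite exprMn !exprVn rr qq; field; rewrite gt_eqF.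
have := refl ((q * r)%:C *: v) (r%:C *: w) cs.
rewrite !scalerA -!rmorphM /= mulVf // divfK //.
have -> : q / r * (q * r) = t by rewrite mulrCA divfK // -expr2.
have -> : r^-1 * (q * r) = q by rewrite mulrC mulfK.
by rewrite scale1r -scalerBr !hilbertianZr exprMn rr qq => ->; ring.
Qed.

Lemma parallelogram v w : Q (v + w) + Q (v - w) = 2 * Q v + 2 * Q w.
Proof.
have := @hilbertian_balance 1 v w ler01.
by rewrite scale1r !mul1r => ->; ring.
Qed.

Lemma polarC v w : polar v w = polar w v.
Proof. by rewrite /polar (addrC w) (hilbertianB w). Qed.

Lemma polar_diag v : polar v v = Q v.
Proof.
rewrite /polar subrr hilbertian0 -mulr2n -scaler_nat.
have -> : (2 : R[i]) = 2%:C by rewrite rmorph_nat.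
by rewrite hilbertianZr; field.
Qed.

Lemma polarNr v w : polar v (- w) = - polar v w.
Proof. by rewrite /polar opprK -mulNr opprB. Qed.

Lemma polarZr (a : R) v w : polar v (a%:C *: w) = a * polar v w.
Proof.
suff pos (t : R) u : 0 <= t -> polar v (t%:C *: u) = t * polar v u.
  have [a0|a0] := leP 0 a; first exact: pos.
  have -> : a%:C *: w = (- a)%:C *: (- w) by rewrite rmorphN scalerN scaleNr opprK.
  by rewrite pos ?oppr_ge0 ?ltW // polarNr mulrNN.
(* The balance identities for v and for -v have equal right-hand sides; subtract them. *)
move=> t0; rewrite ![polar v _]polarC /polar.
have := hilbertian_balance u v t0; have := hilbertian_balance u (- v) t0.
by rewrite hilbertianN opprK => h1 h2; lra.
Qed.

Lemma polarZl (a : R) v w : polar (a%:C *: v) w = a * polar v w.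
Proof. by rewrite polarC polarZr polarC. Qed.

Lemma polarDl v v' w : polar (v + v') w = polar v w + polar v' w.
Proof.
(* With w doubled, the two arguments of Q are (v + w) + (v' + w) and (v - w) + (v' - w); their
   parallelogram laws share the difference v - v', which cancels. *)
have h : polar (v + v') (2%:C *: w) = 2 * (polar v w + polar v' w).
  rewrite /polar.
  have := parallelogram (v + w) (v' + w); have := parallelogram (v - w) (v' - w).
  have -> : v - w + (v' - w) = v + v' - 2%:C *: w.
    by rewrite [2%:C]rmorph_nat scaler_nat mulr2n opprD addrACA.
  have -> : v - w - (v' - w) = v - v' by rewrite opprB addrA subrK.
  have -> : v + w + (v' + w) = v + v' + 2%:C *: w.
    by rewrite [2%:C]rmorph_nat scaler_nat mulr2n addrACA.
  have -> : v + w - (v' + w) = v - v' by rewrite opprD addrACA subrr addr0.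
  by move=> h1 h2; lra.
by move: h; rewrite polarZr => h; lra.
Qed.

Lemma polarDr v w w' : polar v (w + w') = polar v w + polar v w'.
Proof. by rewrite ![polar v _]polarC polarDl. Qed.

Lemma polarii v w : polar ('i%C *: v) ('i%C *: w) = polar v w.
Proof.
rewrite /polar -scalerDr -scalerBr !hilbertianZ rnorm_sqr /=.
by rewrite expr0n expr1n add0r !mul1r.
Qed.

Lemma polarZJ (z : R[i]) v w : polar (z *: v) w = polar v ((z^*)%C *: w).
Proof.
case: z => a b; have -> : a +i* b = a%:C + b%:C * 'i%C.
  by apply/eqP; rewrite eq_complex /=; apply/andP; split; apply/eqP; ring.
rewrite rmorphD rmorphM /= !oppr0.
have -> : 0 -i* 1 = - 'i%C :> R[i].
  by apply/eqP; rewrite eq_complex /= oppr0 !eqxx.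
rewrite !scalerDl polarDl polarDr -!scalerA !polarZl !polarZr.
congr (_ + b * _); rewrite scaleNr -[in RHS]polarii scalerN scalerA.
have -> : 'i%C * 'i%C = -1 :> R[i] by rewrite -expr2 sqr_i.
by rewrite scaleN1r opprK.
Qed.

Lemma hilbertianD v w : Q (v + w) = Q v + 2 * polar v w + Q w.
Proof. by have := parallelogram v w; rewrite /polar => h; lra. Qed.

Lemma polar_CS v w : polar v w ^+ 2 <= Q v * Q w.
Proof.
have h (t : R) : 0 <= Q v + 2 * t * polar v w + t ^+ 2 * Q w.
  have := hilbertian_ge0 (v + t%:C *: w).
  by rewrite hilbertianD polarZr hilbertianZr mulrA.
have := hilbertian_ge0 w; rewrite le_eqVlt => /predU1P[w0|w0].
  rewrite -w0 mulr0; suff -> : polar v w = 0 by rewrite expr0n.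
  apply/eqP; apply: contraT => p0.
  (* When Q w = 0 the polynomial is affine in t, and this t gives it the value -1. *)
  have := h (- (Q v + 1) / (2 * polar v w)); rewrite -w0 mulr0 addr0.
  have -> : 2 * (- (Q v + 1) / (2 * polar v w)) * polar v w = - (Q v + 1).
    by field.
  by move=> ?; lra.
have := h (- polar v w / Q w).
have -> : Q v + 2 * (- polar v w / Q w) * polar v w +
    (- polar v w / Q w) ^+ 2 * Q w = (Q v * Q w - polar v w ^+ 2) / Q w.
  by field; rewrite gt_eqF.
by rewrite pmulr_lge0 ?invr_gt0 // subr_ge0.
Qed.

Lemma hilbertian_triangle v w :
  Num.sqrt (Q (v + w)) <= Num.sqrt (Q v) + Num.sqrt (Q w).
Proof.
rewrite -(@ler_pXn2r _ 2) ?nnegrE ?addr_ge0 ?sqrtr_ge0 //.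
rewrite sqrrD !sqr_sqrtr ?hilbertian_ge0 // hilbertianD lerD2r lerD2l -[leRHS]mulr_natl.
rewrite ler_pM2l // -sqrtrM ?hilbertian_ge0 //.
by rewrite (le_trans (ler_norm _)) // -sqrtr_sqr ler_wsqrtr // polar_CS.
Qed.

End HilbertianForm.

(** * The dual of a quadratic form *)

Section DualSpace.
Context {R : realType}.

Record hform (V : lmodType R[i]) := HForm {
  hform_fun :> V -> R;
  hformP : hilbertian hform_fun }.

Variables (V : lmodType R[i]) (P : hform V).

Let HP := hformP P.

(* The dual of (V, P) as a space of real-valued functionals: g stands for the
   antilinear functional with real part g. *)
Definition dual_pred : {pred V -> R} := fun g =>
  `[< [/\ forall v w, g (v + w) = g v + g w,
          forall (a : R) v, g (a%:C *: v) = a * g v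
        & exists2 C, 0 <= C & forall v, g v ^+ 2 <= C * P v] >].

Lemma dual_closed : zmod_closed dual_pred.
Proof.
split.
  apply/asboolP; split=> [v w|a v|]; rewrite ?addr0 ?mulr0 //.
  by exists 0 => // v; rewrite expr0n mul0r.
move=> g h /asboolP[gD gZ [C C0 gC]] /asboolP[hD hZ [D D0 hD']].
apply/asboolP; split=> [v w|a v|].
- by rewrite /= !fctE gD hD opprD addrACA.
- by rewrite /= !fctE gZ hZ mulrBr.
exists (2 * C + 2 * D) => [|v]; first by rewrite addr_ge0 ?mulr_ge0.
rewrite /= !fctE; have := gC v; have := hD' v; have := sqr_ge0 (g v + h v).
by rewrite mulrDl => *; nra.
Qed.

HB.instance Definition _ :=
  GRing.isZmodClosed.Build _ dual_pred dual_closed.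

Record dual := Dual { dual_fun :> V -> R; dual_funP : dual_fun \in dual_pred }.
HB.instance Definition _ := [isSub for dual_fun].
HB.instance Definition _ := [Choice of dual by <:].
HB.instance Definition _ := [SubChoice_isSubZmodule of dual by <:].
Implicit Types g h : dual.

Lemma dualP g h : g =1 h -> g = h.
Proof. by move=> gh; apply/val_inj/funext. Qed.

Lemma dualAD g v w : g (v + w) = g v + g w.
Proof. by case: g => g /= /asboolP[]. Qed.

Lemma dualAZ g (a : R) v : g (a%:C *: v) = a * g v.
Proof. by case: g => g /= /asboolP[]. Qed.

Lemma dualAN g v : g (- v) = - g v.
Proof. by rewrite -scaleN1r -[-1](rmorphN1 (real_complex R)) dualAZ mulN1r. Qed.

Lemma dual_bound g : exists2 C, 0 <= C & forall v, g v ^+ 2 <= C * P v.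
Proof. by case: g => g /= /asboolP[]. Qed.

Lemma dualDE g h v : (g + h) v = g v + h v.
Proof. by []. Qed.

Lemma dualNE g v : (- g) v = - g v.
Proof. by []. Qed.

Lemma dual_scale_subproof (z : R[i]) g :
  (fun v => g ((z^*)%C *: v)) \in dual_pred.
Proof.
apply/asboolP; split=> [v w|a v|]; first by rewrite scalerDr dualAD.
  by rewrite scalerA mulrC -scalerA dualAZ.
have [C C0 gC] := dual_bound g.
exists (C * rnorm z ^+ 2) => [|v]; first by rewrite mulr_ge0 ?sqr_ge0.
by rewrite (le_trans (gC _)) // (hilbertianZ HP) rnormJ mulrA.
Qed.

Definition dual_scale z g := Dual (dual_scale_subproof z g).

Lemma dual_scaleA a b g :
  dual_scale a (dual_scale b g) = dual_scale (a * b) g.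
Proof. by apply: dualP => v /=; rewrite scalerA -rmorphM mulrC. Qed.

Lemma dual_scale1 : left_id 1 dual_scale.
Proof. by move=> g; apply: dualP => v; rewrite -[LHS]/(g ((1^*)%C *: v)) conjc1 scale1r. Qed.

Lemma dual_scaleDr : right_distributive dual_scale +%R.
Proof. by move=> a g h; apply: dualP. Qed.

Lemma dual_scaleDl g : {morph dual_scale^~ g : a b / a + b}.
Proof.
by move=> a b; apply: dualP => v; rewrite dualDE /= rmorphD scalerDl dualAD.
Qed.

HB.instance Definition _ := GRing.Zmodule_isLmodule.Build R[i] dual
  dual_scaleA dual_scale1 dual_scaleDr dual_scaleDl.

Lemma dualZE (z : R[i]) g v : (z *: g) v = g ((z^*)%C *: v).
Proof. by []. Qed.

Lemma dualZRE (a : R) g v : (a%:C *: g) v = a * g v.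
Proof. by rewrite dualZE conjc_real dualAZ. Qed.

(** The Legendre transform of P, which is the square of the dual norm, written without the quotient
    of g(v)^2 by P v, meaningless at null vectors of P. *)
Definition dualQ g : R := sup (range (fun v => 2 * g v - P v)).

Lemma dualQ_has_sup g : has_sup (range (fun v => 2 * g v - P v)).
Proof.
split; first by exists (2 * g 0 - P 0); exists 0.
have [C C0 gC] := dual_bound g; exists C => _ [v _ <-].
have := gC v; have := hilbertian_ge0 HP v => P0 gv; rewrite lerBlDr.
rewrite (le_trans (ler_norm _)) // -(@ler_pXn2r _ 2) ?nnegrE ?addr_ge0 //.
by rewrite real_normK ?num_real //; have := sqr_ge0 (C - P v); nra.
Qed.

Lemma dualQ_ub g v : 2 * g v - P v <= dualQ g.
Proof. by apply: (ub_le_sup (proj2 (dualQ_has_sup g))); exists v. Qed.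

Lemma dualQ_le g c : (forall v, 2 * g v - P v <= c) -> dualQ g <= c.
Proof.
by move=> h; apply: sup_le_ub => [|_ [v _ <-]//]; exact: (proj1 (dualQ_has_sup g)).
Qed.

Lemma dualQ_ge0 g : 0 <= dualQ g.
Proof.
have := dualQ_ub g 0; rewrite (hilbertian0 HP) subr0.
by rewrite -(scale0r 0) dualAZ mul0r mulr0.
Qed.

Lemma dual_dualQ g v : g v ^+ 2 <= dualQ g * P v.
Proof.
have := hilbertian_ge0 HP v; rewrite le_eqVlt => /predU1P[v0|v0].
  have [C _ /(_ v)] := dual_bound g; by rewrite -v0 !mulr0.
(* This multiple of v maximizes 2 g - P on the real line through v. *)
have := dualQ_ub g ((g v / P v)%:C *: v).
rewrite dualAZ (hilbertianZr HP).
have -> : 2 * (g v / P v * g v) - (g v / P v) ^+ 2 * P v = g v ^+ 2 / P v.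
  by field; rewrite gt_eqF.
by rewrite ler_pdivrMr.
Qed.

Lemma dualQ_approx g e : 0 < e -> exists v, dualQ g - e < 2 * g v - P v.
Proof.
by move=> e0; have [_ [v _ <-] ?] := sup_adherent e0 (dualQ_has_sup g); exists v.
Qed.

(** Reflecting both the pair of functionals and a pair of vectors preserves g v + h w and P v + P w,
    so near-maximizers go to near-maximizers. The reflection is an involution, hence one inequality
    suffices. *)
Lemma dualQ_refl (c s : R) g h : c ^+ 2 + s ^+ 2 = 1 ->
  dualQ (c%:C *: g + s%:C *: h) + dualQ (s%:C *: g - c%:C *: h)
  = dualQ g + dualQ h.
Proof.
suff le g' h' : c ^+ 2 + s ^+ 2 = 1 -> dualQ g' + dualQ h' <=
    dualQ (c%:C *: g' + s%:C *: h') + dualQ (s%:C *: g' - c%:C *: h').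
  move=> cs; apply/le_anti; rewrite le // andbT.
  have := le (c%:C *: g + s%:C *: h) (s%:C *: g - c%:C *: h) cs.
  set G := (X in _ <= dualQ X + _); set H := (X in _ <= _ + dualQ X).
  have -> : G = g.
    apply: dualP => v; rewrite /G !(dualDE, dualNE, dualZRE).
    by rewrite -[RHS]mul1r -cs; ring.
  have -> // : H = h.
  apply: dualP => v; rewrite /H !(dualDE, dualNE, dualZRE).
  by rewrite -[RHS]mul1r -cs; ring.
move=> cs; rewrite leNgt; apply/negP => lt.
set G := _ *: _ + _ in lt; set H := _ - _ in lt.
set e := (dualQ g' + dualQ h' - (dualQ G + dualQ H)) / 2.
have e0 : 0 < e by rewrite divr_gt0 // subr_gt0.
have [v hv] := dualQ_approx g' e0; have [w hw] := dualQ_approx h' e0.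
have := dualQ_ub H (s%:C *: v - c%:C *: w).
have := dualQ_ub G (c%:C *: v + s%:C *: w).
have : P (c%:C *: v + s%:C *: w) + P (s%:C *: v - c%:C *: w) = P v + P w.
  by case: HP => + _ _; exact.
have -> x : G x = c * g' x + s * h' x by rewrite dualDE !dualZRE.
have -> x : H x = s * g' x - c * h' x by rewrite dualDE dualNE !dualZRE.
rewrite !(dualAD, dualAN, dualAZ) => hP h1 h2.
have : g' v = (c ^+ 2 + s ^+ 2) * g' v by rewrite cs mul1r.
have : h' w = (c ^+ 2 + s ^+ 2) * h' w by rewrite cs mul1r.
rewrite /e in hv hw => *; lra.
Qed.

Lemma dualQ_Z (z : R[i]) g : dualQ (z *: g) = rnorm z ^+ 2 * dualQ g.
Proof.
have le (z' : R[i]) g' : dualQ (z' *: g') <= rnorm z' ^+ 2 * dualQ g'.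
  have [->|z0] := eqVneq z' 0.
    rewrite rnorm0 expr0n mul0r scale0r; apply: dualQ_le => v.
    by rewrite [(0 : dual) v]/= mulr0 sub0r oppr_le0 (hilbertian_ge0 HP).
  apply: dualQ_le => v.
  have -> : v = z' *: (z'^-1 *: v) by rewrite scalerA mulfV // scale1r.
  rewrite dualZE scalerA mulJc dualAZ (hilbertianZ HP).
  rewrite mulrCA -mulrBr ler_wpM2l ?sqr_ge0 //; exact: dualQ_ub.
apply/le_anti; rewrite le /=; have [->|z0] := eqVneq z 0.
  by rewrite rnorm0 expr0n mul0r dualQ_ge0.
have nz0 : rnorm z != 0 by apply: contraNneq z0 => /rnorm0_eq0 ->.
have := le z^-1 (z *: g); rewrite scalerA mulVf // scale1r => h.
rewrite (le_trans (ler_wpM2l (sqr_ge0 _) h)) // mulrA -exprMn -rnormM mulfV //.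
by rewrite /rnorm normr1 expr1n mul1r.
Qed.

Lemma dualQP : hilbertian dualQ.
Proof. by split; [move=> *; exact: dualQ_refl|exact: dualQ_Z|exact: dualQ_ge0]. Qed.

Definition dual_norm g : R[i] := (Num.sqrt (dualQ g))%:C.

Lemma dual_normD g h : dual_norm (g + h) <= dual_norm g + dual_norm h.
Proof. by rewrite -rmorphD lecR; exact: (hilbertian_triangle dualQP). Qed.

Lemma dual_normZ (z : R[i]) g : dual_norm (z *: g) = `|z| * dual_norm g.
Proof.
rewrite /dual_norm dualQ_Z sqrtrM ?sqr_ge0 // sqrtr_sqr ger0_norm ?rnorm_ge0 //.
by rewrite rmorphM rnormE.
Qed.

Lemma dual_norm0 g : dual_norm g = 0 -> g = 0.
Proof.
move=> /complexI/eqP; rewrite sqrtr_eq0 => g0; apply: dualP => v.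
have := dual_dualQ g v; have -> : dualQ g = 0 by apply/le_anti; rewrite g0 dualQ_ge0.
by rewrite mul0r => h; apply/eqP; rewrite -sqrf_eq0 eq_le h sqr_ge0.
Qed.

HB.instance Definition _ := Lmodule_isNormed.Build R[i] dual
  dual_normD dual_normZ dual_norm0.

End DualSpace.

(** * Cauchy sequences and limits for real-valued norms *)

Section Limits.
Context {R : realType}.

Lemma half_gt0 (e : R) : 0 < e -> 0 < e / 2.
Proof. by move=> e0; rewrite divr_gt0. Qed.

Lemma harmonic_small (e : R) : 0 < e ->
  exists N, forall n, (N <= n)%N -> n.+1%:R^-1 < e.
Proof.
move=> e0; exists (Num.bound e^-1) => n Nn; rewrite invf_plt ?posrE //.
apply: lt_le_trans (archi_boundP _) _; first by rewrite invr_ge0 ltW.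
by rewrite ler_nat (leq_trans Nn).
Qed.

Definition rcauchy (L : normedZmodType R[i]) (u : nat -> L) : Prop :=
  forall e : R, 0 < e -> exists N, forall m n,
    (N <= m)%N -> (N <= n)%N -> rnorm (u m - u n) < e.

Definition rcvg (L : normedZmodType R[i]) (u : nat -> L) (l : L) : Prop :=
  forall e : R, 0 < e -> exists N, forall n, (N <= n)%N -> rnorm (u n - l) < e.

Lemma gt0_realC (e : R[i]) : 0 < e -> exists2 r : R, 0 < r & e = r%:C.
Proof. by case: e => a b; rewrite ltcE /= => /andP[/eqP -> a0]; exists a. Qed.

Lemma rnorm_lt (L : normedZmodType R[i]) (x : L) (e : R) :
  (`|x| < e%:C) = (rnorm x < e).
Proof. by rewrite rnormE ltcR. Qed.

Lemma rcauchy_rcvg (L : completeNormedModType R[i]) (u : nat -> L) :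
  rcauchy u -> exists l, rcvg u l.
Proof.
move=> cu; suff /cvg_ex[l lu] : cvg (u @ \oo).
  exists l => e e0; have e0' : 0 < e%:C :> R[i] by rewrite ltcR.
  move/cvgrPdist_lt : lu => /(_ _ e0') [N _ h]; exists N => n /h /=.
  by rewrite rnorm_lt rnormBC.
apply/cauchy_cvgP/cauchy_exP => _ /gt0_realC[e e0 ->].
have [N h] := cu _ e0; exists (u N); exists N => // n /= Nn.
by rewrite -ball_normE /= rnorm_lt h.
Qed.

Lemma real_cauchy_cvg (u : nat -> R) :
  (forall e, 0 < e -> exists N, forall m n,
    (N <= m)%N -> (N <= n)%N -> `|u m - u n| < e) -> cvgn u.
Proof.
move=> cu; apply/cauchy_cvgP/cauchy_exP => e e0.
have [N h] := cu _ e0; exists (u N); exists N => // n /= Nn.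
by rewrite -ball_normE /= h.
Qed.

Lemma cvgn_elem (u : nat -> R) (e : R) : cvgn u -> 0 < e ->
  exists N, forall n, (N <= n)%N -> `|u n - limn u| < e.
Proof.
by move=> /cvgrPdist_lt/(_ _ _) h e0; have [N _ k] := h _ e0; exists N => n /k;
   rewrite distrC.
Qed.

Lemma limn_le (u : nat -> R) (c : R) N :
  cvgn u -> (forall n, (N <= n)%N -> u n <= c) -> limn u <= c.
Proof. by move=> cu h; apply: limr_le => //; exists N. Qed.

Lemma limn_ge (u : nat -> R) (c : R) N :
  cvgn u -> (forall n, (N <= n)%N -> c <= u n) -> c <= limn u.
Proof. by move=> cu h; apply: limr_ge => //; exists N. Qed.

Lemma rcvgD (L : normedZmodType R[i]) (u v : nat -> L) a b :
  rcvg u a -> rcvg v b -> rcvg (fun n => u n + v n) (a + b).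
Proof.
move=> ua vb e e0; have e2 : 0 < e / 2 by rewrite divr_gt0.
have [N hN] := ua _ e2; have [M hM] := vb _ e2.
exists (maxn N M) => n; rewrite geq_max => /andP[/hN h1 /hM h2].
have -> : u n + v n - (a + b) = (u n - a) + (v n - b) by rewrite opprD addrACA.
by rewrite (le_lt_trans (rnormD _ _)) // (splitr e) ltrD.
Qed.

Lemma rcvgZ (L : normedModType R[i]) (u : nat -> L) a (z : R[i]) :
  rcvg u a -> rcvg (fun n => z *: u n) (z *: a).
Proof.
move=> ua e e0; have z0 : 0 < rnorm z + 1 by rewrite ltr_pwDr ?rnorm_ge0.
have [N hN] := ua _ (divr_gt0 e0 z0); exists N => n /hN h.
rewrite -scalerBr rnormZ (@le_lt_trans _ _ ((rnorm z + 1) * rnorm (u n - a))) //.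
  by rewrite ler_wpM2r ?rnorm_ge0 // lerDl.
by rewrite mulrC -ltr_pdivlMr.
Qed.

Lemma rcvg_uniq (L : normedZmodType R[i]) (u : nat -> L) a b :
  rcvg u a -> rcvg u b -> a = b.
Proof.
move=> ua ub; apply/eqP; rewrite -subr_eq0; apply/eqP/rnorm0_eq0/eqP.
rewrite eq_le rnorm_ge0 andbT leNgt; apply/negP => e0.
have e2 := half_gt0 e0.
have [N hN] := ua _ e2; have [M hM] := ub _ e2.
have := hN _ (leq_maxl N M); have := hM _ (leq_maxr N M).
have := rnormB_triangle a (u (maxn N M)) b; rewrite (rnormBC a (u _)).
by move=> *; lra.
Qed.

Lemma rcvg_const (L : normedZmodType R[i]) (a : L) : rcvg (fun=> a) a.
Proof. by move=> e e0; exists 0%N => n _; rewrite subrr rnorm0. Qed.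

Lemma rcvg_sum (L : normedZmodType R[i]) (I : Type) (r : seq I)
    (u : I -> nat -> L) (a : I -> L) :
  (forall i, rcvg (u i) (a i)) ->
  rcvg (fun n => \sum_(i <- r) u i n) (\sum_(i <- r) a i).
Proof.
move=> ua; elim: r => [|i r IH].
  by under eq_fun do rewrite big_nil; rewrite big_nil; exact: rcvg_const.
by under eq_fun do rewrite big_cons; rewrite big_cons; exact: rcvgD.
Qed.

Lemma rcvg_norm (L : normedZmodType R[i]) (u : nat -> L) a :
  rcvg u a -> (fun n => rnorm (u n)) @ \oo --> rnorm a.
Proof.
move=> ua; apply/cvgrPdist_lt => e /ua[N h]; exists N => // n /h; apply: le_lt_trans.
rewrite distrC ler_norml; have := rnormD (u n - a) a; have := rnormD (a - u n) (u n).
by rewrite !subrK (rnormBC a (u _)) => *; apply/andP; split; lra.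
Qed.

End Limits.

(** * Completeness and inner product of the dual *)

Section DualComplete.
Context {R : realType} (V : lmodType R[i]) (P : hform V).
Implicit Types g h : dual P.

Lemma dual_rnorm g : rnorm g = Num.sqrt (dualQ g).
Proof. by []. Qed.

Lemma dual_rnorm_sqr g : rnorm g ^+ 2 = dualQ g.
Proof. by rewrite dual_rnorm sqr_sqrtr // dualQ_ge0. Qed.

(** Evaluation at v is bounded by sqrt (P v) times the norm, so a pointwise limit exists.
    Convergence in norm follows by letting m tend to infinity, for fixed v, in the inequality that
    defines [dualQ (u n - u m)] as a supremum. *)
Lemma dual_sequence_complete (u : nat -> dual P) :
  rcauchy u -> exists l, rcvg u l.
Proof.
move=> cu; pose l v := limn (fun n => u n v).
have uE (e : R) : 0 < e -> exists N, forall m n, (N <= m)%N -> (N <= n)%N ->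
    dualQ (u m - u n) < e ^+ 2.
  move=> e0; have [N h] := cu _ e0; exists N => m n Nm Nn.
  by rewrite -dual_rnorm_sqr ltr_pXn2r ?nnegrE ?rnorm_ge0 ?h // ltW.
have uv m n v : `|u m v - u n v| <= rnorm (u m - u n) * Num.sqrt (P v).
  rewrite dual_rnorm -sqrtrM ?dualQ_ge0 // -sqrtr_sqr ler_wsqrtr //.
  exact: (dual_dualQ (u m - u n)).
have cuv v : cvgn (fun n => u n v).
  apply: real_cauchy_cvg => e e0.
  have s0 : 0 < Num.sqrt (P v) + 1 by rewrite ltr_pwDr ?sqrtr_ge0.
  have [N h] := cu _ (divr_gt0 e0 s0); exists N => m n Nm Nn.
  apply: le_lt_trans (uv _ _ _) _; rewrite (@le_lt_trans _ _
    (rnorm (u m - u n) * (Num.sqrt (P v) + 1))) ?ler_wpM2l ?rnorm_ge0 ?lerDl //.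
  by rewrite -ltr_pdivlMr ?h.
have lP : l \in dual_pred P.
  apply/asboolP; split=> [v w|a v|].
  - apply: cvg_lim => //; under eq_fun do rewrite dualAD.
    exact: cvgD (cuv v) (cuv w).
  - apply: cvg_lim => //; under eq_fun do rewrite dualAZ.
    exact: cvgMr (cuv v).
  have [N h] := uE _ ltr01; have [C C0 uC] := dual_bound (u N).
  (* The constant comes from l^2 <= 2 (u N)^2 + 2 (u N - l)^2, whose last square is at most P v. *)
  exists (2 * C + 2) => [|v]; first by rewrite addr_ge0 ?mulr_ge0.
  have P0 := hilbertian_ge0 (hformP P) v.
  have lN : (u N v - l v) ^+ 2 <= P v.
    have h' n : (N <= n)%N -> `|u n v - u N v| <= Num.sqrt (P v).
      move=> Nn; apply: le_trans (uv _ _ _) _.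
      rewrite -[leRHS]mul1r ler_wpM2r ?sqrtr_ge0 // -(@ler_pXn2r _ 2) ?nnegrE //.
        by rewrite dual_rnorm_sqr ltW ?h.
      exact: rnorm_ge0.
    have : `|l v - u N v| <= Num.sqrt (P v).
      rewrite /l ler_distl; apply/andP; split.
        by apply: (limn_ge (N := N) (cuv v)) => k /h'; rewrite ler_distl => /andP[].
      by apply: (limn_le (N := N) (cuv v)) => k /h'; rewrite ler_distl => /andP[].
    rewrite -(@ler_pXn2r _ 2) ?nnegrE ?sqrtr_ge0 // sqr_sqrtr // distrC.
    by rewrite real_normK ?num_real.
  by have := uC v; have := sqr_ge0 (2 * u N v - l v); move=> *; nra.
exists (Dual lP) => e e0; have [N h] := uE _ (half_gt0 e0).
exists N => n Nn; rewrite -(@ltr_pXn2r _ 2) ?nnegrE ?rnorm_ge0 ?ltW //.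
rewrite dual_rnorm_sqr (@le_lt_trans _ _ ((e / 2) ^+ 2)) //; last first.
  by rewrite ltr_pXn2r ?nnegrE ?ltW // ?ltr_pdivrMr //; lra.
apply: dualQ_le => v; rewrite dualDE dualNE /= mulrBr lerBlDr lerBlDr.
rewrite -lerBlDl -ler_pdivrMl //; apply: (limn_ge (N := N) (cuv v)) => m Nm.
have := dualQ_ub (u n - u m) v; have := h _ _ Nn Nm.
by rewrite dualDE dualNE ler_pdivrMl // => *; lra.
Qed.

Lemma dual_complete (F : set_system (dual P)) :
  ProperFilter F -> cauchy F -> cvg F.
Proof.
move=> FF /cauchyP cF.
(* The centres of balls of radius 1 / (n + 1) belonging to the filter form a Cauchy sequence, and
   its limit is a limit of the filter. *)
have F0 n : exists x : dual P, F (ball x (n.+1%:R^-1)%:C).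
  by apply: cF; rewrite ltcR invr_gt0.
have [u hu] := choice F0.
have dist n m : rnorm (u n - u m) < n.+1%:R^-1 + m.+1%:R^-1.
  have [x [h1 h2]] := filter_ex (filterI (hu n) (hu m)).
  move: h1 h2; rewrite -!ball_normE /= !rnorm_lt => h1 h2.
  by rewrite (le_lt_trans (rnormB_triangle _ x _)) // ltrD // rnormBC.
have [|l ul] := @dual_sequence_complete u.
  move=> e e0; have [N hN] := harmonic_small (half_gt0 e0); exists N => m n Nm Nn.
  by rewrite (lt_trans (dist m n)) // (splitr e) ltrD ?hN.
apply/cvg_ex; exists l; apply/cvgrPdist_lt => _ /gt0_realC[e e0 ->].
have e2 := half_gt0 e0.
have [N hN] := harmonic_small e2; have [M hM] := ul _ e2.
apply: filterS (hu (maxn N M)) => x; rewrite -ball_normE /= !rnorm_lt => hx.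
rewrite (le_lt_trans (rnormB_triangle _ (u (maxn N M)) _)) // (splitr e) ltrD //.
  by rewrite rnormBC hM ?leq_maxr.
by rewrite (lt_trans hx) ?hN ?leq_maxl.
Qed.

HB.instance Definition _ := Uniform_isComplete.Build (dual P) dual_complete.

(* The complex inner product with real part [polar]. *)
Definition dual_dot g h : R[i] :=
  polar (@dualQ R V P) g h +i* polar (@dualQ R V P) g ('i%C *: h).

Let HQ : hilbertian (@dualQ R V P) := dualQP P.

Lemma dual_dotC g h : dual_dot g h = (dual_dot h g)^*%C.
Proof.
rewrite /dual_dot /= (polarC HQ); congr (_ +i* _).
rewrite (polarC HQ) (polarZJ HQ).
have -> : ('i^*)%C = - 'i%C :> R[i] by apply/eqP; rewrite eq_complex /= oppr0 !eqxx.
by rewrite scaleNr polarNr.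
Qed.

Lemma dual_dotDl g g' h : dual_dot (g + g') h = dual_dot g h + dual_dot g' h.
Proof. by rewrite /dual_dot !(polarDl HQ). Qed.

Lemma dual_dotZl (z : R[i]) g h : dual_dot (z *: g) h = z * dual_dot g h.
Proof.
case: z => a b; have -> : a +i* b = a%:C + b%:C * 'i%C.
  by apply/eqP; rewrite eq_complex /=; apply/andP; split; apply/eqP; ring.
rewrite scalerDl -scalerA dual_dotDl mulrDl /dual_dot !(polarZl HQ).
rewrite (polarii HQ).
have -> : polar (@dualQ R V P) ('i%C *: g) h = - polar (@dualQ R V P) g ('i%C *: h).
  rewrite (polarZJ HQ).
  have -> : ('i^*)%C = - 'i%C :> R[i] by apply/eqP; rewrite eq_complex /= oppr0 !eqxx.
  by rewrite scaleNr polarNr.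
by apply/eqP; rewrite eq_complex /=; apply/andP; split; apply/eqP; ring.
Qed.

Lemma dual_dotDr g h h' : dual_dot g (h + h') = dual_dot g h + dual_dot g h'.
Proof. by rewrite ![dual_dot g _]dual_dotC dual_dotDl rmorphD. Qed.

Lemma dual_dotZr (z : R[i]) g h : dual_dot g (z *: h) = (z^*)%C * dual_dot g h.
Proof. by rewrite ![dual_dot g _]dual_dotC dual_dotZl rmorphM. Qed.

Lemma dual_dot_diag g : dual_dot g g = (dualQ g)%:C.
Proof.
have := dual_dotC g g; rewrite /dual_dot (polar_diag HQ) => -[] /eqP.
by rewrite -addr_eq0 -mulr2n mulrn_eq0 /= => /eqP ->.
Qed.

Lemma dual_dot_bilinear : bilinear_for *%R (@Num.conj R[i] \; *%R) dual_dot.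
Proof.
by split=> u a x y /=; rewrite ?dual_dotDl ?dual_dotZl ?dual_dotDr ?dual_dotZr.
Qed.

Lemma dual_dot_herm g h :
  dual_dot g h = (-1) ^+ false * Num.conj (dual_dot h g).
Proof. by rewrite expr0 mul1r dual_dotC. Qed.

Lemma dual_dot_gt0 g : g != 0 -> 0 < dual_dot g g.
Proof.
move=> g0; rewrite dual_dot_diag ltcR lt_neqAle dualQ_ge0 andbT eq_sym.
by apply: contra g0 => /eqP h; rewrite -normr_eq0 rnormE dual_rnorm h sqrtr0.
Qed.

HB.instance Definition _ := @bilinear_isBilinear.Build R[i] (dual P) (dual P) R[i]
  *%R (@Num.conj R[i] \; *%R) dual_dot dual_dot_bilinear.
HB.instance Definition _ := isHermitianSesquilinear.Build R[i] (dual P) false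
  (@Num.conj R[i]) dual_dot dual_dot_herm.
HB.instance Definition _ := isDotProduct.Build R[i] (dual P) dual_dot dual_dot_gt0.

Lemma dual_hnormE g : `|g| ^+ 2 = dual_dot g g.
Proof. by rewrite dual_dot_diag rnormE -rmorphXn dual_rnorm_sqr. Qed.

Definition dual_hilbert : hilbert R :=
  @Hilbert R (dual P) (dual_dot : {dot (dual P) for (@Num.conj R[i])}) dual_hnormE.

End DualComplete.

(** * Extension from the dual and dilations *)

Section Hilbert.
Context {R : realType}.
Implicit Types H : hilbert R.

Lemma hnorm_hilbertian H : hilbertian (fun x : H => rnorm x ^+ 2).
Proof.
have E (x : H) : rnorm x ^+ 2 = complex.Re (hdot H x x).
  by rewrite -hnormE rnormE -rmorphXn.
split=> [c s v w cs|z v|v]; last exact: sqr_ge0.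
  have N : s%:C *: v - c%:C *: w = s%:C *: v + (- c)%:C *: w.
    by rewrite rmorphN scaleNr.
  rewrite N !E !(linearDl, linearDr, linearZl_LR, linearZr_LR) /=.
  move: (hdot H v v) (hdot H v w) (hdot H w v) (hdot H w w).
  move=> [a a'] [b b'] [d d'] [e e'] /=.
  by transitivity ((c ^+ 2 + s ^+ 2) * (a + e)); [ring|rewrite cs mul1r].
by rewrite rnormZ exprMn.
Qed.

Lemma linear0_fun (K : pzRingType) (V W : lmodType K) (u : V -> W) :
  linear u -> u 0 = 0.
Proof.
move=> h; have := h 1 0 0; rewrite !scale1r addr0 => h0.
by apply: (addrI (u 0)); rewrite addr0 -h0.
Qed.

Lemma linearZ_fun (K : pzRingType) (V W : lmodType K) (u : V -> W) a x :
  linear u -> u (a *: x) = a *: u x.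
Proof. by move=> h; have := h a x 0; rewrite !addr0 linear0_fun // addr0. Qed.

Lemma linearD_fun (K : pzRingType) (V W : lmodType K) (u : V -> W) x y :
  linear u -> u (x + y) = u x + u y.
Proof. by move=> h; have := h 1 x y; rewrite !scale1r. Qed.

Lemma linear_sum_fun (K : pzRingType) (V W : lmodType K) (u : V -> W)
    (I : Type) (r : seq I) (P : pred I) (F : I -> V) :
  linear u -> u (\sum_(i <- r | P i) F i) = \sum_(i <- r | P i) u (F i).
Proof.
move=> h; elim/big_rec2: _ => [|i y1 y2 _ <-]; first exact: linear0_fun.
by rewrite linearD_fun.
Qed.

Lemma opnorm_has_sup H1 H2 (u : H1 -> H2) (M : R) :
  (forall x, rnorm (u x) <= M * rnorm x) ->
  has_sup [set rnorm (u x) | x in [set x : H1 | rnorm x <= 1]].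
Proof.
move=> uM; split; first by exists (rnorm (u 0)); exists 0 => //=; rewrite rnorm0.
exists (Num.max M 0) => _ [x /= x1 <-]; apply: le_trans (uM x) _.
rewrite (@le_trans _ _ (Num.max M 0 * rnorm x)) //.
  by rewrite ler_wpM2r ?rnorm_ge0 // le_max lexx.
by rewrite -[leRHS]mulr1 ler_wpM2l // le_max lexx orbT.
Qed.

Lemma opnorm_le H1 H2 (u : H1 -> H2) (M : R) : 0 <= M ->
  (forall x, rnorm (u x) <= M * rnorm x) -> opnorm u <= M.
Proof.
move=> M0 uM; apply: sup_le_ub; first exact: (proj1 (opnorm_has_sup uM)).
move=> _ [x /= x1 <-]; rewrite (le_trans (uM x)) // -[leRHS]mulr1.
exact: ler_wpM2l.
Qed.

Lemma opnorm_ge0 H1 H2 (u : H1 -> H2) : bounded_op u -> 0 <= opnorm u.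
Proof.
case=> ul [M /opnorm_has_sup uM]; apply: (ub_le_sup (proj2 uM)).
by exists 0 => /=; rewrite ?linear0_fun ?rnorm0.
Qed.

Lemma opnormP H1 H2 (u : H1 -> H2) x : bounded_op u ->
  rnorm (u x) <= opnorm u * rnorm x.
Proof.
case=> ul [M uM]; have [/rnorm0_eq0 ->|x0] := eqVneq (rnorm x) 0.
  by rewrite linear0_fun // !rnorm0 mulr0.
have xp : 0 < rnorm x by rewrite lt_neqAle eq_sym x0 rnorm_ge0.
rewrite -ler_pdivrMr //; have hs := opnorm_has_sup uM; apply: (ub_le_sup (proj2 hs)).
exists ((rnorm x)^-1%:C *: x) => /=.
  by rewrite rnormZ rnormR ger0_norm ?invr_ge0 ?rnorm_ge0 // mulVf.
by rewrite linearZ_fun // rnormZ rnormR ger0_norm ?invr_ge0 ?rnorm_ge0 // mulrC.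
Qed.

End Hilbert.

Section GNS.
Context {R : realType} (G : groupType) (V : lmodType R[i]) (P : hform V).
Let HP := hformP P.

Lemma embed_subproof (v : V) : (fun w => polar P v w) \in dual_pred P.
Proof.
apply/asboolP; split=> [w w'|a w|]; first exact: (polarDr HP).
  exact: (polarZr HP).
by exists (P v) => [|w]; [exact: (hilbertian_ge0 HP)|exact: (polar_CS HP)].
Qed.

(** The Riesz map. Its kernel consists of the null vectors of P. *)
Definition embed (v : V) : dual P := Dual (embed_subproof v).

Lemma embed_linear : linear embed.
Proof.
move=> a v w; apply: dualP => x; rewrite dualDE dualZE /=.
by rewrite (polarDl HP) (polarZJ HP).
Qed.

(** The change of variable w + v in the supremum. When v nearly attains [dualQ g] the right-hand
    side is small, which is the density of the image of [embed]. *)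
Lemma dualQ_subembed (g : dual P) v :
  dualQ (g - embed v) = dualQ g - 2 * g v + P v.
Proof.
have E w : 2 * (g - embed v) w - P w =
    2 * g (w + v) - P (w + v) - 2 * g v + P v.
  rewrite dualDE dualNE /= dualAD (hilbertianD HP) (polarC HP w); ring.
apply/le_anti/andP; split.
  by apply: dualQ_le => w; rewrite E !lerD2r dualQ_ub.
rewrite -lerBrDr lerBlDr; apply: dualQ_le => w.
have := dualQ_ub (g - embed v) (w - v); rewrite E subrK => h; lra.
Qed.

Lemma embedB v w : embed (v - w) = embed v - embed w.
Proof.
by rewrite -scaleN1r addrC embed_linear scaleN1r addrC.
Qed.

Lemma embed_norm v : rnorm (embed v) = Num.sqrt (P v).
Proof.
rewrite dual_rnorm; congr Num.sqrt.
have := dualQ_subembed (embed v) v.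
rewrite subrr (hilbertian0 (dualQP P)) /= (polar_diag HP) => h; lra.
Qed.

Lemma embed_dense (g : dual P) (e : R) : 0 < e ->
  exists v, rnorm (g - embed v) < e.
Proof.
move=> e0; have [v hv] := dualQ_approx g (exprn_gt0 2 e0); exists v.
rewrite -(@ltr_pXn2r _ 2) ?nnegrE ?rnorm_ge0 ?ltW // dual_rnorm_sqr.
by rewrite dualQ_subembed; lra.
Qed.

Lemma dense_eq0 (H : hilbert R) (x : H) (C : R) :
  (forall e : R, 0 < e -> rnorm x <= C * e) -> x = 0.
Proof.
move=> h; apply/rnorm0_eq0/eqP; rewrite eq_le rnorm_ge0 andbT leNgt.
apply/negP => x0; have C0 : 0 < C.
  by have := h _ ltr01; rewrite mulr1; exact: lt_le_trans.
have := h (rnorm x / (2 * C)) (divr_gt0 x0 (mulr_gt0 (ltr0Sn _ 1) C0)).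
have -> : C * (rnorm x / (2 * C)) = rnorm x / 2 by field; rewrite gt_eqF.
by move=> ?; lra.
Qed.

(** The value at g is pinned down by lying within [rnorm (g - embed v)] of [xi0 v] for every v.
    Linearity, contractivity and agreement with [xi0] all follow from this property, with no return
    to approximating sequences. *)
Lemma embed_extension (H : hilbert R) (xi0 : V -> H) : linear xi0 ->
  (forall v, rnorm (xi0 v) ^+ 2 <= P v) ->
  exists xi : dual P -> H,
    [/\ linear xi, forall g, rnorm (xi g) <= rnorm g
      & forall v, xi (embed v) = xi0 v].
Proof.
move=> xl xP.
have xB v w : rnorm (xi0 v - xi0 w) <= rnorm (embed v - embed w).
  rewrite -embedB embed_norm -(@ler_pXn2r _ 2) ?nnegrE ?rnorm_ge0 ?sqrtr_ge0 //.
  rewrite sqr_sqrtr ?(hilbertian_ge0 HP) //; suff <- : xi0 (v - w) = xi0 v - xi0 w by [].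
  by rewrite linearD_fun // -scaleN1r linearZ_fun // scaleN1r.
have /choice[xi xiP] (g : dual P) :
    exists y : H, forall v, rnorm (y - xi0 v) <= rnorm (g - embed v).
  have e0 (n : nat) : 0 < (n.+1%:R^-1 : R) by rewrite invr_gt0.
  have /choice[v hv] n := embed_dense g (e0 n).
  have [|y hy] := @rcauchy_rcvg R H (xi0 \o v).
    move=> e /half_gt0/harmonic_small[N hN]; exists N => m n Nm Nn /=.
    apply: le_lt_trans (xB _ _) _.
    rewrite (le_lt_trans (rnormB_triangle _ g _)) // (splitr e) ltrD //.
      by rewrite rnormBC (lt_trans (hv _)) ?hN.
    by rewrite (lt_trans (hv _)) ?hN.
  exists y => w; apply/ler_addgt0Pr => e /half_gt0 e2.
  have [N hN] := harmonic_small e2; have [M hM] := hy _ e2.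
  set n := maxn N M; have := hN n (leq_maxl _ _); have := hM n (leq_maxr _ _).
  have := hv n; rewrite /= (rnormBC _ y) => h1 h2 h3.
  have h4 := rnormB_triangle y (xi0 (v n)) (xi0 w); have h5 := xB (v n) w.
  have h6 := rnormB_triangle (embed (v n)) g (embed w).
  rewrite (rnormBC _ g) in h6.
  apply: le_trans h4 _; apply: le_trans (lerD (ltW h2) (le_trans h5 h6)) _.
  rewrite addrA [leRHS]addrC lerD2r [leRHS](splitr e).
  exact: lerD (ltW (lt_trans h1 h3)).
exists xi; split.
- move=> a g h; apply/eqP; rewrite -subr_eq0; apply/eqP.
  apply: (@dense_eq0 _ _ (2 * (rnorm a + 1))) => e e0.
  have [v hv] := embed_dense g e0; have [w hw] := embed_dense h e0.
  have -> : xi (a *: g + h) - (a *: xi g + xi h) =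
      (xi (a *: g + h) - xi0 (a *: v + w)) - (a *: (xi g - xi0 v) + (xi h - xi0 w)).
    by rewrite xl scalerBr [in RHS]addrACA -opprD opprB addrA subrK.
  apply: le_trans (rnormD _ _) _; rewrite rnormN.
  apply: le_trans (lerD (xiP _ _) (rnormD _ _)) _.
  have -> : a *: g + h - embed (a *: v + w) = a *: (g - embed v) + (h - embed w).
    by rewrite embed_linear scalerBr opprD addrACA.
  apply: le_trans (lerD (rnormD _ _) (lexx _)) _; rewrite !rnormZ.
  have := xiP g v; have := xiP h w; have := rnorm_ge0 a => a0 h1 h2.
  have h3 : rnorm a * rnorm (xi g - xi0 v) <= rnorm a * e.
    by rewrite ler_wpM2l // (le_trans h2 (ltW hv)).
  have h4 : rnorm a * rnorm (g - embed v) <= rnorm a * e.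
    by rewrite ler_wpM2l // ltW.
  have h5 := le_trans h1 (ltW hw); move/ltW: hw => h6.
  by apply: le_trans (lerD (lerD h4 h6) (lerD h3 h5)) _; lra.
- by move=> g; have := xiP g 0; rewrite linear0_fun // linear0_fun ?subr0 //; exact: embed_linear.
- move=> v; apply/eqP; rewrite -subr_eq0; apply/eqP/rnorm0_eq0/eqP.
  by rewrite eq_le rnorm_ge0 andbT (le_trans (xiP _ _)) // subrr rnorm0.
Qed.
End GNS.

Section Representation.
Context {R : realType} (G : groupType) (V : lmodType R[i]) (P : hform V).
Variable act : G -> V -> V.
Hypotheses (actl : forall t, linear (act t)) (act1 : forall v, act 1%g v = v)
  (actM : forall s t v, act (s * t)%g v = act s (act t v))
  (actP : forall t v, P (act t v) = P v).
Let HP := hformP P.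

Lemma polar_act t v w : polar P (act t v) (act t w) = polar P v w.
Proof.
by rewrite /polar -scaleN1r -linearZ_fun // -!linearD_fun // !actP scaleN1r.
Qed.

Lemma dual_rep_subproof t (g : dual P) :
  (fun v => g (act t^-1%g v)) \in dual_pred P.
Proof.
apply/asboolP; split=> [v w|a v|]; first by rewrite linearD_fun // dualAD.
  by rewrite linearZ_fun // dualAZ.
by have [C C0 gC] := dual_bound g; exists C => // v; rewrite -(actP t^-1%g v).
Qed.

Definition dual_rep t (g : dual P) : dual P := Dual (dual_rep_subproof t g).

Lemma dual_rep_linear t : linear (dual_rep t).
Proof.
by move=> a g h; apply: dualP => v; rewrite !(dualDE, dualZE) /= linearZ_fun.
Qed.

Lemma dual_rep1 g : dual_rep 1%g g = g.
Proof. by apply: dualP => v /=; rewrite invg1 act1. Qed.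

Lemma dual_repM s t g : dual_rep (s * t)%g g = dual_rep s (dual_rep t g).
Proof. by apply: dualP => v /=; rewrite invgM actM. Qed.

Lemma dual_repQ t g : dualQ (dual_rep t g) = dualQ g.
Proof.
have le s h : dualQ (dual_rep s h) <= dualQ h.
  by apply: dualQ_le => v /=; rewrite -(actP s^-1%g v) dualQ_ub.
apply/le_anti; rewrite le /= -{1}(dual_rep1 g) -(mulVg t) dual_repM; exact: le.
Qed.

Lemma dual_rep_polar t g h :
  polar (@dualQ _ _ P) (dual_rep t g) (dual_rep t h) = polar (@dualQ _ _ P) g h.
Proof.
rewrite /polar -scaleN1r -linearZ_fun; last exact: dual_rep_linear.
by rewrite -!linearD_fun ?dual_repQ ?scaleN1r //; exact: dual_rep_linear.
Qed.

Lemma dual_rep_unitary : unitary_rep (dual_rep : G -> dual_hilbert P -> dual_hilbert P).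
Proof.
split; [|exact: dual_rep1|exact: dual_repM].
move=> t; split; first exact: dual_rep_linear.
  move=> g h; rewrite /hdot /= /dual_dot -linearZ_fun; last exact: dual_rep_linear.
  by rewrite !dual_rep_polar.
by exists (dual_rep t^-1%g) => g; rewrite -dual_repM ?mulVg ?mulgV dual_rep1.
Qed.

Lemma dual_rep_embed t v : dual_rep t (embed P v) = embed P (act t v).
Proof.
by apply: dualP => w /=; rewrite -(polar_act t) -actM mulgV act1.
Qed.

Lemma gns_factorization (H : hilbert R) (K : R) (eta0 : H -> V) (xi0 : V -> H) :
  0 <= K -> linear eta0 -> linear xi0 ->
  (forall h, P (eta0 h) <= K ^+ 2 * rnorm h ^+ 2) ->
  (forall v, rnorm (xi0 v) ^+ 2 <= P v) ->
  exists (Hpi : hilbert R) (pi : G -> Hpi -> Hpi) (xi : Hpi -> H) (eta : H -> Hpi),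
    [/\ unitary_rep pi, bounded_op xi, bounded_op eta,
        (forall t h, xi0 (act t (eta0 h)) = xi (pi t (eta h)))
      & opnorm xi * opnorm eta <= K].
Proof.
move=> K0 el xl eP xP; have [xi [xil xib xie]] := embed_extension xl xP.
pose eta h : dual_hilbert P := embed P (eta0 h).
have etab h : rnorm (eta h) <= K * rnorm h.
  rewrite embed_norm -(@ler_pXn2r _ 2) ?nnegrE ?sqrtr_ge0 ?mulr_ge0 ?rnorm_ge0 //.
  by rewrite sqr_sqrtr ?exprMn // (hilbertian_ge0 HP).
have xib' (g : dual_hilbert P) : rnorm (xi g) <= 1 * rnorm g by rewrite mul1r.
exists (dual_hilbert P), dual_rep, xi, eta.
have bxi : bounded_op (xi : dual_hilbert P -> H) by split=> //; exists 1.
have beta : bounded_op eta.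
  by split=> [a x y|]; [rewrite /eta el embed_linear|exists K].
split=> //; first exact: dual_rep_unitary.
  by move=> t h; rewrite dual_rep_embed xie.
by rewrite -[leRHS]mul1r ler_pM ?opnorm_ge0 // opnorm_le.
Qed.

End Representation.

(** * Minimal subadditive functionals on finite families *)

Section MinimalFunctional.
Context {R : realType} (V : lmodType R[i]).
Variables (U : set (V -> V)) (g : V -> R).
Hypothesis g_ge0 : forall v, 0 <= g v.
Implicit Types (q : seq V -> R) (x y z : seq V).

Let Gs z := \sum_(v <- z) g v.

Let Gs_ge0 z : 0 <= Gs z.
Proof. exact: sumr_ge0. Qed.

(* Functionals on finite families of vectors, regarded as positive quadratic
   elements sum_v |v><v|; an additive one is given by a quadratic form on V. *)
Record good q : Prop := Good {
  good_subadd : forall x y, q (x ++ y) <= q x + q y;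
  good_perm : forall x y, perm_eq x y -> q x = q y;
  good_refl : forall (c s : R) v w x, c ^+ 2 + s ^+ 2 = 1 ->
    q ((c%:C *: v + s%:C *: w) :: (s%:C *: v - c%:C *: w) :: x) <=
    q (v :: w :: x);
  good_homog : forall (a : R) x, q [seq a%:C *: v | v <- x] <= a ^+ 2 * q x;
  good_act : forall u v x, U u -> q (u v :: x) <= q (v :: x);
  good_lower : forall x z, q x + Gs z <= q (x ++ z) }.

Section Good.
Variables (q : seq V -> R) (hq : good q).

Lemma good_nil : q [::] = 0.
Proof.
have := good_subadd hq [::] [::]; have := good_homog hq 0 [::].
by rewrite /= expr0n mul0r => h1 h2; lra.
Qed.

Lemma good_ge x : Gs x <= q x.
Proof. by have := good_lower hq [::] x; rewrite good_nil add0r. Qed.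

Lemma good_cons v x : q x <= q (v :: x).
Proof.
rewrite (good_perm hq (_ : perm_eq (v :: x) (x ++ [:: v]))); last first.
  exact: (permEl (perm_catC [:: v] x)).
by apply: le_trans (good_lower hq _ _); rewrite lerDl.
Qed.

Lemma good_scale1 (a : R) v : q [:: a%:C *: v] = a ^+ 2 * q [:: v].
Proof.
apply/le_anti; rewrite (good_homog hq a [:: v]) /=.
have [->|a0] := eqVneq a 0.
  by rewrite expr0n mul0r (le_trans (Gs_ge0 _) (good_ge _)).
have := good_homog hq a^-1 [:: a%:C *: v].
rewrite /= scalerA -rmorphM mulVf // scale1r exprVn => h.
by rewrite mulrC -ler_pdivlMr ?exprn_even_gt0 // mulrC.
Qed.

(* The usual way to lower a sublinear functional: keep its value at v and make
   it linear there. *)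
Definition lower_at v x : R := inf (range (fun a : R => q (a%:C *: v :: x) - a ^+ 2 * q [:: v])).

Lemma lower_at_has_inf v x :
  has_inf (range (fun a : R => q (a%:C *: v :: x) - a ^+ 2 * q [:: v])).
Proof.
split; first by exists (q (0%:C *: v :: x) - 0 ^+ 2 * q [:: v]); exists 0.
exists 0 => _ [a _ <-]; rewrite subr_ge0 -good_scale1.
by apply: le_trans (good_lower hq [:: _] x); rewrite lerDl.
Qed.

Lemma lower_at_lb v x (a : R) :
  lower_at v x <= q (a%:C *: v :: x) - a ^+ 2 * q [:: v].
Proof. by apply: (ge_inf (proj2 (lower_at_has_inf v x))); exists a. Qed.

Lemma lower_at_ge v x c :
  (forall a : R, c <= q (a%:C *: v :: x) - a ^+ 2 * q [:: v]) -> c <= lower_at v x.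
Proof.
move=> h; apply: lb_le_inf => [|_ [a _ <-]//]; exact: (proj1 (lower_at_has_inf v x)).
Qed.

Lemma lower_at_approx v x e : 0 < e ->
  exists a : R, q (a%:C *: v :: x) - a ^+ 2 * q [:: v] < lower_at v x + e.
Proof.
by move=> e0; have [_ [a _ <-] ?] := inf_adherent e0 (lower_at_has_inf v x); exists a.
Qed.

(** A plane reflection turns a v, b v into r v, 0 with r^2 = a^2 + b^2, and dropping the zero vector
    cannot increase q. This combines the parameters that are nearly optimal for two families when
    [lower_at] is shown to be subadditive. *)
Lemma good_merge (a b : R) v x :
  q ((Num.sqrt (a ^+ 2 + b ^+ 2))%:C *: v :: x) <=
  q (a%:C *: v :: b%:C *: v :: x).
Proof.
set r := Num.sqrt _.
have rr : r ^+ 2 = a ^+ 2 + b ^+ 2 by rewrite sqr_sqrtr // addr_ge0 ?sqr_ge0.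
have key (c s : R) : c ^+ 2 + s ^+ 2 = 1 -> c * a + s * b = r ->
    s * a - c * b = 0 -> q (r%:C *: v :: x) <= q (a%:C *: v :: b%:C *: v :: x).
  move=> cs h1 h2; apply: le_trans (good_refl hq _ _ _ cs).
  rewrite !scalerA -scalerDl -scalerBl -!rmorphM -rmorphD -rmorphB h1 h2.
  rewrite (good_perm hq (_ : perm_eq (r%:C *: v :: 0%:C *: v :: x)
      (0%:C *: v :: r%:C *: v :: x))).
    exact: good_cons.
  exact: (permEl (perm_catCA [:: _] [:: _] x)).
have [r0|r0] := eqVneq r 0.
  have a0 : a = 0 by move: rr; rewrite r0 => h; have := sqr_ge0 b; nra.
  have b0 : b = 0 by move: rr; rewrite r0 => h; have := sqr_ge0 a; nra.
  by apply: (key 1 0); rewrite ?a0 ?b0 ?r0 //; ring.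
apply: (key (a / r) (b / r)).
- by rewrite !exprMn -mulrDl -rr -exprMn mulfV // expr1n.
- by rewrite ![_ / r * _]mulrAC -mulrDl -!expr2 -rr expr2 mulfK.
- by field.
Qed.

Lemma lower_at_good v : good (lower_at v).
Proof.
have perm1 x y w : perm_eq x y -> perm_eq (w :: x) (w :: y) by rewrite perm_cons.
split.
- move=> x y; apply/ler_addgt0Pr => e /half_gt0 e2.
  have [a ha] := lower_at_approx v x e2; have [b hb] := lower_at_approx v y e2.
  have := lower_at_lb v (x ++ y) (Num.sqrt (a ^+ 2 + b ^+ 2)).
  rewrite sqr_sqrtr ?addr_ge0 ?sqr_ge0 // => h1.
  have h2 := good_merge a b v (x ++ y).
  have h3 := good_subadd hq (a%:C *: v :: x) (b%:C *: v :: y).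
  have h4 : q ((a%:C *: v :: x) ++ (b%:C *: v :: y)) =
            q (a%:C *: v :: b%:C *: v :: x ++ y).
    apply: (good_perm hq); rewrite perm_cons.
    exact: (permEl (perm_catCA x [:: _] y)).
  by rewrite h4 in h3; lra.
- move=> x y xy; rewrite /lower_at.
  set F := fun a : R => q (_ :: x) - _; set F' := fun a : R => q (_ :: y) - _.
  suff -> : F = F' by [].
  by apply/funext => a; rewrite /F (good_perm hq (perm1 _ _ _ xy)).
- move=> c s w w' x cs; apply: lower_at_ge => a; apply: le_trans (lower_at_lb _ _ a) _.
  rewrite lerD2r.
  rewrite (good_perm hq (permEl (perm_catCA [:: _] [:: _; _] x))) /=.
  rewrite [leRHS](good_perm hq (permEl (perm_catCA [:: _] [:: _; _] x))) /=.
  exact: good_refl.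
- move=> b x; apply/ler_addgt0Pr => e e0.
  (* The added 1 keeps the tolerance e / (b^2 + 1) meaningful when b = 0. *)
  have b0 : 0 < b ^+ 2 + 1 by rewrite ltr_wpDl ?sqr_ge0.
  have [a ha] := lower_at_approx v x (divr_gt0 e0 b0).
  have := lower_at_lb v [seq b%:C *: u | u <- x] (b * a).
  have := good_homog hq b (a%:C *: v :: x); rewrite /= scalerA -rmorphM => h1 h2.
  have h3 : b ^+ 2 * (e / (b ^+ 2 + 1)) <= e.
    rewrite mulrA ler_pdivrMr // mulrC ler_wpM2l ?ltW //; lra.
  have h4 : b ^+ 2 * (q (a%:C *: v :: x) - a ^+ 2 * q [:: v]) <=
      b ^+ 2 * (lower_at v x + e / (b ^+ 2 + 1)) by rewrite ler_wpM2l ?sqr_ge0 ?ltW.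
  by rewrite exprMn in h2; lra.
- move=> u w x Uu; apply: lower_at_ge => a; apply: le_trans (lower_at_lb _ _ a) _.
  rewrite lerD2r (good_perm hq (permEl (perm_catCA [:: _] [:: _] x))) /=.
  rewrite [leRHS](good_perm hq (permEl (perm_catCA [:: _] [:: _] x))) /=.
  exact: (good_act hq _ _ Uu).
- move=> x z; apply: lower_at_ge => a.
  have := lower_at_lb v x a; have := good_lower hq (a%:C *: v :: x) z.
  by rewrite /= => *; lra.
Qed.

Lemma lower_at_le v x : lower_at v x <= q x.
Proof.
have := lower_at_lb v x 0; have := good_subadd hq [:: 0%:C *: v] x.
by rewrite /= good_scale1 => *; lra.
Qed.

End Good.

(** The pointwise infimum is finite because of the common lower bound [Gs]. That A is a chain enters
    through subadditivity: of two nearly optimal functionals the smaller one serves both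
    families. *)
Lemma good_chain_inf (A : set (seq V -> R)) :
  A !=set0 -> (forall q, A q -> good q) ->
  (forall q r, A q -> A r -> (forall x, q x <= r x) \/ (forall x, r x <= q x)) ->
  exists2 q, good q & forall r x, A r -> q x <= r x.
Proof.
move=> [q0 Aq0] Agood Atot; pose F x := inf [set q x | q in A].
have hi x : has_inf [set q x | q in A].
  split; first by exists (q0 x); exists q0.
  by exists (Gs x) => _ [q /Agood hq <-]; exact: good_ge.
have Fle q x : A q -> F x <= q x.
  by move=> Aq; apply: (ge_inf (proj2 (hi x))); exists q.
have Fge x c : (forall q, A q -> c <= q x) -> c <= F x.
  by move=> h; apply: lb_le_inf => [|_ [q /h qc <-]//]; exact: (proj1 (hi x)).
have Fap x e : 0 < e -> exists2 q, A q & q x < F x + e.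
  by move=> e0; have [_ [q Aq <-] ?] := inf_adherent e0 (hi x); exists q.
exists F => //; split.
- move=> x y; apply/ler_addgt0Pr => e /half_gt0 e2.
  have [q Aq hq] := Fap x _ e2; have [r Ar hr] := Fap y _ e2.
  have [m [Am mq mr]] : exists m, [/\ A m, forall x, m x <= q x & forall x, m x <= r x].
    by have [le|le] := Atot _ _ Aq Ar; [exists q|exists r].
  have := Fle _ (x ++ y) Am; have := good_subadd (Agood _ Am) x y.
  by have := mq x; have := mr y => *; lra.
- move=> x y xy; apply/le_anti/andP; split; apply: Fge => q Aq.
    by rewrite -(good_perm (Agood _ Aq) xy) Fle.
  by rewrite (good_perm (Agood _ Aq) xy) Fle.
- move=> c s v w x cs; apply: Fge => q Aq.
  exact: le_trans (Fle _ _ Aq) (good_refl (Agood _ Aq) _ _ _ cs).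
- move=> b x; apply/ler_addgt0Pr => e e0.
  have b0 : 0 < b ^+ 2 + 1 by rewrite ltr_wpDl ?sqr_ge0.
  have [q Aq hq] := Fap x _ (divr_gt0 e0 b0).
  apply: le_trans (Fle _ _ Aq) _; apply: le_trans (good_homog (Agood _ Aq) b x) _.
  apply: le_trans (ler_wpM2l (sqr_ge0 b) (ltW hq)) _; rewrite mulrDr lerD2l.
  by rewrite mulrA ler_pdivrMr // mulrC ler_wpM2l ?ltW // ltrDl.
- move=> u v x Uu; apply: Fge => q Aq.
  exact: le_trans (Fle _ _ Aq) (good_act (Agood _ Aq) _ _ Uu).
- move=> x z; apply: Fge => q Aq; apply: le_trans (good_lower (Agood _ Aq) x z).
  by rewrite lerD2r Fle.
Qed.

(** A minimal q coincides with each [lower_at q v], and the parameter 1 in that infimum gives the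
    missing superadditivity. *)
Lemma exists_additive p : good p -> exists q,
  [/\ good q, forall x, q x <= p x & forall v x, q (v :: x) = q [:: v] + q x].
Proof.
move=> hp; pose T := {q | good q /\ forall x, q x <= p x}.
(* The order is reversed, so that the maximal elements of Zorn's lemma are minimal functionals. *)
pose rl (s t : T) := `[< forall x, sval t x <= sval s x >].
have [||||[q [hq qp]] qmin] := @Zorn T rl.
- by move=> t; apply/asboolP.
- move=> r s t /asboolP rs /asboolP st; apply/asboolP => x.
  exact: le_trans (st x) (rs x).
- move=> [s ps] [t pt] /asboolP/= st /asboolP/= ts.
  have E : s = t by apply/funext => x; apply/le_anti; rewrite ts st.
  by subst t; congr exist; exact: Prop_irrelevance.
(* The empty chain is bounded by p itself. *)
- move=> A Atot; have [[t At]|A0] := pselect (exists t, A t); last first.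
    by exists (exist _ p (conj hp (fun x => lexx _))) => s As; case: A0; exists s.
  have [|_ [s _ <-]|_ _ [r Ar <-] [s As <-]|q hq qA] :=
      @good_chain_inf [set sval t | t in A].
  + by exists (sval t); exists t.
  + by case: (svalP s).
  + by have [/asboolP|/asboolP] := Atot _ _ Ar As; [right|left].
  have qp x : q x <= p x.
    by apply: le_trans (qA (sval t) x _) (proj2 (svalP t) x); exists t.
  by exists (exist _ q (conj hq qp)) => s As; apply/asboolP => x; apply: qA; exists s.
exists q; split=> // v x; apply/le_anti; rewrite (good_subadd hq [:: v]) /=.
pose s : T := exist _ (lower_at q v) (conj (lower_at_good hq v)
  (fun x => le_trans (lower_at_le hq v x) (qp x))).
have /(congr1 sval)/= qE : s = exist _ q (conj hq qp).
  by apply: qmin; apply/asboolP => y /=; exact: lower_at_le.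
have := lower_at_lb hq v x 1; rewrite qE scale1r expr1n mul1r => h; lra.
Qed.

(** Reflections are involutions and the inverse of a phase is a phase, so the one-sided inequalities
    of [good] become equalities. A complex scalar is split into its modulus, covered by
    [good_scale1], and a phase, which belongs to U. *)
Lemma exists_form p : good p ->
  (forall z : R[i], rnorm z = 1 -> U ( *:%R z)) ->
  exists P : hform V, [/\ forall v, P v <= p [:: v],
    forall u v, U u -> P (u v) <= P v & forall v, g v <= P v].
Proof.
move=> hp Uz; have [q [hq qp qD]] := exists_additive hp.
have G1 v : g v = Gs [:: v] by rewrite /Gs big_seq1.
have le c s v w : c ^+ 2 + s ^+ 2 = 1 ->
    q [:: c%:C *: v + s%:C *: w] + q [:: s%:C *: v - c%:C *: w] <=
    q [:: v] + q [:: w].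
  by move=> cs; rewrite -!qD; exact: good_refl.
have Pz (z : R[i]) v : rnorm z = 1 -> q [:: z *: v] <= q [:: v].
  by move=> /Uz; exact: good_act.
have HP : hilbertian (fun v => q [:: v]).
  split=> [c s v w cs|z v|v].
  - apply/le_anti; rewrite le //=.
    have := le c s (c%:C *: v + s%:C *: w) (s%:C *: v - c%:C *: w) cs.
    have -> : c%:C *: (c%:C *: v + s%:C *: w) + s%:C *: (s%:C *: v - c%:C *: w) = v.
      rewrite !scalerDr !scalerN !scalerA -!rmorphM [s * c]mulrC addrACA subrr.
      by rewrite addr0 -scalerDl -rmorphD -!expr2 cs scale1r.
    have -> : s%:C *: (c%:C *: v + s%:C *: w) - c%:C *: (s%:C *: v - c%:C *: w) = w.
      rewrite !scalerDr !scalerN !scalerA -!rmorphM [s * c]mulrC opprB.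
      rewrite [(c * s)%:C *: v + _]addrC addrACA subrr addr0 -scalerDl -rmorphD.
      by rewrite addrC -!expr2 cs scale1r.
    exact.
  - have [->|z0] := eqVneq z 0.
      rewrite rnorm0 expr0n mul0r -[0](rmorph0 (real_complex R)).
      by rewrite (good_scale1 hq) expr0n mul0r.
    have nz : rnorm z != 0 by apply: contraNneq z0 => /rnorm0_eq0 ->.
    have nzC : (rnorm z)%:C != 0 :> R[i] by apply: contraNneq nz => /complexI ->.
    have inv (a : R[i]) : rnorm a^-1 = (rnorm a)^-1.
      by apply: complexI; rewrite -rnormE normfV rnormE fmorphV.
    have -> : z *: v = (rnorm z)%:C *: ((z / (rnorm z)%:C) *: v).
      by rewrite scalerA mulrC divfK.
    have n1 : rnorm (z / (rnorm z)%:C) = 1.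
      by rewrite rnormM inv rnormR ger0_norm ?rnorm_ge0 // mulfV.
    rewrite (good_scale1 hq); congr (_ * _); apply/le_anti; rewrite Pz //=.
    have := Pz (z / (rnorm z)%:C)^-1 (z / (rnorm z)%:C *: v).
    rewrite scalerA mulVf ?scale1r; last by rewrite mulf_neq0 ?invr_neq0.
    by apply; rewrite inv n1 invr1.
  - by apply: le_trans (good_ge hq [:: v]); rewrite -G1.
exists (HForm HP); split=> [v|u v Uu|v] /=; first exact: qp.
  exact: (good_act hq _ _ Uu).
by rewrite G1; exact: good_ge.
Qed.

End MinimalFunctional.

(** * Admissible families *)

Section Admissible.
Context {R : realType} (G : groupType) (Gamma : set G).
Hypothesis Gamma1 : Gamma 1%g.
Hypothesis Gamma_gen : forall g : G, exists s : seq G,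
  (forall x, x \in s -> Gamma x) /\ g = (\prod_(x <- s) x)%g.
Variables (V : lmodType R[i]) (H : hilbert R) (act : G -> V -> V).
Variables (eta0 : H -> V) (xi0 : V -> H) (K : R).
Hypotheses (actl : forall t, linear (act t)) (act1 : forall v, act 1%g v = v)
  (actM : forall s t v, act (s * t)%g v = act s (act t v))
  (etal : linear eta0) (xil : linear xi0) (K_ge0 : 0 <= K).
Hypothesis span : forall v, exists s : seq (G * H),
  v = \sum_(th <- s) act th.1 (eta0 th.2).

(* Families obtained from [eta0 h] (of energy K^2 times the sum of the
   |h|^2) by scalar isometries and diagonal matrices with entries in Gamma. *)
Inductive adm : seq V -> R -> Prop :=
| adm_base (hs : seq H) :
    adm [seq eta0 h | h <- hs] (K ^+ 2 * \sum_(h <- hs) rnorm h ^+ 2)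
| adm_perm l l' E : perm_eq l l' -> adm l E -> adm l' E
| adm_refl (c s : R) v w l E : c ^+ 2 + s ^+ 2 = 1 -> adm (v :: w :: l) E ->
    adm ((c%:C *: v + s%:C *: w) :: (s%:C *: v - c%:C *: w) :: l) E
| adm_act (z : R[i]) t v l E : rnorm z = 1 -> Gamma t -> adm (v :: l) E ->
    adm (z *: act t v :: l) E.

Lemma adm_scale (a : R) l E :
  adm l E -> adm [seq a%:C *: v | v <- l] (a ^+ 2 * E).
Proof.
elim=> [hs|l1 l2 E' l12 _ IH|c s v w l' E' cs _ IH|z t v l' E' z1 Gt _ IH] /=.
- rewrite -map_comp; have := adm_base [seq a%:C *: h | h <- hs].
  rewrite -map_comp big_map.
  under eq_bigr do rewrite rnormZ rnormR exprMn real_normK ?num_real //.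
  rewrite -mulr_sumr mulrCA; congr (adm _ _); apply: eq_map => h /=.
  by rewrite linearZ_fun.
- by apply: adm_perm IH; exact: perm_map.
- have := adm_refl cs IH.
  by rewrite scalerBr scalerDr !scalerA !(mulrC a%:C).
- have := adm_act z1 Gt IH.
  by rewrite linearZ_fun // !scalerA mulrC.
Qed.

Lemma adm_cat_base l E (hs : seq H) : adm l E ->
  adm (l ++ [seq eta0 h | h <- hs]) (E + K ^+ 2 * \sum_(h <- hs) rnorm h ^+ 2).
Proof.
elim=> [hs'|l1 l2 E' l12 _ IH|c s v w l' E' cs _ IH|z t v l' E' z1 Gt _ IH] /=.
- by rewrite -map_cat -mulrDr -big_cat; exact: adm_base.
- by apply: adm_perm IH; rewrite perm_cat2r.
- exact: adm_refl.
- exact: adm_act.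
Qed.

(** Apart from permutations, a rule changes at most two leading vectors, so one family can be built
    beside the other. [adm_cat_base] starts the second family and permutations bring its active
    vectors to the front. *)
Lemma adm_cat l E l' E' : adm l E -> adm l' E' -> adm (l ++ l') (E + E').
Proof.
move=> al al'; elim: al' => {l' E'}
  [hs|l1 l2 E' l12 _ IH|c s v w l' E' cs _ IH|z t v l' E' z1 Gt _ IH] /=.
- exact: adm_cat_base.
- by apply: adm_perm IH; rewrite perm_cat2l.
- apply: adm_perm (permEl (perm_catCA [:: _; _] l l')) _; apply: adm_refl => //.
  exact: adm_perm (permEl (perm_catCA l [:: _; _] l')) IH.
- apply: adm_perm (permEl (perm_catCA [:: _] l l')) _; apply: adm_act => //.
  exact: adm_perm (permEl (perm_catCA l [:: _] l')) IH.
Qed.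

Lemma adm_act_gen t v l E : adm (v :: l) E -> adm (act t v :: l) E.
Proof.
have [s [sG ->]] := Gamma_gen t.
elim: s sG v => [|x s IH] sG v av; first by rewrite big_nil act1.
rewrite big_cons actM -[act x _]scale1r; apply: adm_act.
- by rewrite /rnorm normr1.
- by apply: sG; rewrite inE eqxx.
- by apply: IH => // y ys; apply: sG; rewrite inE ys orbT.
Qed.

(** Makes the infimum that defines the initial functional in [dilation] one over a nonempty set. *)
Lemma adm_exists x : exists z E, adm (x ++ z) E.
Proof.
have single v : exists z E, adm (v :: z) E.
  have [s ->] := span v; elim: s => [|[t h] s [z [E az]]].
    exists [::], (K ^+ 2 * \sum_(h <- [:: 0 : H]) rnorm h ^+ 2).
    by rewrite big_nil; have := adm_base [:: 0]; rewrite /= linear0_fun.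
  rewrite big_cons /=; set u := act t _; set w := \sum_(_ <- _) _.
  have au : adm [:: u] (K ^+ 2 * \sum_(h <- [:: h]) rnorm h ^+ 2).
    by apply: adm_act_gen; exact: (adm_base [:: h]).
  have r0 : 0 < (2 : R) by [].
  (* The reflection with c = s, rescaled by sqrt 2, has u + w as its first entry; the other entry
     joins the completion z. *)
  have cs : (Num.sqrt 2)^-1 ^+ 2 + (Num.sqrt 2)^-1 ^+ 2 = 1 :> R.
    by rewrite exprVn sqr_sqrtr ?ltW //; field.
  have n0 : Num.sqrt 2 != 0 :> R by rewrite gt_eqF // sqrtr_gt0.
  have := adm_scale (Num.sqrt 2) (adm_refl cs (adm_cat au az)).
  rewrite /= scalerDr !scalerA -!rmorphM /= mulfV // !scale1r => ?.
  by do 2 eexists; eassumption.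
elim: x => [|v x [z [E az]]].
  by exists [::], (K ^+ 2 * \sum_(h <- [::]) rnorm (h : H) ^+ 2); exact: (adm_base [::]).
have [z' [E' az']] := single v; exists (z' ++ z), (E' + E).
by apply: adm_perm (adm_cat az' az); rewrite /= perm_cons perm_catCA.
Qed.

(** The initial functional is the least energy of an admissible family containing x, less the amount
    [Gs z] accounted for by the completing vectors z. Soundness of the energy then says
    [Gs x <= p x]. *)
Lemma dilation :
  (forall l E, adm l E -> \sum_(v <- l) rnorm (xi0 v) ^+ 2 <= E) ->
  exists (Hpi : hilbert R) (pi : G -> Hpi -> Hpi) (xi : Hpi -> H) (eta : H -> Hpi),
    [/\ unitary_rep pi, bounded_op xi, bounded_op eta,
        (forall t h, xi0 (act t (eta0 h)) = xi (pi t (eta h)))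
      & opnorm xi * opnorm eta <= K].
Proof.
move=> sound; pose g v := rnorm (xi0 v) ^+ 2; pose Gs z := \sum_(v <- z) g v.
pose U : set (V -> V) :=
  [set u | exists z t, [/\ rnorm z = 1, Gamma t & u = fun v => z *: act t v]].
pose S x : set R := [set r | exists z E, adm (x ++ z) E /\ r = E - Gs z].
pose p x := inf (S x).
have Gcat x z : Gs (x ++ z) = Gs x + Gs z by rewrite /Gs big_cat.
have g0 v : 0 <= g v by exact: sqr_ge0.
have Slb x r : S x r -> Gs x <= r.
  by move=> [z [E [/sound h ->]]]; rewrite lerBrDr -Gcat.
have hi x : has_inf (S x).
  split; last by exists (Gs x) => r /Slb.
  by have [z [E az]] := adm_exists x; exists (E - Gs z), z, E.
have ple x z E : adm (x ++ z) E -> p x <= E - Gs z.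
  by move=> az; apply: (ge_inf (proj2 (hi x))); exists z, E.
have pge x c : (forall z E, adm (x ++ z) E -> c <= E - Gs z) -> c <= p x.
  move=> h; apply: lb_le_inf => [|_ [z [E [az ->]]]]; last exact: h.
  exact: (proj1 (hi x)).
have pap x e : 0 < e -> exists z E, adm (x ++ z) E /\ E - Gs z < p x + e.
  move=> e0; have [_ [z [E [az ->]]] ?] := inf_adherent e0 (hi x).
  by exists z, E.
have pgood : good U g p.
  split.
  - move=> x y; apply/ler_addgt0Pr => e /half_gt0 e2.
    have [z [E [az hz]]] := pap x _ e2; have [z' [E' [az' hz']]] := pap y _ e2.
    have : adm ((x ++ y) ++ (z ++ z')) (E + E').
      apply: adm_perm (adm_cat az az'); rewrite -!catA perm_cat2l !catA perm_cat2r.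
      by rewrite perm_catC.
    by move/ple; rewrite Gcat => h; lra.
  - move=> x y xy; apply/le_anti/andP; split; apply: pge => z E az; apply: ple;
      by apply: adm_perm az; rewrite perm_cat2r // perm_sym.
  - by move=> c s v w x cs; apply: pge => z E az; apply: ple; exact: adm_refl.
  - move=> a x; apply/ler_addgt0Pr => e e0.
    have a0 : 0 < a ^+ 2 + 1 by rewrite ltr_wpDl ?sqr_ge0.
    have [z [E [az hz]]] := pap x _ (divr_gt0 e0 a0).
    have := adm_scale a az; rewrite map_cat => /ple.
    have -> : Gs [seq a%:C *: v | v <- z] = a ^+ 2 * Gs z.
      rewrite /Gs big_map mulr_sumr; apply: eq_bigr => v _.
      by rewrite /g linearZ_fun // rnormZ rnormR exprMn real_normK ?num_real.
    rewrite -mulrBr => h; apply: le_trans h _.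
    apply: le_trans (ler_wpM2l (sqr_ge0 a) (ltW hz)) _; rewrite mulrDr lerD2l.
    by rewrite mulrA ler_pdivrMr // mulrC ler_wpM2l ?ltW // ltrDl.
  - move=> _ v x [z [t [z1 Gt ->]]]; apply: pge => y E ay; apply: ple.
    exact: adm_act.
  - move=> x z; apply: pge => y E; rewrite -catA => /ple.
    by rewrite Gcat -/(Gs z) => h; lra.
have [|P [Pp PU Pg]] := exists_form g0 pgood.
  move=> z z1; exists z, 1%g; split=> //.
  by apply/funext => v; rewrite act1.
have Ple t v : P (act t v) <= P v.
  have [s [sG ->]] := Gamma_gen t.
  elim: s sG v => [|x s IH] sG v; first by rewrite big_nil act1.
  rewrite big_cons actM.
  apply: (@le_trans _ _ (P (act (\prod_(j <- s) j)%g v))).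
    rewrite -[act x _]scale1r; apply: (PU (fun v => 1 *: act x v)).
    by exists 1, x; split=> //; [rewrite /rnorm normr1|apply: sG; rewrite inE eqxx].
  by apply: IH => y ys; apply: sG; rewrite inE ys orbT.
(* The inverse of t is again a product of elements of Gamma, so the inequality reverses. *)
have PE t v : P (act t v) = P v.
  by apply/le_anti; rewrite Ple /= -{1}(act1 v) -(mulVg t) actM Ple.
apply: (gns_factorization actl act1 actM PE K_ge0 etal xil) => // h.
apply: le_trans (Pp _) _.
have /(ple [:: _]) := adm_base [:: h].
by rewrite /Gs big_nil subr0 big_seq1.
Qed.

End Admissible.

(** * Factorizations *)

Section Chain.
Context {R : realType} (G : groupType) (Gamma : set G) (Gamma1 : Gamma 1%g).
Variables (V : lmodType R[i]) (H : hilbert R) (act : G -> V -> V).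
Variables (eta0 : H -> V) (xi0 : V -> H) (f : G -> H -> H) (K : R).
Hypotheses (actl : forall t, linear (act t)) (act1 : forall v, act 1%g v = v)
  (actM : forall s t v, act (s * t)%g v = act s (act t v))
  (etal : linear eta0) (xil : linear xi0) (K_ge0 : 0 <= K).
Hypothesis fE : forall t h, xi0 (act t (eta0 h)) = f t h.

Lemma hcast_linear (H1 H2 : hilbert R) (e : H1 = H2) : linear (hcast e).
Proof. by case: H2 / e. Qed.

Lemma rnorm_hcast (H1 H2 : hilbert R) (e : H1 = H2) x :
  rnorm (hcast e x) = rnorm x.
Proof. by case: H2 / e. Qed.

Definition factorization (N : nat) (Hs : nat -> hilbert R) (e1 : Hs 0%N = H)
    (eN : Hs N = H) (F : forall i, Gamma -> Hs i.+1 -> Hs i) : Prop :=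
  (forall i t, (i < N)%N -> bounded_op (F i t) /\ opnorm (F i t) <= 1) /\
  (forall (t : nat -> Gamma) (h : H), f (\prod_(i < N) val (t i))%g h =
     K%:C *: hcast e1 (op_prod F t (hcast (esym eN) h))).

Section OneChain.
Variables (N : nat) (Hs : nat -> hilbert R) (e1 : Hs 0%N = H)
  (eN : Hs N = H) (F : forall i, Gamma -> Hs i.+1 -> Hs i).
Hypothesis HF : factorization e1 eN F.

Lemma op_prod_ext (t t' : nat -> Gamma) k (y : Hs k) :
  (forall i, (i < k)%N -> t i = t' i) -> op_prod F t y = op_prod F t' y.
Proof.
elim: k y => [|k IH] y tt //=; rewrite tt // IH // => i ik.
by apply: tt; exact: ltnW.
Qed.

Lemma op_prod_linear (t : nat -> Gamma) k : (k <= N)%N ->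
  linear (@op_prod R _ Hs F t k).
Proof.
elim: k => [|k IH] kN a x y //=.
by have [[Fl _] _] := HF.1 k (t k) kN; rewrite Fl IH // ltnW.
Qed.

(** y stands in for v at the k-th intermediate space: the first k factors applied to y give the
    values of v on k-fold products. The energy can then be measured by norms in a Hilbert space on
    which the factors are contractions. *)
Definition lifts k (v : V) (y : Hs k) : Prop := forall t : nat -> Gamma,
  xi0 (act (\prod_(i < k) val (t i))%g v) = K%:C *: hcast e1 (op_prod F t y).

Lemma lifts_comb k (a b : R[i]) v w (y z : Hs k) : (k <= N)%N ->
  lifts v y -> lifts w z -> lifts (a *: v + b *: w) (a *: y + b *: z).
Proof.
move=> kN vy wz t; rewrite actl xil vy (linearZ_fun _ _ (actl _)) (linearZ_fun _ _ xil) wz.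
rewrite op_prod_linear // hcast_linear scalerDr.
rewrite (linearZ_fun _ _ (op_prod_linear t kN)) (linearZ_fun _ _ (hcast_linear e1)).
by rewrite !scalerA !(mulrC K%:C).
Qed.

Lemma lifts_act k (s : Gamma) v (y : Hs k.+1) :
  lifts v y -> lifts (act (val s) v) (F s y).
Proof.
(* Position k is the last one read by k + 1 factors, so s is the letter that acts first on v. *)
move=> vy t; pose t' i := if i == k then s else t i.
have := vy t'; rewrite big_ord_recr /= {2 4}/t' eqxx actM.
rewrite (@op_prod_ext t' t); last by move=> i ik; rewrite /t' ltn_eqF.
by rewrite (eq_bigr (fun i : 'I_k => val (t i))) // => i _; rewrite /t' ltn_eqF.
Qed.

(** At level N the vector h is itself a lift. Factors evaluated at the unit lead down to level k
    without changing the lifted vector or increasing the norm. *)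
Lemma lifts_base h k : (k <= N)%N ->
  exists2 y : Hs k, lifts (eta0 h) y & rnorm y <= rnorm h.
Proof.
move=> kN; rewrite -(subKn kN); elim: (N - k)%N (leq_subr k N) => [|d IH] dN.
  rewrite subn0; exists (hcast (esym eN) h); last by rewrite rnorm_hcast.
  by move=> t; rewrite fE HF.2.
have [|y hy yh] := IH; first exact: ltnW.
move: y hy yh; have -> : (N - d)%N = (N - d.+1).+1 by rewrite subnSK.
move=> y hy yh; pose s := exist _ 1%g (mem_set Gamma1) : Gamma.
exists (F s y); first by have := @lifts_act _ s _ _ hy; rewrite act1.
have lt : (N - d.+1 < N)%N by rewrite ltn_subrL; case: (N) dN.
have [Fb F1] := HF.1 _ s lt; apply: le_trans (opnormP y Fb) _.
by apply: le_trans yh; rewrite -[leRHS]mul1r ler_wpM2r ?rnorm_ge0.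
Qed.

End OneChain.

Lemma factorization_contract N Hs e1 eN F (HF : @factorization N Hs e1 eN F)
    k (s : Gamma) (y : Hs k.+1) : (k < N)%N -> rnorm (F k s y) ^+ 2 <= rnorm y ^+ 2.
Proof.
move=> kN; have [Fb F1] := HF.1 k s kN.
rewrite ler_pXn2r ?nnegrE ?rnorm_ge0 //; apply: le_trans (opnormP y Fb) _.
by rewrite -[leRHS]mul1r ler_wpM2r ?rnorm_ge0.
Qed.

(** n0 counts the uses of [adm_act] in building l, so it depends on l and not on a factorization.
    Each use lowers the level by one; the vectors that do not move pass through the same factor at
    the unit, which keeps the whole family on one level. *)
Lemma adm_lifts l E : adm Gamma act eta0 K l E ->
  exists n0, forall N Hs e1 eN F, @factorization N Hs e1 eN F ->
    forall k, (k + n0 <= N)%N -> exists zs : seq (V * Hs k),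
      [/\ [seq p.1 | p <- zs] = l,
          K ^+ 2 * \sum_(p <- zs) rnorm p.2 ^+ 2 <= E
        & forall p, p \in zs -> lifts e1 F p.1 p.2].
Proof.
elim=> {l E} [hs|l1 l2 E l12 _ [n0 IH]|c s v w l E cs _ [n0 IH]|z t v l E z1 Gt _ [n0 IH]].
- exists 0%N => N Hs e1 eN F HF k; rewrite addn0 => kN.
  elim: hs => [|h hs [zs [zl zE zp]]].
    by exists [::]; split=> //; rewrite !big_nil.
  have [y hy yh] := lifts_base HF h kN; exists ((eta0 h, y) :: zs).
  split=> /=; first by rewrite zl.
    rewrite !big_cons /= !mulrDr lerD // ler_wpM2l ?sqr_ge0 //.
    by rewrite ler_pXn2r ?nnegrE ?rnorm_ge0.
  by move=> p; rewrite inE => /predU1P[->|/zp].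
- exists n0 => N Hs e1 eN F HF k kN; have [zs [zl zE zp]] := IH _ _ _ _ _ HF _ kN.
  move: l12; rewrite -zl perm_sym => /(perm_iotaP 0)[Is pI ->].
  rewrite size_map in pI.
  have pz : perm_eq [seq nth (0, 0) zs i | i <- Is] zs.
    rewrite -[X in perm_eq _ X](mkseq_nth (0, 0)); exact: perm_map.
  exists [seq nth (0, 0) zs i | i <- Is]; split.
  + rewrite -map_comp; apply/eq_in_map => i; rewrite (perm_mem pI) mem_iota /= => iz.
    by rewrite (nth_map (0, 0)).
  + by rewrite (perm_big _ pz).
  + by move=> p; rewrite (perm_mem pz) => /zp.
- exists n0 => N Hs e1 eN F HF k kN.
  have [zs [zl zE zp]] := IH _ _ _ _ _ HF _ kN.
  case: zs zl zE zp => [//|[v' y] [//|[w' y'] zs]] /= [-> -> zl] zE zp.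
  have kN' : (k <= N)%N by apply: leq_trans kN; rewrite leq_addr.
  have yv : lifts e1 F v y by apply: (zp (v, y)); rewrite inE eqxx.
  have yw : lifts e1 F w y' by apply: (zp (w, y')); rewrite !inE eqxx orbT.
  exists ((c%:C *: v + s%:C *: w, c%:C *: y + s%:C *: y') ::
          (s%:C *: v - c%:C *: w, s%:C *: y - c%:C *: y') :: zs); split=> /=.
  + by rewrite zl.
  + move: zE; rewrite !big_cons /= !addrA.
    by case: (hnorm_hilbertian (Hs k)) => + _ _ => /(_ c s y y' cs) ->.
  + move=> p; rewrite !inE => /or3P[/eqP ->|/eqP ->|pz] /=.
    * exact: (lifts_comb HF).
    * by rewrite -!scaleNr; exact: (lifts_comb HF).
    * by apply: zp; rewrite !inE pz !orbT.
- exists n0.+1 => N Hs e1 eN F HF k; rewrite addnS -addSn => kN.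
  have [zs [zl zE zp]] := IH _ _ _ _ _ HF _ kN.
  case: zs zl zE zp => [//|[v' y] zs] /= [-> zl] zE zp.
  have kN' : (k < N)%N by apply: leq_trans kN; rewrite leq_addr.
  pose one := exist _ 1%g (mem_set Gamma1) : Gamma.
  pose st := exist _ t (mem_set Gt) : Gamma.
  exists ((z *: act t v, z *: F k st y) :: [seq (p.1, F k one p.2) | p <- zs]).
  split=> /=.
  + by rewrite -map_comp /= -zl.
  + apply: le_trans zE; rewrite !big_cons big_map /= ler_wpM2l ?sqr_ge0 //.
    rewrite rnormZ z1 mul1r lerD ?(factorization_contract HF) //.
    by apply: ler_sum => p _; exact: (factorization_contract HF).
  + move=> p; rewrite inE => /predU1P[->|/mapP[q qz ->]] /=.
      have -> : z *: act t v = z *: act t v + 0 *: act t v by rewrite scale0r addr0.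
      have -> : z *: F k st y = z *: F k st y + 0 *: F k st y.
        by rewrite scale0r addr0.
      have hy : lifts e1 F (act t v) (F k st y).
        apply: (@lifts_act _ e1 F k st); apply: (zp (v, y)).
        by rewrite inE eqxx.
      exact: (lifts_comb HF _ _ (ltnW kN')).
    have hq : lifts e1 F q.1 q.2 by apply: zp; rewrite inE qz orbT.
    by have := @lifts_act _ e1 F k one _ _ hq; rewrite act1.
Qed.

Lemma factorization_sound :
  (forall N, (0 < N)%N -> exists Hs e1 eN F, @factorization N Hs e1 eN F) ->
  forall l E, adm Gamma act eta0 K l E -> \sum_(v <- l) rnorm (xi0 v) ^+ 2 <= E.
Proof.
move=> fac l E /adm_lifts[n0 h].
(* The successor is there because n0 may be 0. At level 0 the product is empty and lifting reads
   [xi0 v = K y]. *)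
have [Hs [e1 [eN [F HF]]]] := fac n0.+1 isT.
have [|zs [<- zE zp]] := h _ _ _ _ _ HF 0%N; first by rewrite add0n.
apply: le_trans zE; rewrite big_map mulr_sumr le_eqVlt; apply/orP; left; apply/eqP.
apply: eq_big_seq => p pz; have := zp p pz (fun=> exist _ 1%g (mem_set Gamma1)).
rewrite big_ord0 act1 => ->.
by rewrite rnormZ rnormR ger0_norm // rnorm_hcast exprMn.
Qed.

End Chain.

(** * Matrices of operators and matrix norms *)

Section OperatorMatrices.
Context {R : realType}.
Implicit Types H : hilbert R.

(** A norm bound stated for all h at once, meaningful before the supremum in [opmx_norm] is known to
    be finite. *)
Definition opbd H1 H2 m n (T : 'M[H1 -> H2]_(m, n)) (c : R) : Prop :=
  forall h : 'I_n -> H1, \sum_i rnorm (\sum_j T i j (h j)) ^+ 2 <=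
    c ^+ 2 * \sum_j rnorm (h j) ^+ 2.

(** The bound is imposed on all amplifications of C to Hilbert space vectors, the form in which C
    meets operator matrices. *)
Definition scalar_bd m n (C : 'M[R[i]]_(m, n)) (c : R) : Prop :=
  forall H (h : 'I_n -> H), \sum_i rnorm (\sum_j C i j *: h j) ^+ 2 <=
    c ^+ 2 * \sum_j rnorm (h j) ^+ 2.

Lemma sumr_sqr_le (I : Type) (r : seq I) (a : I -> R) : (forall i, 0 <= a i) ->
  \sum_(i <- r) a i ^+ 2 <= (\sum_(i <- r) a i) ^+ 2.
Proof.
move=> a0; elim: r => [|i r IH]; first by rewrite !big_nil expr0n.
rewrite !big_cons; have : 0 <= \sum_(j <- r) a j by exact: sumr_ge0.
by have := a0 i; move: IH; set S := \sum_(j <- r) a j => *; nra.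
Qed.

Lemma opbd_entries H1 H2 m n (T : 'M[H1 -> H2]_(m, n)) (M : 'I_m -> 'I_n -> R) :
  (forall i j, 0 <= M i j) -> (forall i j x, rnorm (T i j x) <= M i j * rnorm x) ->
  opbd T (\sum_i \sum_j M i j).
Proof.
move=> M0 TM h; set S := \sum_j rnorm (h j) ^+ 2.
have S0 : 0 <= S by apply: sumr_ge0 => j _; exact: sqr_ge0.
have hS j : rnorm (h j) <= Num.sqrt S.
  rewrite -(@ler_pXn2r _ 2) ?nnegrE ?rnorm_ge0 ?sqrtr_ge0 // sqr_sqrtr //.
  by rewrite /S (bigD1 j) //= lerDl; apply: sumr_ge0 => k _; exact: sqr_ge0.
rewrite -(sqr_sqrtr S0) -exprMn mulr_suml.
apply: (@le_trans _ _ (\sum_i ((\sum_j M i j) * Num.sqrt S) ^+ 2)).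
  apply: ler_sum => i _.
  have Mi0 : 0 <= \sum_j M i j by exact: sumr_ge0.
  rewrite ler_pXn2r ?nnegrE ?rnorm_ge0 ?mulr_ge0 ?sqrtr_ge0 //.
  apply: le_trans (rnorm_sum _ _ _) _; rewrite mulr_suml; apply: ler_sum => j _.
  by apply: le_trans (TM i j _) _; rewrite ler_wpM2l.
by apply: sumr_sqr_le => i; rewrite mulr_ge0 ?sqrtr_ge0 // sumr_ge0.
Qed.

Lemma opmx_has_sup H1 H2 m n (T : 'M[H1 -> H2]_(m, n)) (c : R) : opbd T c ->
  has_sup [set Num.sqrt (\sum_i rnorm (\sum_j T i j (h j)) ^+ 2) |
       h in [set h : 'I_n -> H1 | \sum_j rnorm (h j) ^+ 2 <= 1]].
Proof.
move=> Tc; split.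
  eexists; exists (fun=> 0) => //=; rewrite big1 // => j _.
  by rewrite rnorm0 expr0n.
exists `|c| => _ [h /= h1 <-]; rewrite -sqrtr_sqr ler_wsqrtr //.
by apply: le_trans (Tc h) _; rewrite -[leRHS]mulr1 ler_wpM2l ?sqr_ge0.
Qed.

Lemma opmx_norm_le H1 H2 m n (T : 'M[H1 -> H2]_(m, n)) (c : R) :
  0 <= c -> opbd T c -> opmx_norm T <= c.
Proof.
move=> c0 Tc; apply: sup_le_ub; first exact: (proj1 (opmx_has_sup Tc)).
move=> _ [h /= h1 <-]; rewrite -[leRHS]ger0_norm // -sqrtr_sqr ler_wsqrtr //.
by apply: le_trans (Tc h) _; rewrite -[leRHS]mulr1 ler_wpM2l ?sqr_ge0.
Qed.

Lemma opmx_norm_ge0 H1 H2 m n (T : 'M[H1 -> H2]_(m, n)) (c : R) :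
  opbd T c -> 0 <= opmx_norm T.
Proof.
move=> Tc; apply: (@le_trans _ _ (Num.sqrt (\sum_i rnorm (\sum_j T i j 0) ^+ 2))).
  exact: sqrtr_ge0.
apply: (ub_le_sup (proj2 (opmx_has_sup Tc))); exists (fun=> 0) => //=.
by rewrite big1 // => j _; rewrite rnorm0 expr0n.
Qed.

Definition mx_bounded H1 H2 m n (T : 'M[H1 -> H2]_(m, n)) : Prop :=
  forall i j, bounded_op (T i j).

Lemma bounded_opP H1 H2 (u : H1 -> H2) : bounded_op u ->
  exists2 M, 0 <= M & forall x, rnorm (u x) <= M * rnorm x.
Proof.
case=> _ [M uM]; exists (Num.max M 0); first by rewrite le_max lexx orbT.
by move=> x; apply: le_trans (uM x) _; rewrite ler_wpM2r ?rnorm_ge0 // le_max lexx.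
Qed.

Lemma opbd_exists H1 H2 m n (T : 'M[H1 -> H2]_(m, n)) :
  mx_bounded T -> exists c, opbd T c.
Proof.
move=> Tb; have /choice[M hM] (p : 'I_m * 'I_n) : exists M, 0 <= M /\
    forall x, rnorm (T p.1 p.2 x) <= M * rnorm x.
  by have [M M0 h] := bounded_opP (Tb p.1 p.2); exists M.
exists (\sum_i \sum_j M (i, j)); apply: opbd_entries => i j.
  exact: (proj1 (hM (i, j))).
exact: (proj2 (hM (i, j))).
Qed.

Lemma opmx_normP H1 H2 m n (T : 'M[H1 -> H2]_(m, n)) :
  mx_bounded T -> opbd T (opmx_norm T).
Proof.
move=> Tb h; have [c Tc] := opbd_exists Tb; set S := \sum_j rnorm (h j) ^+ 2.
have S0 : 0 <= S by apply: sumr_ge0 => j _; exact: sqr_ge0.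
move: S0; rewrite le_eqVlt => /predU1P[S0|S0].
  by have := Tc h; rewrite -/S -S0 !mulr0.
set r := Num.sqrt S; have r0 : 0 < r by rewrite sqrtr_gt0.
have rr : r ^+ 2 = S by rewrite sqr_sqrtr // ltW.
have scale j : rnorm ((r^-1)%:C *: h j) ^+ 2 = r ^- 2 * rnorm (h j) ^+ 2.
  by rewrite rnormZ rnormR exprMn real_normK ?num_real // exprVn.
have : Num.sqrt (\sum_i rnorm (\sum_j T i j ((r^-1)%:C *: h j)) ^+ 2) <= opmx_norm T.
  apply: (ub_le_sup (proj2 (opmx_has_sup Tc))); exists (fun j => (r^-1)%:C *: h j) => //=.
  by under eq_bigr do rewrite scale; rewrite -mulr_sumr -/S -rr mulVf ?gt_eqF // exprn_gt0.
have T0 := opmx_norm_ge0 Tc; move=> le.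
have : Num.sqrt (\sum_i rnorm (\sum_j T i j ((r^-1)%:C *: h j)) ^+ 2) ^+ 2 <=
    opmx_norm T ^+ 2 by rewrite ler_pXn2r ?nnegrE ?sqrtr_ge0.
rewrite sqr_sqrtr; last by apply: sumr_ge0 => i _; exact: sqr_ge0.
rewrite (eq_bigr (fun i => r ^- 2 * rnorm (\sum_j T i j (h j)) ^+ 2)).
  by rewrite -mulr_sumr mulrC ler_pdivrMr ?exprn_gt0 // rr.
move=> i _; rewrite (eq_bigr (fun j => (r^-1)%:C *: T i j (h j))); last first.
  by move=> j _; rewrite linearZ_fun //; case: (Tb i j).
by rewrite -scaler_sumr rnormZ rnormR exprMn real_normK ?num_real // exprVn.
Qed.

Lemma opbd_lim H1 H2 m n (T : 'M[H1 -> H2]_(m, n)) (c : R) : 0 <= c ->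
  (forall e, 0 < e -> opbd T (c + e)) -> opbd T c.
Proof.
move=> c0 Tc h; set S := \sum_j rnorm (h j) ^+ 2.
have S0 : 0 <= S by apply: sumr_ge0 => j _; exact: sqr_ge0.
(* For t <= 1, (c + t)^2 S exceeds c^2 S by at most t (2 c + 1) S. Adding e makes d positive, so
   that e / d can serve as t. *)
apply/ler_addgt0Pr => e e0; set d := (2 * c + 1) * S + e.
have d0 : 0 < d by rewrite ltr_wpDl // mulr_ge0 // addr_ge0 // mulr_ge0.
pose t := Num.min 1 (e / d).
have t0 : 0 < t by rewrite lt_min ltr01 divr_gt0.
have t1 : t <= 1 by rewrite ge_min lexx.
have td : t * d <= e by rewrite -ler_pdivlMr // ge_min lexx orbT.
apply: le_trans (Tc t t0 h) _; rewrite -/S.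
have : t * t * S <= t * S by rewrite ler_wpM2r // -[leRHS]mulr1 ler_wpM2l // ltW.
by have : 0 <= t * e by [rewrite mulr_ge0 // ltW]; move: td; rewrite /d => *; nra.
Qed.

Lemma opbd_weaken H1 H2 m n (T : 'M[H1 -> H2]_(m, n)) (c d : R) :
  0 <= c -> c <= d -> opbd T c -> opbd T d.
Proof.
move=> c0 cd Tc h; apply: le_trans (Tc h) _.
rewrite ler_wpM2r ?ler_pXn2r ?nnegrE ?(le_trans c0 cd) //.
by apply: sumr_ge0 => j _; exact: sqr_ge0.
Qed.

End OperatorMatrices.

Section ScalarAction.
Context {R : realType}.

Definition lscale (V : lmodType R[i]) m n p (C : 'M[R[i]]_(m, n)) (x : 'M[V]_(n, p)) :
  'M[V]_(m, p) := \matrix_(i, j) \sum_k C i k *: x k j.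

Definition rscale (V : lmodType R[i]) m n p (x : 'M[V]_(m, n)) (C : 'M[R[i]]_(n, p)) :
  'M[V]_(m, p) := \matrix_(i, j) \sum_k C k j *: x i k.

Lemma fct_sumE (T : Type) (V : zmodType) (I : Type) (r : seq I) (P : pred I)
  (F : I -> T -> V) t : (\sum_(i <- r | P i) F i) t = \sum_(i <- r | P i) F i t.
Proof. by elim/big_rec2: _ => [|i y1 y2 _ <-]. Qed.

Lemma opbd_lscale (H1 H2 : hilbert R) m n p (C : 'M[R[i]]_(m, n))
    (T : 'M[H1 -> H2]_(n, p)) c d :
  scalar_bd C c -> opbd T d -> opbd (lscale C T) (c * d).
Proof.
move=> Cc Td h; rewrite exprMn -mulrA.
apply: (le_trans _ (ler_wpM2l (sqr_ge0 c) (Td h))).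
apply: (le_trans _ (Cc H2 (fun k => \sum_j T k j (h j)))); apply: ler_sum => i _.
rewrite le_eqVlt; apply/orP; left; apply/eqP; congr (rnorm _ ^+ 2).
under eq_bigr do rewrite mxE fct_sumE.
by rewrite exchange_big; apply: eq_bigr => k _; rewrite scaler_sumr.
Qed.

Lemma opbd_rscale (H1 H2 : hilbert R) m n p (C : 'M[R[i]]_(n, p))
    (T : 'M[H1 -> H2]_(m, n)) c d :
  (forall i j, linear (T i j)) -> scalar_bd C c -> opbd T d ->
  opbd (rscale T C) (c * d).
Proof.
move=> Tl Cc Td h; rewrite (mulrC c) exprMn -mulrA.
apply: (le_trans _ (ler_wpM2l (sqr_ge0 d) (Cc H1 h))).
apply: (le_trans _ (Td (fun k => \sum_j C k j *: h j))); apply: ler_sum => i _.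
rewrite le_eqVlt; apply/orP; left; apply/eqP; congr (rnorm _ ^+ 2).
under eq_bigr do rewrite mxE fct_sumE.
rewrite exchange_big; apply: eq_bigr => k _.
rewrite linear_sum_fun //; apply: eq_bigr => j _; by rewrite linearZ_fun.
Qed.

Lemma opbd_block (H1 H2 : hilbert R) m n m' n' (S : 'M[H1 -> H2]_(m, n))
    (T : 'M[H1 -> H2]_(m', n')) c :
  opbd S c -> opbd T c -> opbd (block_mx S 0 0 T) c.
Proof.
move=> Sc Tc h; rewrite !big_split_ord /= mulrDr.
have z0 (k : nat) (u : 'I_k -> H1) : \sum_j (0 : H1 -> H2) (u j) = 0.
  by rewrite big1.
apply: lerD.
  apply: (le_trans _ (Sc (fun j => h (lshift _ j)))); apply: ler_sum => i _.
  rewrite le_eqVlt; apply/orP; left; apply/eqP; congr (rnorm _ ^+ 2).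
  rewrite big_split_ord /= [X in _ + X]big1 ?addr0.
    by apply: eq_bigr => j _; rewrite block_mxEul.
  by move=> j _; rewrite block_mxEur mxE.
apply: (le_trans _ (Tc (fun j => h (rshift _ j)))); apply: ler_sum => i _.
rewrite le_eqVlt; apply/orP; left; apply/eqP; congr (rnorm _ ^+ 2).
rewrite big_split_ord /= [X in X + _]big1 ?add0r.
  by apply: eq_bigr => j _; rewrite block_mxEdr.
by move=> j _; rewrite block_mxEdl mxE.
Qed.

Lemma scalar_bd_diag n (d : 'I_n -> R[i]) (c : R) :
  (forall i, rnorm (d i) <= c) -> scalar_bd (\matrix_(i, j) (d i *+ (i == j))) c.
Proof.
move=> dc H h; rewrite mulr_sumr; apply: ler_sum => i _.
rewrite (bigD1 i) //= big1 ?addr0 => [|j ji]; last first.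
  by rewrite mxE eq_sym (negPf ji) mulr0n scale0r.
rewrite mxE eqxx mulr1n rnormZ exprMn ler_wpM2r ?sqr_ge0 //.
by rewrite ler_pXn2r ?nnegrE ?rnorm_ge0 // (le_trans (rnorm_ge0 (d i))).
Qed.

Lemma scalar_bd_scale n (a : R[i]) : scalar_bd (a%:M : 'M[R[i]]_n) (rnorm a).
Proof.
have -> : (a%:M : 'M[R[i]]_n) = \matrix_(i, j) (a *+ (i == j)).
  by apply/matrixP => i j; rewrite !mxE.
exact: scalar_bd_diag.
Qed.

Lemma scalar_bd_col n m p (A : 'M[R[i]]_(n, p)) (B : 'M[R[i]]_(m, p)) (a b c : R) :
  a ^+ 2 + b ^+ 2 = c ^+ 2 ->
  scalar_bd A a -> scalar_bd B b -> scalar_bd (col_mx A B) c.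
Proof.
move=> abc Aa Bb H h; rewrite big_split_ord /= -abc mulrDl lerD //.
  apply: (le_trans _ (Aa H h)); apply: ler_sum => i _.
  by under eq_bigr do rewrite col_mxEu.
apply: (le_trans _ (Bb H h)); apply: ler_sum => i _.
by under eq_bigr do rewrite col_mxEd.
Qed.

Lemma scalar_bd_row n (s t c : R) : 0 <= s -> 0 <= t -> s ^+ 2 + t ^+ 2 = c ^+ 2 ->
  scalar_bd (row_mx s%:C%:M t%:C%:M : 'M[R[i]]_(n, n + n)) c.
Proof.
move=> s0 t0 stc H h; rewrite big_split_ord /= -stc -big_split mulr_sumr /=.
apply: ler_sum => i _; rewrite big_split_ord /=.
rewrite (bigD1 i) //= [X in _ + X + _]big1 ?addr0 => [|j ji]; last first.
  by rewrite row_mxEl !mxE eq_sym (negPf ji) mulr0n scale0r.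
rewrite (bigD1 i) //= [X in _ + (_ + X)]big1 ?addr0 => [|j ji]; last first.
  by rewrite row_mxEr !mxE eq_sym (negPf ji) mulr0n scale0r.
rewrite row_mxEl row_mxEr !mxE eqxx !mulr1n.
set x := h _; set y := h _; have := rnormD (s%:C *: x) (t%:C *: y).
rewrite !rnormZ !rnormR !ger0_norm // => le.
apply: (@le_trans _ _ ((s * rnorm x + t * rnorm y) ^+ 2)).
  by rewrite ler_pXn2r ?nnegrE ?rnorm_ge0 ?addr_ge0 ?mulr_ge0 ?rnorm_ge0.
by have := sqr_ge0 (t * rnorm x - s * rnorm y); move=> ?; nra.
Qed.

Lemma scalar_bd_row_delta n (j : 'I_n) : scalar_bd (delta_mx 0 j : 'M[R[i]]_(1, n)) 1.
Proof.
move=> H h; rewrite big_ord1 expr1n mul1r (bigD1 j) //= big1 ?addr0 => [|k kj].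
  rewrite mxE !eqxx scale1r (bigD1 j) //= lerDl; apply: sumr_ge0 => k _.
  exact: sqr_ge0.
by rewrite mxE (negPf kj) andbF scale0r.
Qed.

Lemma scalar_bd_col_delta n (i : 'I_n) : scalar_bd (delta_mx i 0 : 'M[R[i]]_(n, 1)) 1.
Proof.
move=> H h; rewrite big_ord1 expr1n mul1r (bigD1 i) //= [X in _ + X]big1 ?addr0.
  by rewrite big_ord1 mxE !eqxx scale1r.
by move=> k ki; rewrite big_ord1 mxE (negPf ki) scale0r rnorm0 expr0n.
Qed.

End ScalarAction.

(** * Abstract matrix seminorms *)

Section MatrixNormed.
Context {R : realType}.
Implicit Types X : opspace R.

(* Ruan's axioms for a matrix seminorm, in the rectangular form that also
   covers the scalar action. *)
Record ruan X : Prop := Ruan {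
  ruan0 : osp_set (0 : X);
  ruan_lin : forall (a : R[i]) (x y : X),
    osp_set x -> osp_set y -> osp_set (a *: x + y);
  ruan_ge0 : forall m n (x : 'M[X]_(m, n)), mx_in x -> 0 <= osp_norm x;
  ruan_l : forall m n p (C : 'M[R[i]]_(m, n)) (x : 'M[X]_(n, p)) c, 0 <= c ->
    scalar_bd C c -> mx_in x -> osp_norm (lscale C x) <= c * osp_norm x;
  ruan_r : forall m n p (x : 'M[X]_(m, n)) (C : 'M[R[i]]_(n, p)) c, 0 <= c ->
    scalar_bd C c -> mx_in x -> osp_norm (rscale x C) <= c * osp_norm x;
  ruan_d : forall m n m' n' (x : 'M[X]_(m, n)) (y : 'M[X]_(m', n')) c,
    mx_in x -> mx_in y -> osp_norm x <= c -> osp_norm y <= c ->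
    osp_norm (block_mx x 0 0 y) <= c }.

Section Ruan.
Variables (X : opspace R) (hX : ruan X).

Lemma ruanD (x y : X) : osp_set x -> osp_set y -> osp_set (x + y).
Proof. by move=> hx hy; have := ruan_lin hX 1 hx hy; rewrite scale1r. Qed.

Lemma ruanZ (a : R[i]) (x : X) : osp_set x -> osp_set (a *: x).
Proof. by move=> hx; have := ruan_lin hX a hx (ruan0 hX); rewrite addr0. Qed.

Lemma ruan_sum (I : Type) (r : seq I) (F : I -> X) :
  (forall i, osp_set (F i)) -> osp_set (\sum_(i <- r) F i).
Proof.
move=> hF; elim: r => [|i r IH]; first by rewrite big_nil; exact: ruan0.
by rewrite big_cons; exact: ruanD.
Qed.

Lemma mx_in_lscale m n p (C : 'M[R[i]]_(m, n)) (x : 'M[X]_(n, p)) :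
  mx_in x -> mx_in (lscale C x).
Proof. by move=> hx i j; rewrite mxE; apply: ruan_sum => k; exact: ruanZ. Qed.

Lemma mx_in_rscale m n p (x : 'M[X]_(m, n)) (C : 'M[R[i]]_(n, p)) :
  mx_in x -> mx_in (rscale x C).
Proof. by move=> hx i j; rewrite mxE; apply: ruan_sum => k; exact: ruanZ. Qed.

Lemma mx_in_block m n m' n' (x : 'M[X]_(m, n)) (y : 'M[X]_(m', n')) :
  mx_in x -> mx_in y -> mx_in (block_mx x 0 0 y).
Proof.
move=> hx hy i j; rewrite !mxE; case: (fintype.split i) => k; rewrite mxE;
  case: (fintype.split j) => l; rewrite ?mxE //; exact: ruan0.
Qed.

Lemma mx_inD m n (x y : 'M[X]_(m, n)) : mx_in x -> mx_in y -> mx_in (x + y).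
Proof. by move=> hx hy i j; rewrite mxE; exact: ruanD. Qed.

Lemma mx_in0 m n : mx_in (0 : 'M[X]_(m, n)).
Proof. by move=> i j; rewrite mxE; exact: ruan0. Qed.

Lemma mx_inB m n (x y : 'M[X]_(m, n)) : mx_in x -> mx_in y -> mx_in (x - y).
Proof.
by move=> hx hy i j; rewrite !mxE -scaleN1r; apply: ruanD => //; exact: ruanZ.
Qed.

Lemma lscale_scalar m n (a : R[i]) (x : 'M[X]_(m, n)) i j :
  lscale (a%:M) x i j = a *: x i j.
Proof.
rewrite mxE (bigD1 i) //= big1 ?addr0 => [|k ki]; last first.
  by rewrite mxE eq_sym (negPf ki) mulr0n scale0r.
by rewrite mxE eqxx mulr1n.
Qed.

Lemma rscale_scalar m n (a : R[i]) (x : 'M[X]_(m, n)) i j :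
  rscale x (a%:M) i j = a *: x i j.
Proof.
rewrite mxE (bigD1 j) //= big1 ?addr0 => [|k kj]; last first.
  by rewrite mxE (negPf kj) mulr0n scale0r.
by rewrite mxE eqxx mulr1n.
Qed.

Lemma ruan_norm0 m n : osp_norm (0 : 'M[X]_(m, n)) = 0.
Proof.
apply/le_anti; rewrite (ruan_ge0 hX) ?andbT; last exact: mx_in0.
have := ruan_l hX (rnorm_ge0 (0 : R[i])) (@scalar_bd_scale R m 0) (@mx_in0 m n).
rewrite rnorm0 mul0r; congr (osp_norm _ <= _); apply/matrixP => i j.
by rewrite lscale_scalar scale0r mxE.
Qed.

Lemma ruan_normN m n (x : 'M[X]_(m, n)) : mx_in x -> osp_norm (- x) <= osp_norm x.
Proof.
move=> hx; have := ruan_l hX (rnorm_ge0 (-1 : R[i])) (@scalar_bd_scale R m (-1)) hx.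
rewrite rnormN /rnorm normr1 mul1r; congr (osp_norm _ <= _).
by apply/matrixP => i j; rewrite lscale_scalar scaleN1r mxE.
Qed.

(** With s^2 = a and t^2 = b, the sum x + y is the row (s, t) times the block diagonal of x / a and
    y / b times the column (s, t), and row and column have norm at most sqrt (a + b). Taking a and b
    slightly above the norms makes them invertible. *)
Lemma ruan_triangle m n (x y : 'M[X]_(m, n)) : mx_in x -> mx_in y ->
  osp_norm (x + y) <= osp_norm x + osp_norm y.
Proof.
move=> hx hy; have x0 := ruan_ge0 hX hx; have y0 := ruan_ge0 hX hy.
apply/ler_addgt0Pr => e /half_gt0 e2.
set a := osp_norm x + e / 2; set b := osp_norm y + e / 2.
have a0 : 0 < a by rewrite ltr_wpDl. have b0 : 0 < b by rewrite ltr_wpDl.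
pose A : R[i] := a^-1%:C; pose B : R[i] := b^-1%:C.
have hA : osp_norm (lscale A%:M x) <= 1.
  apply: le_trans (ruan_l hX (rnorm_ge0 A) (@scalar_bd_scale R m A) hx) _.
  rewrite /A rnormR ger0_norm ?invr_ge0 ?(ltW a0) // ler_pdivrMl // mulr1 /a lerDl.
  exact: ltW.
have hB : osp_norm (lscale B%:M y) <= 1.
  apply: le_trans (ruan_l hX (rnorm_ge0 B) (@scalar_bd_scale R m B) hy) _.
  rewrite /B rnormR ger0_norm ?invr_ge0 ?(ltW b0) // ler_pdivrMl // mulr1 /b lerDl.
  exact: ltW.
have ix := mx_in_lscale A%:M hx; have iy := mx_in_lscale B%:M hy.
set s := Num.sqrt a; set t := Num.sqrt b; set c := Num.sqrt (a + b).
have ss : s ^+ 2 = a by rewrite sqr_sqrtr // ltW.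
have tt' : t ^+ 2 = b by rewrite sqr_sqrtr // ltW.
have cc : c ^+ 2 = a + b by rewrite sqr_sqrtr // addr_ge0 // ltW.
have stc : s ^+ 2 + t ^+ 2 = c ^+ 2 by rewrite ss tt' cc.
have s0 : 0 <= s by exact: sqrtr_ge0. have t0 : 0 <= t by exact: sqrtr_ge0.
have c0 : 0 <= c by exact: sqrtr_ge0.
have cl := @scalar_bd_row R m s t c s0 t0 stc.
have cr : scalar_bd (col_mx s%:C%:M t%:C%:M : 'M[R[i]]_(n + n, n)) c.
  have rs (r : R) : 0 <= r -> scalar_bd (r%:C%:M : 'M[R[i]]_n) r.
    by move=> r0; have := @scalar_bd_scale R n r%:C; rewrite rnormR ger0_norm.
  exact: scalar_bd_col stc (rs _ s0) (rs _ t0).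
have ib := mx_in_block ix iy.
have := ruan_l hX c0 cl (mx_in_rscale (col_mx s%:C%:M t%:C%:M) ib).
have := ruan_r hX c0 cr ib; have := ruan_d hX ix iy hA hB.
set blk := block_mx _ _ _ _ => h1 h2.
have -> : lscale (row_mx s%:C%:M t%:C%:M) (rscale blk (col_mx s%:C%:M t%:C%:M)) = x + y.
  apply/matrixP => i j; rewrite mxE big_split_ord /= [RHS]mxE.
  congr (_ + _); rewrite (bigD1 i) //= big1 ?addr0 => [|k ki].
  - rewrite row_mxEl !mxE eqxx mulr1n big_split_ord /= [X in _ + X]big1 ?addr0.
      rewrite (bigD1 j) //= big1 ?addr0 => [|k kj].
        rewrite col_mxEu /blk block_mxEul lscale_scalar mxE eqxx mulr1n !scalerA.
        by rewrite -!rmorphM /= -expr2 ss mulfV ?gt_eqF // scale1r.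
      by rewrite col_mxEu mxE (negPf kj) mulr0n scale0r.
    by move=> k _; rewrite /blk block_mxEur [X in _ *: X]mxE scaler0.
  - by rewrite row_mxEl !mxE eq_sym (negPf ki) mulr0n scale0r.
  - rewrite row_mxEr !mxE eqxx mulr1n big_split_ord /= [X in X + _]big1 ?add0r.
      rewrite (bigD1 j) //= big1 ?addr0 => [|k kj].
        rewrite col_mxEd /blk block_mxEdr lscale_scalar mxE eqxx mulr1n !scalerA.
        by rewrite -!rmorphM /= -expr2 tt' mulfV ?gt_eqF // scale1r.
      by rewrite col_mxEd mxE (negPf kj) mulr0n scale0r.
    by move=> k _; rewrite /blk block_mxEdl [X in _ *: X]mxE scaler0.
  - by rewrite row_mxEr !mxE eq_sym (negPf ki) mulr0n scale0r.
move=> h3; apply: le_trans h3 _.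
apply: (@le_trans _ _ (c * (c * 1))).
  by rewrite ler_wpM2l // (le_trans h2) // ler_wpM2l.
by rewrite mulr1 -expr2 cc /a /b addrACA -splitr.
Qed.

Lemma ruan_norm_sum m n (I : Type) (r : seq I) (F : I -> 'M[X]_(m, n)) :
  (forall i, mx_in (F i)) ->
  osp_norm (\sum_(i <- r) F i) <= \sum_(i <- r) osp_norm (F i).
Proof.
move=> hF; elim: r => [|i r IH]; first by rewrite !big_nil ruan_norm0.
rewrite !big_cons; apply: le_trans (ruan_triangle _ _) _ => //; last by rewrite lerD2l.
elim: r {IH} => [|k r IH]; first by rewrite big_nil; exact: mx_in0.
by rewrite big_cons; exact: mx_inD.
Qed.

Definition entry_mx m n (i : 'I_m) (j : 'I_n) (x : X) : 'M[X]_(m, n) :=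
  \matrix_(k, l) (if (k == i) && (l == j) then x else 0).

Lemma entry_mx_sum m n (x : 'M[X]_(m, n)) : x = \sum_i \sum_j entry_mx i j (x i j).
Proof.
apply/matrixP => k l; rewrite summxE (bigD1 k) //= [X in _ + X]big1 ?addr0.
  rewrite summxE (bigD1 l) //= big1 ?addr0 ?mxE ?eqxx // => j jl.
  by rewrite mxE eqxx eq_sym (negPf jl).
move=> i ik; rewrite summxE big1 // => j _; rewrite mxE.
by rewrite eq_sym (negPf ik).
Qed.

Lemma mx_in_entry m n (i : 'I_m) (j : 'I_n) x : osp_set x -> mx_in (entry_mx i j x).
Proof. by move=> hx k l; rewrite mxE; case: ifP => // _; exact: ruan0. Qed.

Lemma ruan_entry_mx m n (i : 'I_m) (j : 'I_n) (x : X) : osp_set x ->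
  osp_norm (entry_mx i j x) <= osp_norm (const_mx x : 'M[X]_1).
Proof.
move=> hx; have ix : mx_in (const_mx x : 'M[X]_1) by move=> k l; rewrite mxE.
have h1 := ruan_r hX ler01 (@scalar_bd_row_delta R n j) ix.
have h2 := ruan_l hX ler01 (@scalar_bd_col_delta R m i) (mx_in_rscale (delta_mx 0 j) ix).
rewrite !mul1r in h1 h2; apply: le_trans h1; apply: le_trans h2.
rewrite le_eqVlt; apply/orP; left; apply/eqP; congr osp_norm.
apply/matrixP => k l; rewrite !mxE big_ord1 !mxE big_ord1 !mxE !eqxx andbT /=.
by case: (k == i); case: (l == j); rewrite /= ?scale1r ?scale0r ?scaler0.
Qed.

(** Needed for completions, where the Cauchy condition is imposed entry by entry. *)
Lemma ruan_entries m n (x : 'M[X]_(m, n)) : mx_in x ->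
  osp_norm x <= \sum_i \sum_j osp_norm (const_mx (x i j) : 'M[X]_1).
Proof.
move=> hx; rewrite {1}(entry_mx_sum x); apply: le_trans (ruan_norm_sum _ _) _.
  move=> i k l; rewrite summxE; apply: ruan_sum => j.
  exact: mx_in_entry.
apply: ler_sum => i _; apply: le_trans (ruan_norm_sum _ _) _.
  by move=> j; exact: mx_in_entry.
by apply: ler_sum => j _; exact: ruan_entry_mx.
Qed.

Lemma ruan_norm_dist m n (x y : 'M[X]_(m, n)) : mx_in x -> mx_in y ->
  `|osp_norm x - osp_norm y| <= osp_norm (x - y).
Proof.
move=> hx hy; rewrite ler_distl; apply/andP; split.
  have := ruan_triangle hx (mx_inB hy hx); have := ruan_normN (mx_inB hx hy).
  by rewrite opprB subrKC => *; lra.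
by have := ruan_triangle hy (mx_inB hx hy); rewrite subrKC.
Qed.

End Ruan.

Lemma linear_on0 (V W : lmodType R[i]) (D : set V) (u : V -> W) :
  D 0 -> linear_on D u -> u 0 = 0.
Proof.
move=> D0 ul; have := ul 1 0 0 D0 D0; rewrite !scale1r addr0 => h.
by apply: (addrI (u 0)); rewrite addr0 -h.
Qed.

Lemma linear_on_comb X (W : lmodType R[i]) (u : X -> W) (I : Type) (r : seq I)
    (c : I -> R[i]) (F : I -> X) : ruan X -> linear_on (@osp_set R X) u ->
  (forall i, osp_set (F i)) ->
  u (\sum_(i <- r) c i *: F i) = \sum_(i <- r) c i *: u (F i).
Proof.
move=> hX ul hF; elim: r => [|i r IH].
  by rewrite !big_nil (linear_on0 (ruan0 hX) ul).
rewrite !big_cons ul ?IH //; apply: ruan_sum => // k; exact: ruanZ.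
Qed.

End MatrixNormed.

Section MaximalStructure.
Context {R : realType}.

(** The dual of the zero form, a zero space. It makes the supremum in the maximal norm range over a
    nonempty set. *)
Lemma hilbert_inhabited : inhabited (hilbert R).
Proof.
have h : @hilbertian R R[i]^o (fun=> 0).
  by split=> *; rewrite ?addr0 ?mulr0.
exact: inhabits (dual_hilbert (HForm h)).
Qed.

Variables (V : lmodType R[i]) (D : set V) (nu : V -> R).
Hypotheses (D0 : D 0) (Dlin : forall (a : R[i]) x y, D x -> D y -> D (a *: x + y))
  (nu_ge0 : forall v, D v -> 0 <= nu v).

Definition nu_contractive (H : hilbert R) (u : V -> BH H H) : Prop :=
  linear_on D u /\ forall v, D v -> bounded_op (u v) /\ opnorm (u v) <= nu v.

Let X : opspace R := max_opspace D nu.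
Let S m n (x : 'M[X]_(m, n)) : set R :=
  [set r | exists (H : hilbert R) (u : V -> BH H H),
      [/\ linear_on D u,
          forall v, D v -> bounded_op (u v) /\ opnorm (u v) <= nu v
        & r = opmx_norm (map_mx u x)]].

Lemma nu_contractive_bounded H (u : V -> BH H H) m n (x : 'M[X]_(m, n)) :
  nu_contractive u -> mx_in x -> @mx_bounded R H H m n (map_mx u x).
Proof. by move=> [_ hu] hx i j; rewrite mxE; case: (hu _ (hx i j)). Qed.

Lemma nu_contractive_opbd H (u : V -> BH H H) m n (x : 'M[X]_(m, n)) :
  nu_contractive u -> mx_in x ->
  @opbd R H H m n (map_mx u x) (\sum_i \sum_j nu (x i j)).
Proof.
move=> [_ hu] hx; apply: opbd_entries => i j; first exact/nu_ge0/hx.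
move=> h; rewrite mxE; have [ub un] := hu _ (hx i j).
by apply: le_trans (opnormP h ub) _; rewrite ler_wpM2r ?rnorm_ge0.
Qed.

Lemma max_has_sup m n (x : 'M[X]_(m, n)) : mx_in x -> has_sup (S x).
Proof.
move=> hx; split; last first.
  exists (\sum_i \sum_j nu (x i j)) => _ [H [u [ul hu ->]]].
  apply: opmx_norm_le; last exact: nu_contractive_opbd.
  by apply: sumr_ge0 => i _; apply: sumr_ge0 => j _; exact/nu_ge0/hx.
have [H] := hilbert_inhabited; exists (@opmx_norm R H H m n (map_mx (fun=> 0) x)).
exists H, (fun=> 0); split=> // [a v w _ _|v Dv]; first by rewrite scaler0 addr0.
have b0 h : rnorm ((0 : H -> H) h) <= 0 * rnorm h by rewrite rnorm0 mul0r.
split; last by apply: le_trans (nu_ge0 Dv); exact: opnorm_le.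
by split; [move=> a v' w'; rewrite scaler0 addr0|exists 0].
Qed.

Lemma max_norm_ge H (u : V -> BH H H) m n (x : 'M[X]_(m, n)) :
  nu_contractive u -> mx_in x -> @opmx_norm R H H m n (map_mx u x) <= osp_norm x.
Proof.
move=> [ul hu] hx; apply: (ub_le_sup (proj2 (max_has_sup hx))).
by exists H, u.
Qed.

Lemma max_norm_le m n (x : 'M[X]_(m, n)) c : mx_in x -> 0 <= c ->
  (forall H (u : V -> BH H H), nu_contractive u -> @opbd R H H m n (map_mx u x) c) ->
  osp_norm x <= c.
Proof.
move=> hx c0 h; apply: sup_le_ub; first exact: (proj1 (max_has_sup hx)).
by move=> _ [H [u [ul hu ->]]]; apply: opmx_norm_le => //; exact: h.
Qed.

Lemma nu_contractive_norm H (u : V -> BH H H) m n (x : 'M[X]_(m, n)) :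
  nu_contractive u -> mx_in x -> @opbd R H H m n (map_mx u x) (osp_norm x).
Proof.
move=> hu hx; have := opmx_normP (nu_contractive_bounded hu hx).
apply: opbd_weaken; last exact: max_norm_ge.
exact: opmx_norm_ge0 (nu_contractive_opbd hu hx).
Qed.

Lemma linear_on_sumZ (W : lmodType R[i]) (u : V -> W) (I : Type) (r : seq I)
    (c : I -> R[i]) (F : I -> V) : linear_on D u -> (forall i, D (F i)) ->
  u (\sum_(i <- r) c i *: F i) = \sum_(i <- r) c i *: u (F i).
Proof.
move=> ul hF; elim: r => [|i r IH]; first by rewrite !big_nil (linear_on0 D0 ul).
rewrite !big_cons ul ?IH //.
elim: r {IH} => [|k r IH]; first by rewrite big_nil.
by rewrite big_cons; exact: Dlin.
Qed.

Lemma max_norm_ge0 m n (x : 'M[X]_(m, n)) : mx_in x -> 0 <= osp_norm x.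
Proof.
move=> hx; have [r [H [u [ul hu _]]]] := proj1 (max_has_sup hx).
have hu' : nu_contractive u by [].
exact: le_trans (opmx_norm_ge0 (nu_contractive_opbd hu' hx)) (max_norm_ge hu' hx).
Qed.

(** Each contractive u sends scalar actions and block diagonals of matrices to those of operator
    matrices, where the bounds are concrete; they pass to the supremum over u. *)
Lemma max_opspace_ruan : ruan X.
Proof.
have DZ (a : R[i]) x : D x -> D (a *: x).
  by move=> Dx; rewrite -[_ *: _]addr0; exact: Dlin.
have Dsum (I : Type) (r : seq I) (F : I -> V) :
    (forall i, D (F i)) -> D (\sum_(i <- r) F i).
  move=> hF; elim: r => [|i r IH]; first by rewrite big_nil.
  by rewrite big_cons -[F i]scale1r; exact: Dlin.
split=> //.
- exact: max_norm_ge0.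
- move=> m n p C x c c0 hC hx.
  have x0 := max_norm_ge0 hx.
  apply: max_norm_le; first by move=> i j; rewrite mxE; apply: Dsum => k; exact: (DZ _ _ (hx _ _)).
    by rewrite mulr_ge0.
  move=> H u hu.
  have -> : map_mx u (lscale C x) = lscale C (map_mx u x : 'M[H -> H]_(n, p)).
    apply/matrixP => i j; rewrite !mxE (linear_on_sumZ _ _ hu.1) => [|k]; last exact: hx.
    by apply: eq_bigr => k _; rewrite mxE.
  by apply: opbd_lscale => //; exact: nu_contractive_norm.
- move=> m n p x C c c0 hC hx.
  have x0 := max_norm_ge0 hx.
  apply: max_norm_le; first by move=> i j; rewrite mxE; apply: Dsum => k; exact: (DZ _ _ (hx _ _)).
    by rewrite mulr_ge0.
  move=> H u hu.
  have -> : map_mx u (rscale x C) = rscale (map_mx u x : 'M[H -> H]_(m, n)) C.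
    apply/matrixP => i j; rewrite !mxE (linear_on_sumZ _ _ hu.1) => [|k]; last exact: hx.
    by apply: eq_bigr => k _; rewrite mxE.
  apply: opbd_rscale => //; last exact: nu_contractive_norm.
  by move=> i j; case: (nu_contractive_bounded hu hx i j).
- move=> m n m' n' x y c hx hy xc yc.
  have x0 := max_norm_ge0 hx; have y0 := max_norm_ge0 hy.
  apply: max_norm_le.
  + move=> i j; rewrite !mxE; case: (fintype.split i) => k; rewrite mxE;
      by case: (fintype.split j) => l; rewrite ?mxE //; exact: D0.
  + exact: le_trans xc.
  move=> H u hu; rewrite map_block_mx.
  have u0 : u 0 = 0 by exact: linear_on0 D0 hu.1.
  have z0 (k l : nat) : map_mx u (0 : 'M[V]_(k, l)) = 0.
    by apply/matrixP => i j; rewrite !mxE u0.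
  rewrite !z0; apply: opbd_block.
    exact: opbd_weaken x0 xc (nu_contractive_norm hu hx).
  exact: opbd_weaken y0 yc (nu_contractive_norm hu hy).
Qed.

(** A contractive u makes the matrix a diagonal of operators, each bounded by c. Applied to basis
    vectors of ell_1, this is what allows diagonal matrices over Gamma in the admissible
    families. *)
Lemma max_norm_diag n (d : 'I_n -> V) (c : R) : 0 <= c ->
  (forall i, D (d i)) -> (forall i, nu (d i) <= c) ->
  osp_norm (\matrix_(i, j) (if i == j then d i else 0) : 'M[X]_n) <= c.
Proof.
move=> c0 Dd dc; apply: max_norm_le => //.
  by move=> i j; rewrite mxE; case: ifP => _; [exact: Dd|exact: D0].
move=> H u hu h; rewrite mulr_sumr; apply: ler_sum => i _.
rewrite (bigD1 i) //= big1 ?addr0 => [|j ji]; last first.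
  by rewrite !mxE eq_sym (negPf ji) (linear_on0 D0 hu.1).
rewrite !mxE eqxx -exprMn ler_pXn2r ?nnegrE ?rnorm_ge0 ?mulr_ge0 ?rnorm_ge0 //.
have [ub un] := hu.2 _ (Dd i); apply: le_trans (opnormP _ ub) _.
by rewrite ler_wpM2r ?rnorm_ge0 // (le_trans un).
Qed.

End MaximalStructure.

(** * The Haagerup tensor product *)

Section CompleteContractions.
Context {R : realType}.

(** Complete contractivity is required for rectangular matrices, since the Haagerup norm factors a
    matrix through an arbitrary intermediate size. *)
Record ccmap (X : opspace R) (L : hilbert R) (s : X -> L -> L) : Prop := CCmap {
  cc_lin : linear_on (@osp_set R X) s;
  cc_bounded : forall x, osp_set x -> bounded_op (s x);
  cc_norm : forall m n (x : 'M[X]_(m, n)), mx_in x -> opbd (map_mx s x) (osp_norm x) }.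

End CompleteContractions.

Section HaagerupAlgebraic.
Context {R : realType}.
Variables (E F : opspace R) (hE : ruan E) (hF : ruan F).
Let X := haagerup_alg E F.

(** Matrix multiplication with tensors in place of products; the Haagerup norm is an infimum over
    factorizations of this form. *)
Definition odot m n r (a : 'M[E]_(m, r)) (b : 'M[F]_(r, n)) : 'M[X]_(m, n) :=
  \matrix_(i, j) \sum_l tens_alg (a i l) (b l j).

Lemma tens_lin_l (c : R[i]) (x y : E) (z : F) : osp_set x -> osp_set y ->
  osp_set z -> tens_alg (c *: x + y) z = c *: tens_alg x z + tens_alg y z.
Proof. by move=> hx hy hz; apply/funext => phi; exact: bilform_linl. Qed.

Lemma tens_lin_r (c : R[i]) (x : E) (y z : F) : osp_set x -> osp_set y ->
  osp_set z -> tens_alg x (c *: y + z) = c *: tens_alg x y + tens_alg x z.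
Proof. by move=> hx hy hz; apply/funext => phi; exact: bilform_linr. Qed.

Lemma tens_sum_l (I : Type) (r : seq I) (c : I -> R[i]) (x : I -> E) (z : F) :
  (forall i, osp_set (x i)) -> osp_set z ->
  tens_alg (\sum_(i <- r) c i *: x i) z = \sum_(i <- r) c i *: tens_alg (x i) z.
Proof.
move=> hx hz.
apply: (@linear_on_comb R E _ (fun x => tens_alg x z) I r c x hE _ hx).
by move=> a y w hy hw; exact: tens_lin_l.
Qed.

Lemma tens_sum_r (I : Type) (r : seq I) (c : I -> R[i]) (x : E) (y : I -> F) :
  osp_set x -> (forall i, osp_set (y i)) ->
  tens_alg x (\sum_(i <- r) c i *: y i) = \sum_(i <- r) c i *: tens_alg x (y i).
Proof.
move=> hx hy.
apply: (@linear_on_comb R F _ (fun y => tens_alg x y) I r c y hF _ hy).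
by move=> a z w hz hw; exact: tens_lin_r.
Qed.

Lemma tens0_l (z : F) : osp_set z -> tens_alg (0 : E) z = 0.
Proof. by move=> hz; have := tens_sum_l [::] (fun _ : unit => 0) (fun=> ruan0 hE) hz; rewrite !big_nil. Qed.

Lemma tens0_r (x : E) : osp_set x -> tens_alg x (0 : F) = 0.
Proof. by move=> hx; have := tens_sum_r [::] (fun _ : unit => 0) hx (fun=> ruan0 hF); rewrite !big_nil. Qed.

Lemma lscale_odot m n p r (C : 'M[R[i]]_(m, n)) (a : 'M[E]_(n, r)) (b : 'M[F]_(r, p)) :
  mx_in a -> mx_in b -> lscale C (odot a b) = odot (lscale C a) b.
Proof.
move=> ha hb; apply/matrixP => i j; rewrite !mxE.
under eq_bigr do rewrite mxE scaler_sumr.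
rewrite exchange_big; apply: eq_bigr => l _; rewrite mxE tens_sum_l //.
Qed.

Lemma rscale_odot m n p r (a : 'M[E]_(m, r)) (b : 'M[F]_(r, n)) (C : 'M[R[i]]_(n, p)) :
  mx_in a -> mx_in b -> rscale (odot a b) C = odot a (rscale b C).
Proof.
move=> ha hb; apply/matrixP => i j; rewrite !mxE.
under eq_bigr do rewrite mxE scaler_sumr.
rewrite exchange_big; apply: eq_bigr => l _; rewrite mxE tens_sum_r //.
Qed.

Lemma block_odot m n r m' n' r' (a : 'M[E]_(m, r)) (b : 'M[F]_(r, n))
    (a' : 'M[E]_(m', r')) (b' : 'M[F]_(r', n')) :
  mx_in a -> mx_in b -> mx_in a' -> mx_in b' ->
  block_mx (odot a b) 0 0 (odot a' b') =
  odot (block_mx a 0 0 a') (block_mx b 0 0 b').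
Proof.
move=> ha hb ha' hb'; apply/matrixP => i j; rewrite [RHS]mxE big_split_ord /=.
case: (split_ordP i) => i' ->; case: (split_ordP j) => j' ->.
- rewrite block_mxEul mxE [X in _ + X]big1 ?addr0.
    by apply: eq_bigr => l _; rewrite !block_mxEul.
  by move=> l _; rewrite block_mxEur block_mxEdl !mxE tens0_l //; exact: ruan0.
- rewrite block_mxEur mxE !big1 ?addr0 // => l _.
    by rewrite block_mxEur block_mxEdr mxE tens0_l.
  by rewrite block_mxEul block_mxEur [X in tens_alg _ X]mxE tens0_r.
- rewrite block_mxEdl mxE !big1 ?addr0 // => l _.
    by rewrite block_mxEdr block_mxEdl [X in tens_alg _ X]mxE tens0_r.
  by rewrite block_mxEdl block_mxEul mxE tens0_l.
- rewrite block_mxEdr mxE [X in X + _]big1 ?add0r.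
    by apply: eq_bigr => l _; rewrite !block_mxEdr.
  by move=> l _; rewrite block_mxEdl block_mxEur !mxE tens0_l //; exact: ruan0.
Qed.

Lemma odot_in m n r (a : 'M[E]_(m, r)) (b : 'M[F]_(r, n)) :
  mx_in a -> mx_in b -> mx_in (odot a b).
Proof. by move=> ha hb i j; rewrite mxE; exists r, (a i), (fun l => b l j). Qed.

Lemma odotD m n r r' (a : 'M[E]_(m, r)) (b : 'M[F]_(r, n))
    (a' : 'M[E]_(m, r')) (b' : 'M[F]_(r', n)) :
  odot (row_mx a a') (col_mx b b') = odot a b + odot a' b'.
Proof.
apply/matrixP => i j; rewrite !mxE big_split_ord /=; congr (_ + _);
  by apply: eq_bigr => l _; rewrite ?row_mxEl ?row_mxEr ?col_mxEu ?col_mxEd.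
Qed.

Lemma mx_in_row m r r' (a : 'M[E]_(m, r)) (a' : 'M[E]_(m, r')) :
  mx_in a -> mx_in a' -> mx_in (row_mx a a').
Proof. by move=> ha ha' i l; rewrite mxE; case: (fintype.split l). Qed.

Lemma mx_in_col n r r' (b : 'M[F]_(r, n)) (b' : 'M[F]_(r', n)) :
  mx_in b -> mx_in b' -> mx_in (col_mx b b').
Proof. by move=> hb hb' l j; rewrite mxE; case: (fintype.split l). Qed.

(** Concatenating rows on the left and columns on the right adds factorizations, so a matrix with a
    single nonzero entry is enough: put its left legs in one row and its right legs in one
    column. *)
Lemma odot_exists m n (x : 'M[X]_(m, n)) : mx_in x ->
  exists r (a : 'M[E]_(m, r)) (b : 'M[F]_(r, n)),
    [/\ mx_in a, mx_in b & x = odot a b].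
Proof.
move=> hx; pose P (y : 'M[X]_(m, n)) :=
  exists r (a : 'M[E]_(m, r)) (b : 'M[F]_(r, n)), [/\ mx_in a, mx_in b & y = odot a b].
have P0 : P 0.
  exists 0%N, 0, 0; split; first exact: mx_in0.
    exact: mx_in0.
  by apply/matrixP => i j; rewrite !mxE big_ord0.
have PD y z : P y -> P z -> P (y + z).
  move=> [r [a [b [ha hb ->]]]] [r' [a' [b' [ha' hb' ->]]]].
  exists (r + r')%N, (row_mx a a'), (col_mx b b'); split; last by rewrite odotD.
    exact: mx_in_row.
  exact: mx_in_col.
have Psum (I : Type) (s : seq I) (G : I -> 'M[X]_(m, n)) :
    (forall i, P (G i)) -> P (\sum_(i <- s) G i).
  by move=> hG; apply: big_ind.
rewrite -/(P x) (entry_mx_sum x); apply: (Psum _ _ _) => i; apply: (Psum _ _ _) => j.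
have [r [e [f [he hf ->]]]] := hx i j.
exists r, (\matrix_(k, l) if k == i then e l else 0),
  (\matrix_(l, k) if k == j then f l else 0); split.
- by move=> k l; rewrite mxE; case: ifP => // _; exact: ruan0.
- by move=> l k; rewrite mxE; case: ifP => // _; exact: ruan0.
apply/matrixP => k l; rewrite !mxE [RHS](eq_bigr (fun q =>
  tens_alg (if k == i then e q else 0) (if l == j then f q else 0))); last first.
  by move=> q _; rewrite !mxE.
case: (k == i) => /=; last first.
  by rewrite big1 // => q _; rewrite tens0_l //; case: ifP => // _; exact: ruan0.
by case: (l == j) => //=; rewrite big1 // => q _; rewrite tens0_r.
Qed.

Let S m n (x : 'M[X]_(m, n)) : set R :=
  [set c | exists (r : nat) (a : 'M[E]_(m, r)) (b : 'M[F]_(r, n)),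
        [/\ mx_in a, mx_in b,
            forall i j, x i j = \sum_l tens_alg (a i l) (b l j)
          & c = osp_norm a * osp_norm b]].

Lemma haag_has_inf m n (x : 'M[X]_(m, n)) : mx_in x -> has_inf (S x).
Proof.
move=> hx; split.
  have [r [a [b [ha hb ->]]]] := odot_exists hx.
  by eexists; exists r, a, b; split=> // i j; rewrite mxE.
exists 0 => _ [r [a [b [ha hb _ ->]]]].
by rewrite mulr_ge0 ?(ruan_ge0 hE) ?(ruan_ge0 hF).
Qed.

Lemma haag_ge0 m n (x : 'M[X]_(m, n)) : mx_in x -> 0 <= osp_norm x.
Proof.
move=> hx; apply: lb_le_inf; first exact: (proj1 (haag_has_inf hx)).
move=> _ [r [a [b [ha hb _ ->]]]].
by rewrite mulr_ge0 ?(ruan_ge0 hE) ?(ruan_ge0 hF).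
Qed.

Lemma haag_le m n r (a : 'M[E]_(m, r)) (b : 'M[F]_(r, n)) :
  mx_in a -> mx_in b -> osp_norm (odot a b) <= osp_norm a * osp_norm b.
Proof.
move=> ha hb; apply: (ge_inf (proj2 (haag_has_inf (odot_in ha hb)))).
by exists r, a, b; split=> // i j; rewrite mxE.
Qed.

Lemma scale_balance (p q d : R) : 0 <= p -> 0 <= q -> 0 < d -> p * q < d ^+ 2 ->
  exists2 t, 0 < t & t * p <= d /\ t^-1 * q <= d.
Proof.
move=> p0 q0 d0 pq; move: p0; rewrite le_eqVlt => /predU1P[p0|p0].
  (* With p = 0 the first condition holds for every t, and this t, at least q / d, meets the second;
     q + 1 keeps it positive. *)
  exists ((q + 1) / d); first by rewrite divr_gt0 // ltr_wpDl.
  rewrite -p0 mulr0 invf_div ltW //; split=> //.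
  by rewrite mulrAC ler_pdivrMr ?ltr_wpDl // ler_pM2l // lerDl.
exists (d / p); first by rewrite divr_gt0.
rewrite divfK ?gt_eqF //; split=> //; rewrite invf_div mulrAC ler_pdivrMr //.
by rewrite -expr2 ltW.
Qed.

(** A scalar moves across the tensor sign, so both factors can be brought below the same d. For
    block diagonals this bounds each block factor by d, hence the norm by d^2, instead of by a
    product of mismatched maxima. *)
Lemma haag_balanced m n (x : 'M[X]_(m, n)) (d : R) : mx_in x -> 0 < d ->
  osp_norm x < d ^+ 2 -> exists r (a : 'M[E]_(m, r)) (b : 'M[F]_(r, n)),
    [/\ mx_in a, mx_in b, x = odot a b, osp_norm a <= d & osp_norm b <= d].
Proof.
move=> hx d0 xd; have e0 : 0 < d ^+ 2 - osp_norm x by rewrite subr_gt0.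
have [_ [r [a [b [ha hb xab ->]]]]] := inf_adherent e0 (haag_has_inf hx).
rewrite -/(osp_norm x) subrKC => abd.
have [t t0 [ta tb]] :=
  scale_balance (ruan_ge0 hE ha) (ruan_ge0 hF hb) d0 abd.
pose T : R[i] := t%:C; have T0 : T != 0 by apply/eqP => /complexI/eqP; rewrite gt_eqF.
exists r, (rscale a T%:M), (lscale T^-1%:M b); split.
- exact: mx_in_rscale.
- exact: mx_in_lscale.
- apply/matrixP => i j; rewrite xab mxE; apply: eq_bigr => l _.
  rewrite rscale_scalar lscale_scalar.
  have := tens_sum_l [:: tt] (fun=> T) (fun=> ha i l) (ruanZ hF T^-1 (hb l j)).
  rewrite !big_seq1 => ->.
  have := tens_sum_r [:: tt] (fun=> T^-1) (ha i l) (fun=> hb l j).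
  by rewrite !big_seq1 => ->; rewrite scalerA mulfV // scale1r.
- apply: le_trans (ruan_r hE (rnorm_ge0 T) (@scalar_bd_scale R r T) ha) _.
  by rewrite rnormR gtr0_norm.
- apply: le_trans (ruan_l hF (rnorm_ge0 T^-1) (@scalar_bd_scale R r T^-1) hb) _.
  by rewrite /T -fmorphV rnormR gtr0_norm ?invr_gt0.
Qed.

Lemma haagerup_alg_ruan : ruan X.
Proof.
have sq (x e : R) : 0 <= x -> 0 < e -> exists2 d, 0 < d & d ^+ 2 = x + e.
  move=> x0 e0; have xe : 0 < x + e by rewrite ltr_wpDl.
  by exists (Num.sqrt (x + e)); rewrite ?sqrtr_gt0 // sqr_sqrtr // ltW.
have in1 (x : X) : osp_set x <-> mx_in (const_mx x : 'M[X]_1).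
  by split=> [hx i j|/(_ 0 0)]; rewrite mxE.
split.
- exists 0%N, (fun=> 0), (fun=> 0); split=> [[]|[]|] //.
  by rewrite big_ord0.
- move=> c x y /in1 hx /in1 hy; apply/in1.
  have [r [a [b [ha hb Ex]]]] := odot_exists hx.
  have [r' [a' [b' [ha' hb' Ey]]]] := odot_exists hy.
  have -> : const_mx (c *: x + y) = odot (row_mx (lscale c%:M a) a') (col_mx b b').
    rewrite odotD -lscale_odot // -Ex -Ey; apply/matrixP => i j.
    by rewrite [RHS]mxE lscale_scalar !mxE.
  by apply: odot_in; [apply: mx_in_row => //; exact: mx_in_lscale|exact: mx_in_col].
- exact: haag_ge0.
- move=> m n p C x c c0 hC hx; apply/ler_addgt0Pr => e e0.
  have c1 : 0 < c + 1 by rewrite ltr_wpDl.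
  have e1 : 0 < e / (c + 1) by rewrite divr_gt0.
  have [d d0 dd] := sq _ _ (haag_ge0 hx) e1.
  have [|r [a [b [ha hb xab ad bd]]]] := haag_balanced hx d0; first by rewrite dd ltrDl.
  rewrite {1}xab lscale_odot //; have ia := mx_in_lscale hE C ha.
  apply: le_trans (haag_le ia hb) _.
  have h1 : osp_norm (lscale C a) * osp_norm b <= c * d ^+ 2.
    rewrite expr2 mulrA ler_pM ?(ruan_ge0 hE) ?(ruan_ge0 hF) //.
    by apply: le_trans (ruan_l hE c0 hC ha) _; rewrite ler_wpM2l.
  apply: le_trans h1 _; rewrite dd mulrDr lerD2l mulrA ler_pdivrMr // mulrC.
  by rewrite ler_wpM2l ?ltW // ltrDl.
- move=> m n p x C c c0 hC hx; apply/ler_addgt0Pr => e e0.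
  have c1 : 0 < c + 1 by rewrite ltr_wpDl.
  have e1 : 0 < e / (c + 1) by rewrite divr_gt0.
  have [d d0 dd] := sq _ _ (haag_ge0 hx) e1.
  have [|r [a [b [ha hb xab ad bd]]]] := haag_balanced hx d0; first by rewrite dd ltrDl.
  rewrite {1}xab rscale_odot //; have ib := mx_in_rscale hF C hb.
  apply: le_trans (haag_le ha ib) _.
  have h1 : osp_norm a * osp_norm (rscale b C) <= c * d ^+ 2.
    rewrite mulrC expr2 mulrA ler_pM ?(ruan_ge0 hE) ?(ruan_ge0 hF) //.
    by apply: le_trans (ruan_r hF c0 hC hb) _; rewrite ler_wpM2l.
  apply: le_trans h1 _; rewrite dd mulrDr lerD2l mulrA ler_pdivrMr // mulrC.
  by rewrite ler_wpM2l ?ltW // ltrDl.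
- move=> m n m' n' x y c hx hy xc yc; apply/ler_addgt0Pr => e e0.
  have [d d0 dd] := sq _ _ (le_trans (haag_ge0 hx) xc) e0.
  have [|r [a [b [ha hb -> ad bd]]]] := haag_balanced hx d0.
    by rewrite dd (le_lt_trans xc) // ltrDl.
  have [|r' [a' [b' [ha' hb' -> ad' bd']]]] := haag_balanced hy d0.
    by rewrite dd (le_lt_trans yc) // ltrDl.
  rewrite block_odot //.
  have ia := mx_in_block hE ha ha'; have ib := mx_in_block hF hb hb'.
  apply: le_trans (haag_le ia ib) _; rewrite -dd expr2.
  by rewrite ler_pM ?(ruan_ge0 hE) ?(ruan_ge0 hF) ?(ruan_d hE) ?(ruan_d hF).
Qed.

Section Product.
Variables (L : hilbert R) (s : E -> L -> L) (t : F -> L -> L).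
Hypotheses (hs : ccmap s) (ht : ccmap t).

Let dotform_l (h k : L) (y : F) : osp_set y ->
  linear_on (@osp_set R E) (fun x => hdot L (s x (t y h)) k : R[i]^o).
Proof.
move=> hy c x x' hx hx'; rewrite (cc_lin hs) //.
by rewrite linearDl linearZl_LR.
Qed.

Let dotform_r (h k : L) (x : E) : osp_set x ->
  linear_on (@osp_set R F) (fun y => hdot L (s x (t y h)) k : R[i]^o).
Proof.
move=> hx c y y' hy hy'; rewrite (cc_lin ht) //.
have [sl _] := cc_bounded hs hx.
by rewrite sl linearDl linearZl_LR.
Qed.

(** A tensor is a functional on bilinear forms, so its values at these forms are the matrix
    coefficients of the operator that it should define. *)
Definition dotform (h k : L) : bilform E F := Bilform (dotform_l h k) (dotform_r h k).

Lemma hdotP (c : R[i]) (x y k : L) :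
  hdot L (c *: x + y) k = c * hdot L x k + hdot L y k.
Proof. by rewrite linearDl linearZl_LR. Qed.

Lemma hdot_inj (x y : L) : (forall k, hdot L x k = hdot L y k) -> x = y.
Proof.
move=> xy; apply/eqP; rewrite -subr_eq0 -normr_eq0.
have : `|x - y| ^+ 2 == 0 by rewrite hnormE linearBl subr_eq0; apply/eqP; exact: xy.
by rewrite expf_eq0.
Qed.

(** The vector is selected by its coefficients, which makes the definition independent of how z is
    written as a sum. On sums of elementary tensors such a vector exists and the default 0 does not
    intervene. *)
Definition prod_map (z : X) : L -> L := fun h =>
  xget 0 [set y | forall k, hdot L y k = z (dotform h k)].

Lemma prod_mapE r (e : 'I_r -> E) (f : 'I_r -> F) h :
  prod_map (\sum_l tens_alg (e l) (f l)) h = \sum_l s (e l) (t (f l) h).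
Proof.
apply: hdot_inj => k.
have P : [set y | forall k, hdot L y k =
    (\sum_l tens_alg (e l) (f l)) (dotform h k)] (\sum_l s (e l) (t (f l) h)).
  move=> k' /=; rewrite linear_sumlz fct_sumE.
  by apply: eq_bigr.
by have := xgetPex 0 (ex_intro _ _ P) k; rewrite /prod_map => ->; rewrite P.
Qed.

Lemma prod_map_hdot (z : X) h k : osp_set z ->
  hdot L (prod_map z h) k = z (dotform h k).
Proof.
move=> [r [e [f [_ _ ->]]]]; rewrite prod_mapE linear_sumlz fct_sumE.
by apply: eq_bigr.
Qed.

(** The operator matrix of the product is that of b under t followed by that of a under s, through r
    copies of L; the bounds multiply. *)
Lemma prod_map_odot m n r (a : 'M[E]_(m, r)) (b : 'M[F]_(r, n)) :
  mx_in a -> mx_in b ->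
  opbd (map_mx prod_map (odot a b)) (osp_norm a * osp_norm b).
Proof.
move=> ha hb h; rewrite exprMn -mulrA.
apply: (le_trans _ (ler_wpM2l (sqr_ge0 _) (cc_norm ht hb h))).
apply: (le_trans _ (cc_norm hs ha (fun l => \sum_j map_mx t b l j (h j)))).
apply: ler_sum => i _; rewrite le_eqVlt; apply/orP; left; apply/eqP.
congr (rnorm _ ^+ 2).
under eq_bigr do rewrite !mxE prod_mapE.
rewrite exchange_big; apply: eq_bigr => l _; rewrite !mxE.
have [sl _] := cc_bounded hs (ha i l).
by rewrite linear_sum_fun //; apply: eq_bigr => j _; rewrite mxE.
Qed.

Lemma prod_map_cc : ccmap prod_map.
Proof.
split.
- move=> c x y hx hy; apply/funext => h; apply: hdot_inj => k.
  rewrite prod_map_hdot; last exact: (ruan_lin haagerup_alg_ruan).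
  by rewrite hdotP !prod_map_hdot.
- move=> z [r [e [f [he hf ->]]]].
  have Mb (l : 'I_r) : exists M, forall h, rnorm (s (e l) (t (f l) h)) <= M * rnorm h.
    have [M M0 hM] := bounded_opP (cc_bounded hs (he l)).
    have [M' M'0 hM'] := bounded_opP (cc_bounded ht (hf l)).
    exists (M * M') => h; apply: le_trans (hM _) _.
    by rewrite -mulrA ler_wpM2l.
  split; last first.
    have [M hM] := choice Mb; exists (\sum_l M l) => h.
    rewrite prod_mapE mulr_suml; apply: le_trans (rnorm_sum _ _ _) _.
    exact: ler_sum.
  move=> c h k; rewrite !prod_mapE scaler_sumr -big_split /=.
  apply: eq_bigr => l _; have [tl _] := cc_bounded ht (hf l).
  by have [sl _] := cc_bounded hs (he l); rewrite tl sl.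
move=> m n x hx; apply: opbd_lim; first exact: haag_ge0.
move=> e e0; have xe : 0 < osp_norm x + e by rewrite ltr_wpDl ?haag_ge0.
have d0 : 0 < Num.sqrt (osp_norm x + e) by rewrite sqrtr_gt0.
have [|r [a [b [ha hb xab ad bd]]]] := haag_balanced hx d0.
  by rewrite sqr_sqrtr ?(ltW xe) // ltrDl.
have := prod_map_odot ha hb; rewrite -xab; apply: opbd_weaken.
  by rewrite mulr_ge0 ?(ruan_ge0 hE) ?(ruan_ge0 hF).
rewrite -[leRHS]sqr_sqrtr ?(ltW xe) // expr2.
by rewrite ler_pM ?(ruan_ge0 hE) ?(ruan_ge0 hF).
Qed.

End Product.
End HaagerupAlgebraic.

Lemma cvg_sumR (R : realType) (I : Type) (r : seq I) (f : I -> nat -> R) (l : I -> R) :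
  (forall i, f i @ \oo --> l i) ->
  (fun k => \sum_(i <- r) f i k) @ \oo --> \sum_(i <- r) l i.
Proof.
move=> fl; elim: r => [|i r IH].
  by under eq_fun do rewrite big_nil; rewrite big_nil; exact: cvg_cst.
by under eq_fun do rewrite big_cons; rewrite big_cons; exact: cvgD.
Qed.

(** * Completions of matrix seminormed spaces *)

Section Completion.
Context {R : realType}.
Variables (X : opspace R) (hX : ruan X).
Let Y := completion X.

Definition nth_mx m n (x : 'M[Y]_(m, n)) (k : nat) : 'M[X]_(m, n) :=
  \matrix_(i, j) x i j k.

Lemma mx_in_nth m n (x : 'M[Y]_(m, n)) k : mx_in x -> mx_in (nth_mx x k).
Proof. by move=> hx i j; rewrite mxE; case: (hx i j). Qed.

Lemma completion_norm_cvg m n (x : 'M[Y]_(m, n)) : mx_in x ->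
  cvgn (fun k => osp_norm (nth_mx x k)).
Proof.
move=> hx; apply: real_cauchy_cvg => e e0.
(* The tolerance is shared among the m n entries; the successor keeps c positive for empty matrices
   and makes the final inequality strict. *)
pose c : R := (m * n).+1%:R; have c0 : 0 < c by rewrite ltr0n.
have ec : 0 < e / c by rewrite divr_gt0.
have /choice[N hN] (p : 'I_m * 'I_n) : exists N, forall k l,
    (N <= k)%N -> (N <= l)%N ->
    osp_norm (const_mx (x p.1 p.2 k - x p.1 p.2 l) : 'M[X]_1) < e / c.
  by case: (hx p.1 p.2) => _ /(_ _ ec).
exists (\max_p N p)%N => k l Nk Nl.
have hk := mx_in_nth k hx; have hl := mx_in_nth l hx.
apply: le_lt_trans (ruan_norm_dist hX hk hl) _.
apply: le_lt_trans (ruan_entries hX (mx_inB hX hk hl)) _.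
rewrite pair_big /=.
apply: (@le_lt_trans _ _ (\sum_(p : 'I_m * 'I_n) (e / c))).
  apply: ler_sum => p _; rewrite !mxE; apply/ltW/hN.
    by apply: leq_trans Nk; exact: leq_bigmax.
  by apply: leq_trans Nl; exact: leq_bigmax.
rewrite sumr_const card_prod !card_ord -mulr_natr mulrAC ltr_pdivrMr //.
by rewrite ltr_pM2l // ltr_nat.
Qed.

Lemma completion_norm_le m n (x : 'M[Y]_(m, n)) N c : mx_in x ->
  (forall k, (N <= k)%N -> osp_norm (nth_mx x k) <= c) -> osp_norm x <= c.
Proof. by move=> hx; apply: limn_le; exact: completion_norm_cvg. Qed.

Lemma completion_norm_near m n (x : 'M[Y]_(m, n)) e : mx_in x -> 0 < e ->
  exists N, forall k, (N <= k)%N -> osp_norm (nth_mx x k) < osp_norm x + e.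
Proof.
move=> hx e0; have [N hN] := cvgn_elem (completion_norm_cvg hx) e0.
by exists N => k /hN; rewrite ltr_distl => /andP[].
Qed.

Lemma completion_norm_const m n (x : 'M[X]_(m, n)) :
  osp_norm (\matrix_(i, j) (fun=> x i j) : 'M[Y]_(m, n)) = osp_norm x.
Proof.
apply: cvg_lim => //.
rewrite (_ : (fun k => _) = (fun=> osp_norm x)); first exact: cvg_cst.
apply/funext => k; congr osp_norm.
by apply/matrixP => i j; rewrite !mxE.
Qed.

Lemma completion_const_in (x : X) : osp_set x -> osp_set ((fun=> x) : Y).
Proof.
move=> hx; split=> // e e0; exists 0%N => k l _ _.
rewrite subrr (_ : const_mx 0 = 0 :> 'M[X]_1) ?(ruan_norm0 hX) //.
Qed.

Lemma const_osp_norm_lin (a : R[i]) (x y : X) : osp_set x -> osp_set y ->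
  osp_norm (const_mx (a *: x + y) : 'M[X]_1) <=
  rnorm a * osp_norm (const_mx x : 'M[X]_1) + osp_norm (const_mx y : 'M[X]_1).
Proof.
move=> hx hy; have ix : mx_in (const_mx x : 'M[X]_1) by move=> i j; rewrite mxE.
have iy : mx_in (const_mx y : 'M[X]_1) by move=> i j; rewrite mxE.
have -> : const_mx (a *: x + y) = lscale a%:M (const_mx x) + const_mx y :> 'M[X]_1.
  by apply/matrixP => i j; rewrite [RHS]mxE lscale_scalar !mxE.
apply: le_trans (ruan_triangle hX (mx_in_lscale hX _ ix) iy) _; rewrite lerD2r.
exact: (ruan_l hX (rnorm_ge0 a) (@scalar_bd_scale R 1 a)).
Qed.

Lemma completion_ruan : ruan Y.
Proof.
have S0 : osp_set (0 : Y) by apply: completion_const_in; exact: ruan0.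
have Sl (a : R[i]) (x y : Y) : osp_set x -> osp_set y -> osp_set (a *: x + y).
  move=> [hx cx] [hy cy]; split=> [k|e e0]; first exact: (ruan_lin hX).
  have a0 : 0 < 2 * (rnorm a + 1) by rewrite mulr_gt0 // ltr_wpDl ?rnorm_ge0.
  have [N hN] := cx _ (divr_gt0 e0 a0); have [M hM] := cy _ (half_gt0 e0).
  exists (maxn N M) => k l; rewrite !geq_max => /andP[Nk Mk] /andP[Nl Ml].
  have -> : (a *: x + y) k - (a *: x + y) l = a *: (x k - x l) + (y k - y l).
    by rewrite /= !fctE scalerBr opprD addrACA.
  have B (u v : X) : osp_set u -> osp_set v -> osp_set (u - v).
    by move=> hu hv; rewrite -scaleN1r; apply: (ruanD hX) => //; exact: ruanZ.
  apply: le_lt_trans (const_osp_norm_lin _ _ _) _; [exact: B|exact: B|].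
  rewrite [ltRHS](splitr e) ler_ltD ?hM //.
  apply: le_trans (ler_wpM2l (rnorm_ge0 a) (ltW (hN _ _ Nk Nl))) _.
  rewrite invfM [e * _]mulrA mulrA ler_pdivrMr; last first.
    by rewrite ltr_wpDl ?rnorm_ge0.
  by rewrite mulrC ler_pM2l ?half_gt0 // lerDl.
have SZ (a : R[i]) (x : Y) : osp_set x -> osp_set (a *: x).
  by move=> hx; have := Sl a _ _ hx S0; rewrite addr0.
have Ssum (I : Type) (r : seq I) (F : I -> Y) :
    (forall i, osp_set (F i)) -> osp_set (\sum_(i <- r) F i).
  move=> hF; elim: r => [|i r IH]; first by rewrite big_nil.
  by rewrite big_cons -[F i]scale1r; exact: Sl.
split=> //.
- move=> m n x hx; apply: (limn_ge (N := 0%N) (completion_norm_cvg hx)) => k _.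
  exact: ruan_ge0 (mx_in_nth k hx).
- move=> m n p C x c c0 hC hx.
  have ix : mx_in (lscale C x) by move=> i j; rewrite mxE; apply: Ssum => k; exact: SZ.
  apply/ler_addgt0Pr => e e0; have c1 : 0 < c + 1 by rewrite ltr_wpDl.
  have [N hN] := completion_norm_near hx (divr_gt0 e0 c1).
  apply: (completion_norm_le (N := N)) => // k /hN xk.
  have -> : nth_mx (lscale C x) k = lscale C (nth_mx x k).
    apply/matrixP => i j; rewrite !mxE fct_sumE; apply: eq_bigr => l _.
    by rewrite mxE.
  apply: le_trans (ruan_l hX c0 hC (mx_in_nth k hx)) _.
  apply: le_trans (ler_wpM2l c0 (ltW xk)) _; rewrite mulrDr lerD2l mulrA.
  by rewrite ler_pdivrMr // mulrC ler_wpM2l ?ltW // ltrDl.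
- move=> m n p x C c c0 hC hx.
  have ix : mx_in (rscale x C) by move=> i j; rewrite mxE; apply: Ssum => k; exact: SZ.
  apply/ler_addgt0Pr => e e0; have c1 : 0 < c + 1 by rewrite ltr_wpDl.
  have [N hN] := completion_norm_near hx (divr_gt0 e0 c1).
  apply: (completion_norm_le (N := N)) => // k /hN xk.
  have -> : nth_mx (rscale x C) k = rscale (nth_mx x k) C.
    apply/matrixP => i j; rewrite !mxE fct_sumE; apply: eq_bigr => l _.
    by rewrite mxE.
  apply: le_trans (ruan_r hX c0 hC (mx_in_nth k hx)) _.
  apply: le_trans (ler_wpM2l c0 (ltW xk)) _; rewrite mulrDr lerD2l mulrA.
  by rewrite ler_pdivrMr // mulrC ler_wpM2l ?ltW // ltrDl.
- move=> m n m' n' x y c hx hy xc yc.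
  have ib : mx_in (block_mx x 0 0 y).
    move=> i j; rewrite !mxE; case: (fintype.split i) => k; rewrite mxE;
      by case: (fintype.split j) => l; rewrite ?mxE.
  apply/ler_addgt0Pr => e e0.
  have [N hN] := completion_norm_near hx e0; have [M hM] := completion_norm_near hy e0.
  apply: (completion_norm_le (N := maxn N M)) => // k.
  rewrite geq_max => /andP[/hN xk /hM yk].
  have -> : nth_mx (block_mx x 0 0 y) k = block_mx (nth_mx x k) 0 0 (nth_mx y k).
    apply/matrixP => i j; rewrite mxE.
    case: (split_ordP i) => i' ->; case: (split_ordP j) => j' ->;
      by rewrite ?block_mxEul ?block_mxEur ?block_mxEdl ?block_mxEdr !mxE.
  apply: (ruan_d hX); [exact: mx_in_nth|exact: mx_in_nth| |].
    by rewrite (le_trans (ltW xk)) // lerD2r.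
  by rewrite (le_trans (ltW yk)) // lerD2r.
Qed.

Section Extension.
Variables (L : hilbert R) (s : X -> L -> L) (hs : ccmap s).

(** The default 0 is not taken on Cauchy sequences, where the limit exists. *)
Definition completion_map (x : Y) : L -> L := fun h =>
  xget 0 [set y | rcvg (fun k => s (x k) h) y].

Lemma cc_const_bound (x : X) h : osp_set x ->
  rnorm (s x h) <= osp_norm (const_mx x : 'M[X]_1) * rnorm h.
Proof.
move=> hx; have ix : mx_in (const_mx x : 'M[X]_1) by move=> i j; rewrite mxE.
have := cc_norm hs ix (fun=> h); rewrite !big_ord1 !mxE -exprMn.
by rewrite ler_pXn2r ?nnegrE ?mulr_ge0 ?rnorm_ge0 ?(ruan_ge0 hX).
Qed.

Lemma completion_mapP (x : Y) h : osp_set x ->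
  rcvg (fun k => s (x k) h) (completion_map x h).
Proof.
move=> [hx cx]; suff [y hy] : exists y, rcvg (fun k => s (x k) h) y.
  exact: (xgetPex 0 (ex_intro _ y hy)).
apply: rcauchy_rcvg => e e0.
have h0 : 0 < rnorm h + 1 by rewrite ltr_wpDl ?rnorm_ge0.
have [N hN] := cx _ (divr_gt0 e0 h0); exists N => k l Nk Nl.
have B : osp_set (x k - x l).
  by rewrite -scaleN1r; apply: (ruanD hX) => //; exact: ruanZ.
have -> : s (x k) h - s (x l) h = s (x k - x l) h.
  have -> : x k - x l = (-1) *: x l + x k by rewrite scaleN1r addrC.
  rewrite (cc_lin hs) // -[RHS]/((-1) *: s (x l) h + s (x k) h).
  by rewrite scaleN1r addrC.
apply: le_lt_trans (cc_const_bound h B) _.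
apply: (@le_lt_trans _ _ (osp_norm (const_mx (x k - x l) : 'M[X]_1) * (rnorm h + 1))).
  rewrite ler_wpM2l ?lerDl // (ruan_ge0 hX) // => i j; by rewrite mxE.
by rewrite -ltr_pdivlMr // hN.
Qed.

Lemma completion_map_const (x : X) : completion_map (fun=> x) = s x.
Proof.
apply/funext => h; have P := rcvg_const (s x h).
exact: rcvg_uniq (xgetPex 0 (ex_intro _ _ P)) P.
Qed.

Lemma completion_map_cc : ccmap completion_map.
Proof.
have lin (x : Y) : osp_set x -> linear (completion_map x).
  move=> hx c h k; apply: (rcvg_uniq (completion_mapP _ hx)).
  have hk q : linear (s (x q)) by case: (cc_bounded hs (proj1 hx q)).
  under eq_fun do rewrite hk.
  by apply: rcvgD; [apply: rcvgZ|]; exact: completion_mapP.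
have opbd_map m n (x : 'M[Y]_(m, n)) : mx_in x ->
    opbd (map_mx completion_map x) (osp_norm x).
  move=> hx; apply: opbd_lim; first exact: (ruan_ge0 completion_ruan).
  move=> e e0 h; have [N hN] := completion_norm_near hx e0.
  have cv i : rcvg (fun k => \sum_j s (x i j k) (h j))
                   (\sum_j map_mx completion_map x i j (h j)).
    by apply: rcvg_sum => j; rewrite mxE; exact: completion_mapP.
  have lim_le : (fun k => \sum_i rnorm (\sum_j s (x i j k) (h j)) ^+ 2) @ \oo -->
      \sum_i rnorm (\sum_j map_mx completion_map x i j (h j)) ^+ 2.
    apply: cvg_sumR => i; have := rcvg_norm (cv i) => c.
    under eq_fun do rewrite expr2; rewrite expr2; exact: cvgM.
  rewrite -(cvg_lim _ lim_le) //; apply: (limn_le (N := N)).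
    by apply/cvg_ex; eexists; exact: lim_le.
  move=> k /hN xk; have ik := mx_in_nth k hx.
  have := opbd_weaken (ruan_ge0 hX ik) (ltW xk) (cc_norm hs ik) h.
  congr (_ <= _); apply: eq_bigr => i _; congr (rnorm _ ^+ 2).
  by apply: eq_bigr => j _; rewrite !mxE.
split=> //.
- move=> c x y hx hy; apply/funext => h.
  apply: (rcvg_uniq (completion_mapP _ (ruan_lin completion_ruan c hx hy))).
  have E k : s ((c *: x + y) k) h = c *: s (x k) h + s (y k) h.
    have -> : (c *: x + y) k = c *: x k + y k by [].
    by rewrite (cc_lin hs); [|exact: (proj1 hx)|exact: (proj1 hy)].
  under eq_fun do rewrite E.
  by apply: rcvgD; [apply: rcvgZ|]; exact: completion_mapP.
- move=> x hx; split; first exact: lin.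
  have ix : mx_in (const_mx x : 'M[Y]_1) by move=> i j; rewrite mxE.
  exists (osp_norm (const_mx x : 'M[Y]_1)) => h.
  have := opbd_map _ _ _ ix (fun=> h); rewrite !big_ord1 !mxE -exprMn.
  by rewrite ler_pXn2r ?nnegrE ?mulr_ge0 ?rnorm_ge0 ?(ruan_ge0 completion_ruan).
Qed.

End Extension.
End Completion.

(** * Operators on ell_1 *)

Section Ell1.
Context {R : realType} (T : choiceType).

Let D : set (T -> R[i]^o) :=
  [set x | summable [set: T] (fun t => (rnorm (x t : R[i]))%:E)].
Definition ell1_norm (x : T -> R[i]^o) : R :=
  fine (\esum_(t in [set: T]) (rnorm (x t : R[i]))%:E).

Let a (x : T -> R[i]^o) t : R := rnorm (x t : R[i]).
Let a_ge0 x t : 0 <= a x t.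
Proof. exact: rnorm_ge0. Qed.

Lemma ell1_esumE x : D x -> (\esum_(t in [set: T]) (a x t)%:E)%E = (ell1_norm x)%:E.
Proof.
move=> Dx; rewrite /ell1_norm fineK //.
suff E : (\esum_(t in [set: T]) (rnorm (x t : R[i]))%:E)%E =
    (\esum_(t in [set: T]) `|(rnorm (x t : R[i]))%:E|)%E by rewrite E -summableE.
by apply: eq_esum => t _; rewrite gee0_abs // lee_fin a_ge0.
Qed.

Lemma ell1_sum_le x (s : seq T) : D x -> uniq s -> \sum_(t <- s) a x t <= ell1_norm x.
Proof.
move=> Dx us; rewrite -lee_fin -ell1_esumE // -sumEFin.
apply: ereal_sup_ubound; exists [set` s]; first by split=> //; exact: finite_seq.
by rewrite -fsbig_seq.
Qed.

Lemma ell1_intro x (c : R) : (forall s : seq T, uniq s -> \sum_(t <- s) a x t <= c) ->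
  D x /\ ell1_norm x <= c.
Proof.
move=> h; have le : ((\esum_(t in [set: T]) (a x t)%:E) <= c%:E)%E.
  apply: ge_ereal_sup => _ [A [fA _] <-].
  by rewrite fsbig_finite //= sumEFin lee_fin h // fset_uniq.
have Dx : D x.
  apply: le_lt_trans (ltry c); apply: le_trans le; apply: le_esum => t _.
  by rewrite gee0_abs // lee_fin a_ge0.
by split=> //; rewrite -lee_fin -ell1_esumE.
Qed.

Lemma ell1_approx x e : D x -> 0 < e ->
  exists2 s : seq T, uniq s & ell1_norm x - e < \sum_(t <- s) a x t.
Proof.
move=> Dx e0; apply: contrapT => h.
have : ell1_norm x <= ell1_norm x - e.
  apply: (proj2 (ell1_intro _)) => s us; rewrite leNgt; apply/negP => lt.
  by apply: h; exists s.
by rewrite lerBrDr gerDl leNgt e0.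
Qed.

Lemma ell1_norm_ge0 x : D x -> 0 <= ell1_norm x.
Proof. by move=> Dx; have := @ell1_sum_le x [::] Dx isT; rewrite big_nil. Qed.

Lemma ell1_zero : D 0.
Proof.
apply: (proj1 (@ell1_intro 0 0 _)) => s _; rewrite big1 // => t _.
exact: rnorm0.
Qed.

Lemma ell1_lin (c : R[i]) x y : D x -> D y -> D (c *: x + y).
Proof.
move=> Dx Dy; apply: (proj1 (@ell1_intro _ (rnorm c * ell1_norm x + ell1_norm y) _)).
move=> s us; apply: (@le_trans _ _ (\sum_(t <- s) (rnorm c * a x t + a y t))).
  by apply: ler_sum => t _; rewrite /a /= -rnormM; exact: rnormD.
rewrite big_split -mulr_sumr lerD ?ell1_sum_le // ler_wpM2l ?rnorm_ge0 //.
exact: ell1_sum_le.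
Qed.

Lemma ell1_delta t : D (delta t) /\ ell1_norm (delta t) <= 1.
Proof.
apply: ell1_intro => s us; have [ts|ts] := boolP (t \in s).
  rewrite (bigD1_seq t) //= big1 ?addr0 => [|i it].
    by rewrite /a /delta eqxx /rnorm normr1.
  by rewrite /a /delta (negPf it) rnorm0.
rewrite big_seq big1 // => i si; rewrite /a /delta.
by have [E|_] := eqVneq i t; [rewrite -E si in ts|rewrite rnorm0].
Qed.

Lemma ell1_ruan : ruan (ell1 (R := R) T).
Proof. exact: max_opspace_ruan ell1_zero ell1_lin ell1_norm_ge0. Qed.

Section Summation.
Variable L : hilbert R.
Implicit Types (z : T -> L) (y : L).

(** Unconditional summation along finite subsets, encoded as duplicate-free lists, as T may be
    uncountable. *)
Definition issum z y : Prop := forall e : R, 0 < e -> exists2 s : seq T,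
  uniq s & forall r, uniq r -> {subset s <= r} -> rnorm (\sum_(t <- r) z t - y) < e.

Lemma undup_subl (s r : seq T) : {subset s <= undup (s ++ r)}.
Proof. by move=> t ts; rewrite mem_undup mem_cat ts. Qed.

Lemma undup_subr (s r : seq T) : {subset r <= undup (s ++ r)}.
Proof. by move=> t tr; rewrite mem_undup mem_cat tr orbT. Qed.

Lemma issum_uniq z y y' : issum z y -> issum z y' -> y = y'.
Proof.
move=> h h'; apply/eqP; rewrite -subr_eq0; apply/eqP/rnorm0_eq0/eqP.
rewrite eq_le rnorm_ge0 andbT leNgt; apply/negP => /half_gt0 e2.
have [s us hs] := h _ e2; have [r ur hr] := h' _ e2.
have := hs _ (undup_uniq _) (@undup_subl s r); have := hr _ (undup_uniq _) (@undup_subr s r).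
set S := \sum_(t <- _) _; have := rnormB_triangle y S y'; rewrite (rnormBC y S).
by move=> *; lra.
Qed.

Lemma issum_lin (c : R[i]) z y z' y' : issum z y -> issum z' y' ->
  issum (fun t => c *: z t + z' t) (c *: y + y').
Proof.
move=> h h' e e0; have c0 : 0 < 2 * (rnorm c + 1).
  by rewrite mulr_gt0 // ltr_wpDl ?rnorm_ge0.
have [s us hs] := h _ (divr_gt0 e0 c0); have [r ur hr] := h' _ (half_gt0 e0).
exists (undup (s ++ r)); first exact: undup_uniq.
move=> q uq sq; rewrite big_split -scaler_sumr /= opprD addrACA -scalerBr.
apply: le_lt_trans (rnormD _ _) _; rewrite rnormZ [ltRHS](splitr e).
apply: ler_ltD; last first.
  by apply: hr => // t tr; apply: sq; exact: undup_subr.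
have hq : rnorm (\sum_(t <- q) z t - y) <= e / (2 * (rnorm c + 1)).
  by apply/ltW/hs => // t ts; apply: sq; exact: undup_subl.
apply: le_trans (ler_wpM2l (rnorm_ge0 c) hq) _.
rewrite invfM [e * _]mulrA mulrA ler_pdivrMr; last by rewrite ltr_wpDl ?rnorm_ge0.
by rewrite mulrC ler_pM2l ?half_gt0 // lerDl.
Qed.

Lemma issum_le z y c : issum z y ->
  (forall s, uniq s -> rnorm (\sum_(t <- s) z t) <= c) -> rnorm y <= c.
Proof.
move=> h hc; apply/ler_addgt0Pr => e /h[s us hs].
have := hs s us (fun _ => id); have := hc s us; set S := \sum_(t <- s) _.
have := rnormB_triangle y S 0; rewrite !subr0 (rnormBC y) => *; lra.
Qed.

Lemma sum_diff z (s r : seq T) : uniq s -> uniq r -> {subset s <= r} ->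
  \sum_(t <- r) z t - \sum_(t <- s) z t = \sum_(t <- r | t \notin s) z t.
Proof.
move=> us ur sr; rewrite (bigID (fun t => t \in s)) /=.
suff -> : \sum_(t <- r | t \in s) z t = \sum_(t <- s) z t by rewrite addrAC subrr add0r.
rewrite -big_filter; apply: perm_big; apply: uniq_perm => //.
  exact: filter_uniq.
by move=> t; rewrite mem_filter andbC; case: (boolP (t \in s)) => [/sr ->|]; rewrite ?andbF.
Qed.

(** A finite set that carries all but e / (C + 1) of the norm of x leaves a tail of z smaller than
    e. Such sets for tolerances 1 / (n + 1) give Cauchy partial sums, compared through unions. *)
Lemma issum_exists (x : T -> R[i]^o) (C : R) z : D x -> 0 <= C ->
  (forall t, rnorm (z t) <= C * a x t) -> exists y, issum z y.
Proof.
move=> Dx C0 zx.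
have tail (e : R) : 0 < e -> exists2 s, uniq s & forall r, uniq r ->
    {subset s <= r} -> rnorm (\sum_(t <- r) z t - \sum_(t <- s) z t) < e.
  move=> e0; have C1 : 0 < C + 1 by rewrite ltr_wpDl.
  have [s us hs] := ell1_approx Dx (divr_gt0 e0 C1); exists s => // r ur sr.
  rewrite sum_diff //; apply: le_lt_trans (rnorm_sum _ _ _) _.
  have hr : \sum_(t <- r | t \notin s) a x t < e / (C + 1).
    have ucat : uniq (s ++ [seq t <- r | t \notin s]).
      rewrite cat_uniq us filter_uniq // andbT /=; apply/hasPn => t.
      by rewrite mem_filter => /andP[].
    have := ell1_sum_le Dx ucat; rewrite big_cat big_filter /= => h; lra.
  apply: (@le_lt_trans _ _ ((C + 1) * \sum_(t <- r | t \notin s) a x t)).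
    rewrite mulr_sumr; apply: ler_sum => t _; apply: le_trans (zx t) _.
    by rewrite ler_wpM2r // lerDl.
  by rewrite mulrC -ltr_pdivlMr.
have n0 n : 0 < (n.+1%:R^-1 : R) by rewrite invr_gt0.
have /choice[s hs] n : exists s, uniq s /\ forall r, uniq r -> {subset s <= r} ->
    rnorm (\sum_(t <- r) z t - \sum_(t <- s) z t) < n.+1%:R^-1.
  by have [s us h] := tail _ (n0 n); exists s.
have [|y hy] := @rcauchy_rcvg R L (fun n => \sum_(t <- s n) z t).
  move=> e /half_gt0/harmonic_small[N hN]; exists N => m n Nm Nn.
  set S := \sum_(t <- undup (s m ++ s n)) z t.
  apply: le_lt_trans (rnormB_triangle _ S _) _; rewrite (splitr e) ltrD //.
    rewrite rnormBC; apply: lt_trans (hN _ Nm); apply: (proj2 (hs m)).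
      exact: undup_uniq.
    exact: undup_subl.
  apply: lt_trans (hN _ Nn); apply: (proj2 (hs n)); first exact: undup_uniq.
  exact: undup_subr.
exists y => e /half_gt0 e2; have [N hN] := harmonic_small e2; have [M hM] := hy _ e2.
pose n := maxn N M; exists (s n); first exact: (proj1 (hs n)).
move=> r ur sr; apply: le_lt_trans (rnormB_triangle _ (\sum_(t <- s n) z t) _) _.
rewrite (splitr e) ltrD ?hM ?leq_maxr //.
by apply: lt_trans (hN n (leq_maxl _ _)); exact: (proj2 (hs n)).
Qed.

Variable p : T -> L -> L.
Hypotheses (pl : forall t, linear (p t)) (pb : forall t h, rnorm (p t h) <= rnorm h).

Definition ell1_map (x : T -> R[i]^o) : L -> L := fun h =>
  xget 0 [set y | issum (fun t => x t *: p t h) y].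

Lemma ell1_mapP x h : D x -> issum (fun t => x t *: p t h) (ell1_map x h).
Proof.
move=> Dx; have [|y hy] := @issum_exists x (rnorm h) (fun t => x t *: p t h) Dx (rnorm_ge0 h).
  by move=> t; rewrite rnormZ mulrC ler_wpM2r ?rnorm_ge0.
exact: (xgetPex 0 (ex_intro _ y hy)).
Qed.

Lemma ell1_map_contractive : nu_contractive D ell1_norm (H := L) ell1_map.
Proof.
split=> [c x y Dx Dy|x Dx].
  apply/funext => h; apply: (issum_uniq (ell1_mapP h (ell1_lin c Dx Dy))).
  have := issum_lin c (ell1_mapP h Dx) (ell1_mapP h Dy).
  congr issum; apply/funext => t; rewrite scalerA -scalerDl //.
have lin : linear (ell1_map x).
  move=> c h k; apply: (issum_uniq (ell1_mapP _ Dx)).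
  have := issum_lin c (ell1_mapP h Dx) (ell1_mapP k Dx).
  congr issum; apply/funext => t; rewrite pl scalerDr !scalerA.
  by rewrite [c * _]mulrC.
have bd h : rnorm (ell1_map x h) <= ell1_norm x * rnorm h.
  apply: (issum_le (ell1_mapP h Dx)) => s us; apply: le_trans (rnorm_sum _ _ _) _.
  apply: (@le_trans _ _ (\sum_(t <- s) a x t * rnorm h)).
    by apply: ler_sum => t _; rewrite rnormZ ler_wpM2l ?rnorm_ge0.
  by rewrite -mulr_suml ler_wpM2r ?rnorm_ge0 // ell1_sum_le.
by split; [split=> //; exists (ell1_norm x)|apply: opnorm_le => //; exact: ell1_norm_ge0].
Qed.

Lemma ell1_map_delta t : ell1_map (delta t) = p t.
Proof.
apply/funext => h; apply: (issum_uniq (ell1_mapP h (proj1 (ell1_delta t)))).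
move=> e e0; exists [:: t] => // r ur tr.
have rt : t \in r by apply: tr; rewrite inE.
rewrite (bigD1_seq t) //= big1 ?addr0 => [|i it].
  by rewrite /delta eqxx scale1r subrr rnorm0.
by rewrite /delta (negPf it) scale0r.
Qed.

(** A contractive map is one of those over which the maximal norm is a supremum, so it is completely
    contractive. *)
Lemma ell1_map_cc : ccmap (X := ell1 (R := R) T) ell1_map.
Proof.
have [ml mb] := ell1_map_contractive; split=> // [x /mb[]//|m n x hx].
exact: (nu_contractive_norm ell1_norm_ge0 ell1_map_contractive).
Qed.

End Summation.

Lemma ell1_diag_delta n (t : 'I_n -> T) :
  osp_norm (\matrix_(i, j) (if i == j then delta (t i) else 0) : 'M[ell1 (R := R) T]_n) <= 1.
Proof.
apply: (max_norm_diag ell1_zero ell1_norm_ge0 ler01) => i.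
  exact: (proj1 (ell1_delta (t i))).
exact: (proj2 (ell1_delta (t i))).
Qed.

End Ell1.

(** * Completely bounded extensions *)

Section Powers.
Context {R : realType}.

Lemma haagerup_pow_ruan (E : opspace R) n : ruan E -> ruan (haagerup_pow E n).
Proof.
move=> hE; elim: n => [|n IH] //=.
exact: completion_ruan (haagerup_alg_ruan IH hE).
Qed.

Lemma tens_in (E F : opspace R) (hE : ruan E) (hF : ruan F) (x : E) (y : F) :
  osp_set x -> osp_set y -> osp_set (tens x y).
Proof.
move=> hx hy; apply: completion_const_in; first exact: haagerup_alg_ruan.
by exists 1%N, (fun=> x), (fun=> y); split=> //; rewrite big_ord1.
Qed.

Lemma tens_pow_in (E : opspace R) (x : nat -> E) n : ruan E ->
  (forall i, osp_set (x i)) -> osp_set (tens_pow x n).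
Proof.
by move=> hE hx; elim: n => [|n IH] //=; apply: tens_in => //; exact: haagerup_pow_ruan.
Qed.

Lemma tens_pow_ext (E : opspace R) (x y : nat -> E) n :
  (forall i, (i <= n)%N -> x i = y i) -> tens_pow x n = tens_pow y n.
Proof.
elim: n => [|n IH] xy /=; first exact: xy.
by rewrite IH ?xy // => i le; apply: xy; exact: leqW.
Qed.

Section RepresentationToCb.
Variables (G : groupType) (Gamma : set G) (L : hilbert R) (pi : G -> L -> L).
Hypothesis hpi : unitary_rep pi.

Let E : opspace R := ell1 Gamma.
Let hE : ruan E := ell1_ruan Gamma.

Lemma unitary_norm t h : rnorm (pi t h) = rnorm h.
Proof.
have [/(_ t)[_ ud _] _ _] := hpi; apply/eqP; rewrite -(@eqrXn2 _ 2) ?rnorm_ge0 //.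
by apply/eqP/complexI; rewrite !rmorphXn /= -!rnormE !hnormE ud.
Qed.

(** Each further tensor leg composes on the right with its operator on L, and multiplicativity of pi
    collects the factors. *)
Lemma pow_representation n : exists s : haagerup_pow E n -> L -> L,
  ccmap s /\ forall (t : nat -> Gamma),
    s (tens_pow (fun i => delta (t i)) n) = pi (\prod_(i < n.+1) val (t i))%g.
Proof.
have [u1 pi1 piM] := hpi.
pose p (t : Gamma) := pi (val t).
have pl t : linear (p t) by case: (u1 (val t)).
have pb t h : rnorm (p t h) <= rnorm h by rewrite unitary_norm.
have hp := ell1_map_cc pl pb; have pd := ell1_map_delta pb.
elim: n => [|n [s [hs sE]]].
  by exists (ell1_map p); split=> // t; rewrite /= pd big_ord1.
have hn := haagerup_pow_ruan n hE.
have hq := prod_map_cc hn hE hs hp.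
exists (completion_map (prod_map hs hp)); split.
  have hc := completion_map_cc (haagerup_alg_ruan hn hE) hq; exact: hc.
move=> t; rewrite [tens_pow _ _]/= /tens completion_map_const.
apply/funext => h; rewrite big_ord_recr /= piM -sE -[pi (val _) h]/(p (t n.+1) h) -pd.
have := prod_mapE hs hp (fun _ : 'I_1 => tens_pow (fun i => delta (t i)) n)
  (fun=> delta (t n.+1)) h.
by rewrite !big_ord1.
Qed.

Lemma representation_cb (H : hilbert R) (f : G -> H -> H) (xi : L -> H) (eta : H -> L)
    (K : R) :
  bounded_op xi -> bounded_op eta -> (forall t h, f t h = xi (pi t (eta h))) ->
  opnorm xi * opnorm eta <= K -> cb_extendable Gamma f K.
Proof.
move=> bxi beta fE xeK n; have [s [hs sE]] := pow_representation n.
have [xil _] := bxi; have [etal _] := beta.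
have x0 := opnorm_ge0 bxi; have e0 := opnorm_ge0 beta.
pose u (x : haagerup_pow E n) : BH H H := fun h => xi (s x (eta h)).
have ubd m (x : 'M[haagerup_pow E n]_m) : mx_in x -> osp_norm x <= 1 ->
    @opbd R H H m m (map_mx u x) (opnorm xi * opnorm eta).
  move=> hx x1 h; have n0 := ruan_ge0 (haagerup_pow_ruan n hE) hx.
  apply: (@le_trans _ _ (\sum_i opnorm xi ^+ 2 *
      rnorm (\sum_j map_mx s x i j (eta (h j))) ^+ 2)).
    apply: ler_sum => i _; rewrite -exprMn ler_pXn2r ?nnegrE ?rnorm_ge0 ?mulr_ge0 ?rnorm_ge0 //.
    apply: (le_trans _ (opnormP _ bxi)); rewrite le_eqVlt; apply/orP; left; apply/eqP.
    rewrite linear_sum_fun //; congr rnorm; apply: eq_bigr => j _.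
    by rewrite !mxE.
  rewrite -mulr_sumr exprMn -[leRHS]mulrA ler_wpM2l ?sqr_ge0 //.
  apply: le_trans (opbd_weaken n0 x1 (cc_norm hs hx) (fun j => eta (h j))) _.
  rewrite expr1n mul1r mulr_sumr; apply: ler_sum => j _.
  by rewrite -exprMn ler_pXn2r ?nnegrE ?mulr_ge0 ?rnorm_ge0 // opnormP.
have cbK : (cbnorm u <= K%:E)%E.
  apply: ge_ereal_sup => _ [m [x [hx x1 ->]]]; rewrite lee_fin.
  apply: le_trans xeK; apply: opmx_norm_le; first exact: mulr_ge0.
  exact: ubd.
exists u; split=> //; last first.
  by move=> t; apply/funext => h; rewrite /u sE fE.
split; last by apply: le_lt_trans cbK _; exact: ltry.
- move=> c x y hx hy; apply/funext => h.
  by rewrite /u (cc_lin hs) // xil.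
- move=> x hx; have [sl _] := cc_bounded hs hx.
  have [M M0 hM] := bounded_opP (cc_bounded hs hx).
  split=> [c h k|]; first by rewrite /u etal sl xil.
  exists (opnorm xi * (M * opnorm eta)) => h.
  apply: le_trans (opnormP _ bxi) _; rewrite -!mulrA ler_wpM2l //.
  by apply: le_trans (hM _) _; rewrite ler_wpM2l // opnormP.
Qed.

End RepresentationToCb.

(** * Energy bounds from completely bounded extensions *)

Section CbSound.
Variables (G : groupType) (Gamma : set G) (Gamma1 : Gamma 1%g).
Variables (V : lmodType R[i]) (H : hilbert R) (act : G -> V -> V).
Variables (eta0 : H -> V) (xi0 : V -> H) (f : G -> H -> H) (K : R).
Hypotheses (actl : forall t, linear (act t)) (act1 : forall v, act 1%g v = v)
  (actM : forall s t v, act (s * t)%g v = act s (act t v))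
  (etal : linear eta0) (xil : linear xi0) (K_ge0 : 0 <= K).
Hypothesis fE : forall t h, xi0 (act t (eta0 h)) = f t h.
Hypothesis Hcb : cb_extendable Gamma f K.

Let E : opspace R := ell1 Gamma.
Let hE : ruan E := ell1_ruan Gamma.
Let dpow (t : nat -> Gamma) N : haagerup_pow E N := tens_pow (fun i => delta (t i)) N.

Let dpow_in t N : osp_set (dpow t N).
Proof. by apply: tens_pow_in => // i; exact: (proj1 (ell1_delta _)). Qed.

(* T is the action on V of the element of the group algebra given by x. *)
Definition represents N (x : haagerup_pow E N) (T : V -> V) : Prop :=
  exists s : seq (R[i] * (nat -> Gamma)),
    x = \sum_(p <- s) p.1 *: dpow p.2 N /\
    forall v, T v = \sum_(p <- s) p.1 *: act (\prod_(i < N.+1) val (p.2 i))%g v.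

Lemma represents_in N (x : haagerup_pow E N) T : represents x T -> osp_set x.
Proof.
move=> [s [-> _]]; have hN := haagerup_pow_ruan N hE.
by apply: (ruan_sum hN) => p; exact: ruanZ.
Qed.

Lemma represents_linear N (x : haagerup_pow E N) T : represents x T -> linear T.
Proof.
move=> [s [_ TE]] c v w; rewrite !TE scaler_sumr -big_split; apply: eq_bigr => p _.
by rewrite actl scalerDr !scalerA mulrC.
Qed.

Lemma represents0 N : represents (0 : haagerup_pow E N) (fun=> 0).
Proof. by exists [::]; split=> [|v]; rewrite big_nil. Qed.

Lemma represents_lin N (c : R[i]) (x y : haagerup_pow E N) T U :
  represents x T -> represents y U ->
  represents (c *: x + y) (fun v => c *: T v + U v).
Proof.
move=> [s [-> TE]] [r [-> UE]]; exists ([seq (c * p.1, p.2) | p <- s] ++ r); split.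
  rewrite big_cat big_map scaler_sumr; congr (_ + _).
  by apply: eq_bigr => p _; rewrite scalerA.
move=> v; rewrite TE UE big_cat big_map scaler_sumr; congr (_ + _).
by apply: eq_bigr => p _; rewrite scalerA.
Qed.

Lemma represents_sum N (I : Type) (r : seq I) (c : I -> R[i])
    (x : I -> haagerup_pow E N) T :
  (forall k, represents (x k) (T k)) ->
  represents (\sum_(k <- r) c k *: x k) (fun v => \sum_(k <- r) c k *: T k v).
Proof.
move=> h; elim: r => [|k r IH].
  rewrite big_nil (_ : (fun v => _) = (fun=> 0)); first exact: represents0.
  by apply/funext => v; rewrite big_nil.
rewrite big_cons (_ : (fun v => _) =
  (fun v => c k *: T k v + \sum_(k <- r) c k *: T k v)); first exact: represents_lin.
by apply/funext => v; rewrite big_cons.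
Qed.

Lemma represents_delta (t : Gamma) : represents (delta t : haagerup_pow E 0) (act (val t)).
Proof.
exists [:: (1, fun=> t)]; split=> [|v]; rewrite big_seq1 scale1r //=.
by rewrite big_ord1.
Qed.

Lemma represents_tens N (x : haagerup_pow E N) T (t : Gamma) : represents x T ->
  represents (tens x (delta t) : haagerup_pow E N.+1) (fun v => T (act (val t) v)).
Proof.
move=> [s [-> TE]]; pose ext (w : nat -> Gamma) i := if (i <= N)%N then w i else t.
have hN := haagerup_pow_ruan N hE.
exists [seq (p.1, ext p.2) | p <- s]; split.
  rewrite big_map; apply/funext => k; rewrite fct_sumE /tens.
  rewrite (tens_sum_l hN) //; last exact: (proj1 (ell1_delta _)).
  apply: eq_bigr => p _; rewrite /dpow /=; congr (_ *: _).
  rewrite /tens /ext ltnn; congr tens_alg.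
  by apply: tens_pow_ext => i ->.
move=> v; rewrite TE big_map; apply: eq_bigr => p _; congr (_ *: _).
rewrite [in RHS]big_ord_recr /= {2}/ext ltnn actM; congr (act _ _).
by apply: eq_bigr => i _; rewrite /ext -ltnS ltn_ord.
Qed.

(** The energy bound strengthened so as to survive the construction of l: the family may first be
    hit by any X of norm at most 1 over any tensor power. Each move on l is absorbed into X, and N
    is left free because a Gamma-move raises it. *)
Definition cb_claim (l : seq V) (e : R) : Prop :=
  forall n, size l = n -> forall N (X : 'M[haagerup_pow E N]_n) (T : 'I_n -> 'I_n -> V -> V),
    (forall i j, represents (X i j) (T i j)) -> osp_norm X <= 1 ->
    \sum_i rnorm (xi0 (\sum_j T i j (nth 0 l j))) ^+ 2 <= e.

(** The extension u is used here: on the element represented by T it takes the value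
    [xi0 \o T \o eta0], so the claim is the bound K for u at X. *)
Lemma cb_claim_base (hs : seq H) :
  cb_claim [seq eta0 h | h <- hs] (K ^+ 2 * \sum_(h <- hs) rnorm h ^+ 2).
Proof.
move=> n; rewrite size_map => sn N X T XT X1.
have [u [[ul ub _] uK uE]] := Hcb N.
have hN := haagerup_pow_ruan N hE.
have Xin : mx_in X by move=> i j; exact: represents_in (XT i j).
have uT i j h : u (X i j) h = xi0 (T i j (eta0 h)).
  have [s [-> TE]] := XT i j.
  rewrite (linear_on_comb s (fun p => p.1) hN ul) => [|p]; last exact: dpow_in.
  rewrite fct_sumE TE linear_sum_fun //; apply: eq_bigr => p _.
  by rewrite linearZ_fun // fE -uE.
have uXK : @opmx_norm R H H n n (map_mx u X) <= K.
  rewrite -lee_fin; apply: le_trans uK; apply: ereal_sup_ubound.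
  by exists n, X.
have uXb : @mx_bounded R H H n n (map_mx u X).
  by move=> i j; rewrite mxE; exact: (ub _ (Xin i j)).
have [c uXc] := opbd_exists uXb.
have := opbd_weaken (opmx_norm_ge0 uXc) uXK (opmx_normP uXb).
move=> /(_ (fun j => nth 0 hs j)).
congr (_ <= _); last first.
  by rewrite (big_nth 0) big_mkord sn.
apply: eq_bigr => i _; rewrite linear_sum_fun //; congr (rnorm _ ^+ 2).
apply: eq_bigr => j _; rewrite mxE uT (nth_map 0) // sn; exact: ltn_ord.
Qed.

(** Applying X to C l is applying X C to l, and X C still has norm at most 1. *)
Lemma cb_claim_comb (l l' : seq V) n (C : 'M[R[i]]_n) e :
  size l = n -> size l' = n -> scalar_bd C 1 ->
  (forall j : 'I_n, nth 0 l' j = \sum_k C j k *: nth 0 l k) ->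
  cb_claim l e -> cb_claim l' e.
Proof.
move=> sl sl' C1 ll h m sm N; rewrite -sm sl' => X T XT X1.
have hN := haagerup_pow_ruan N hE.
have Xin : mx_in X by move=> i j; exact: represents_in (XT i j).
have XC i k : represents (rscale X C i k) (fun v => \sum_j C j k *: T i j v).
  by rewrite mxE; apply: represents_sum.
have XC1 : osp_norm (rscale X C) <= 1.
  by apply: le_trans (ruan_r hN ler01 C1 Xin) _; rewrite mul1r.
have := h n sl N (rscale X C) _ XC XC1; congr (_ <= _); apply: eq_bigr => i _; congr (rnorm (xi0 _) ^+ 2).
rewrite exchange_big; apply: eq_bigr => j _; rewrite ll.
have Tl := represents_linear (XT i j).
by rewrite linear_sum_fun //; apply: eq_bigr => k _; rewrite linearZ_fun.
Qed.

(** Applying X after the diagonal with entries t, 1, ..., 1 amounts to using the Haagerup product of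
    X with the diagonal matrix of the corresponding basis vectors. Both factors have norm at most 1,
    and the product lives in the next tensor power. *)
Lemma cb_claim_shift (t : Gamma) v l e :
  cb_claim (v :: l) e -> cb_claim (act (val t) v :: l) e.
Proof.
move=> h n; case: n => [//|n] sn N X T XT X1.
pose one := exist _ 1%g (mem_set Gamma1) : Gamma.
pose d (j : 'I_n.+1) := if j == ord0 then t else one.
have hN := haagerup_pow_ruan N hE.
have Xin : mx_in X by move=> i j; exact: represents_in (XT i j).
pose Dg : 'M[E]_n.+1 := \matrix_(i, j) (if i == j then delta (d i) else 0).
have D1 : osp_norm Dg <= 1 by exact: ell1_diag_delta.
have Din : mx_in Dg.
  move=> i j; rewrite mxE; case: ifP => _; last exact: (ruan0 hE).
  exact: (proj1 (ell1_delta _)).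
pose X' : 'M[haagerup_pow E N.+1]_n.+1 := \matrix_(i, j) tens (X i j) (delta (d j)).
have X'E : X' = \matrix_(i, j) (fun=> odot X Dg i j).
  apply/matrixP => i j; rewrite !mxE; apply/funext => k.
  rewrite (bigD1 j) //= big1 ?addr0 => [|q qj]; last first.
    by rewrite mxE (negPf qj) (tens0_r hE).
  by rewrite mxE eqxx.
have X'1 : osp_norm X' <= 1.
  rewrite X'E completion_norm_const; apply: le_trans (haag_le hN hE Xin Din) _.
  rewrite -[leRHS]mulr1 ler_pM ?(ruan_ge0 hN) ?(ruan_ge0 hE) //.
have X'T i j : represents (X' i j) (fun v => T i j (act (val (d j)) v)).
  by rewrite mxE; exact: represents_tens.
have := h n.+1 sn N.+1 X' _ X'T X'1.
congr (_ <= _); apply: eq_bigr => i _; congr (rnorm (xi0 _) ^+ 2).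
apply: eq_bigr => j _; congr (T i j _); rewrite /d.
by case: (unliftP ord0 j) => [k ->|->] //=; rewrite act1.
Qed.

Lemma cb_claim_perm l l' e : perm_eq l l' -> cb_claim l e -> cb_claim l' e.
Proof.
rewrite perm_sym => ll; have sl : size l' = size l by exact: perm_size.
have /tuple_permP[p pE] : perm_eq l' (in_tuple l) by [].
apply: (@cb_claim_comb l l' (size l) (perm_mx p)) => //.
  move=> L h; rewrite expr1n mul1r [leRHS](reindex_inj (@perm_inj _ p)) /=.
  apply: ler_sum => i _; rewrite (bigD1 (p i)) //= big1 ?addr0 => [|k kp].
    by rewrite !mxE eqxx scale1r.
  by rewrite !mxE eq_sym (negPf kp) scale0r.
move=> j; rewrite (bigD1 (p j)) //= big1 ?addr0 => [|k kp]; last first.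
  by rewrite !mxE eq_sym (negPf kp) scale0r.
rewrite !mxE eqxx scale1r pE.
rewrite -(tnth_nth 0 [tuple tnth (in_tuple l) (p i) | i < size l] j) tnth_mktuple.
by rewrite (tnth_nth 0).
Qed.

Lemma cb_claim_refl (c s : R) v w l e : c ^+ 2 + s ^+ 2 = 1 -> cb_claim (v :: w :: l) e ->
  cb_claim ((c%:C *: v + s%:C *: w) :: (s%:C *: v - c%:C *: w) :: l) e.
Proof.
(* The reflection on the first two coordinates and the identity elsewhere, with natural number
   indices so that splitting off two terms computes by matching. *)
move=> cs; pose m := size l; pose D (j k : nat) : R[i] := match j, k with
  | 0, 0 => c%:C | 0, 1 => s%:C | 1, 0 => s%:C | 1, 1 => - c%:C
  | j'.+2, k'.+2 => (j' == k')%:R | _, _ => 0 end.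
pose C : 'M[R[i]]_m.+2 := \matrix_(j, k) D j k.
have CE (W : lmodType R[i]) (h : nat -> W) (j : nat) : (j < m.+2)%N ->
    \sum_(k < m.+2) D j k *: h k =
    match j with
    | 0 => c%:C *: h 0%N + s%:C *: h 1%N
    | 1 => s%:C *: h 0%N - c%:C *: h 1%N
    | j'.+2 => h j'.+2 end.
  move=> jm; rewrite 2!big_ord_recl /=; case: j jm => [|[|j]] jm /=.
  - by rewrite big1 ?addr0 // => k _; rewrite scale0r.
  - by rewrite big1 ?addr0 ?scaleNr // => k _; rewrite scale0r.
  rewrite !scale0r !add0r (bigD1 (Ordinal (jm : (j < m)%N))) //= eqxx scale1r.
  by rewrite big1 ?addr0 // => k; rewrite -val_eqE eq_sym /= => /negPf ->; rewrite scale0r.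
apply: (@cb_claim_comb _ _ m.+2 C) => //.
  move=> L h; pose h' (k : nat) := h (inord k).
  have hE' (k : 'I_m.+2) : h k = h' k by rewrite /h' inord_val.
  have -> : \sum_i rnorm (\sum_j C i j *: h j) ^+ 2 =
      \sum_(i < m.+2) rnorm (\sum_(j < m.+2) D i j *: h' j) ^+ 2.
    apply: eq_bigr => i _; congr (rnorm _ ^+ 2); apply: eq_bigr => j _.
    by rewrite mxE hE'.
  rewrite (eq_bigr (fun i : 'I_m.+2 => rnorm (match val i with
    | 0 => c%:C *: h' 0%N + s%:C *: h' 1%N
    | 1 => s%:C *: h' 0%N - c%:C *: h' 1%N
    | j'.+2 => h' j'.+2 end) ^+ 2)); last by move=> i _; rewrite CE.
  rewrite [X in _ <= _ * X](eq_bigr (fun i : 'I_m.+2 => rnorm (h' i) ^+ 2)); last first.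
    by move=> i _; rewrite hE'.
  rewrite expr1n mul1r !big_ord_recl /= !addrA lerD2r.
  by case: (hnorm_hilbertian L) => + _ _ => /(_ c s (h' 0%N) (h' 1%N) cs) ->.
move=> j; rewrite (eq_bigr (fun k : 'I_m.+2 => D j k *: nth 0 (v :: w :: l) k)).
  by rewrite (CE _ (nth 0 (v :: w :: l))) //; case: (val j) => [|[|i]].
by move=> k _; rewrite mxE.
Qed.

Lemma cb_claim_phase (z : R[i]) v l e : rnorm z = 1 -> cb_claim (v :: l) e ->
  cb_claim (z *: v :: l) e.
Proof.
move=> z1; pose d (j : 'I_(size l).+1) : R[i] := if j == ord0 then z else 1.
apply: (@cb_claim_comb _ _ (size l).+1 (\matrix_(j, k) (d j *+ (j == k)))) => //.
  apply: scalar_bd_diag => j; rewrite /d; case: ifP => _; first by rewrite z1.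
  by rewrite /rnorm normr1.
move=> j; rewrite (bigD1 j) //= big1 ?addr0 => [|k kj]; last first.
  by rewrite mxE eq_sym (negPf kj) mulr0n scale0r.
rewrite mxE eqxx mulr1n /d.
by case: (unliftP ord0 j) => [k ->|->] //=; rewrite scale1r.
Qed.

Lemma cb_sound l e : adm Gamma act eta0 K l e ->
  \sum_(v <- l) rnorm (xi0 v) ^+ 2 <= e.
Proof.
move=> ale; suff h : cb_claim l e.
  (* Index 0 is the single copy of ell_1; the diagonal of the basis vector at the unit has norm at
     most 1 and acts as the identity on the family. *)
  pose one := exist _ 1%g (mem_set Gamma1) : Gamma.
  pose X : 'M[haagerup_pow E 0]_(size l) :=
    \matrix_(i, j) (if i == j then delta one else 0).
  have XT i j : represents (X i j) (if i == j then act 1%g else fun=> 0).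
    rewrite mxE; case: ifP => _; [exact: represents_delta|exact: represents0].
  have := h _ erefl 0%N X _ XT (ell1_diag_delta (fun=> one)).
  congr (_ <= _); rewrite (big_nth 0) big_mkord; apply: eq_bigr => i _.
  congr (rnorm (xi0 _) ^+ 2).
  rewrite (bigD1 i) //= eqxx big1 ?addr0 ?act1 // => j ji.
  by rewrite eq_sym (negPf ji).
elim: ale => {l e} [hs|l1 l2 e l12 _ IH|c s v w l e cs _ IH|z t v l e z1 Gt _ IH].
- exact: cb_claim_base.
- exact: cb_claim_perm IH.
- exact: cb_claim_refl.
- apply: cb_claim_phase => //.
  exact: (@cb_claim_shift (exist _ t (mem_set Gt))).
Qed.

End CbSound.
End Powers.

(** * From representations to factorizations *)

Section RepresentationToFactorization.
Context {R : realType} (G : groupType) (L H : hilbert R) (pi : G -> L -> L).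
Variables (xi : L -> H) (eta : H -> L) (f : G -> H -> H) (K : R).
Hypotheses (hpi : unitary_rep pi) (bxi : bounded_op xi) (beta : bounded_op eta)
  (fE : forall t h, f t h = xi (pi t (eta h)))
  (xeK : opnorm xi * opnorm eta <= K).

(** The factors in (iv) are contractions with K in front, so xi is divided by its norm and the
    remaining scalar, the norm of xi over K, goes to eta. If K or the norm of xi is 0, then f
    vanishes and zero maps serve. *)
Lemma normalized_factors : exists (x : L -> H) (e : H -> L),
  [/\ linear x /\ linear e, forall v, rnorm (x v) <= rnorm v,
      forall h, rnorm (e h) <= rnorm h
    & forall t h, f t h = K%:C *: x (pi t (e h))].
Proof.
have [xl _] := bxi; have [el _] := beta.
have x0 := opnorm_ge0 bxi; have e0 := opnorm_ge0 beta.
have piP t : linear (pi t) by case: hpi => /(_ t)[].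
have bound t h : rnorm (f t h) <= opnorm xi * (opnorm eta * rnorm h).
  rewrite fE; apply: le_trans (opnormP _ bxi) _; rewrite ler_wpM2l //.
  by rewrite (unitary_norm hpi) opnormP.
have K0 : 0 <= K by apply: le_trans xeK; exact: mulr_ge0.
have [deg|] := boolP ((K == 0) || (opnorm xi == 0)).
  have f0 t h : f t h = 0.
    apply/rnorm0_eq0/eqP; rewrite eq_le rnorm_ge0 andbT.
    apply: le_trans (bound t h) _; rewrite mulrA.
    suff -> : opnorm xi * opnorm eta = 0 by rewrite mul0r.
    case/orP: deg => /eqP d0; last by rewrite d0 mul0r.
    by apply/le_anti; rewrite mulr_ge0 // andbT -d0.
  exists (fun=> 0), (fun=> 0); split=> [|v|h|t h]; rewrite ?rnorm0 ?rnorm_ge0 //.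
    by split=> a u v; rewrite scaler0 addr0.
  by rewrite f0 scaler0.
rewrite negb_or => /andP[Kn xn].
have Kp : 0 < K by rewrite lt_neqAle eq_sym Kn.
have xp : 0 < opnorm xi by rewrite lt_neqAle eq_sym xn.
exists (fun v => (opnorm xi)^-1%:C *: xi v), (fun h => (opnorm xi / K)%:C *: eta h).
split.
- by split=> a u v; rewrite ?xl ?el scalerDr !scalerA mulrC.
- move=> v; rewrite rnormZ rnormR gtr0_norm ?invr_gt0 // ler_pdivrMl //.
  exact: opnormP.
- move=> h; rewrite rnormZ rnormR gtr0_norm ?divr_gt0 // mulrAC ler_pdivrMr //.
  apply: le_trans (ler_wpM2l x0 (opnormP h beta)) _.
  by rewrite mulrA [leRHS]mulrC ler_wpM2r ?rnorm_ge0.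
move=> t h; rewrite (linearZ_fun _ _ (piP t)) (linearZ_fun _ _ xl) !scalerA -!rmorphM.
rewrite fE mulrAC /= (_ : K * (opnorm xi / K) * (opnorm xi)^-1 = 1) ?scale1r //.
by field; rewrite Kn xn.
Qed.

Let side (b : bool) : hilbert R := if b then H else L.

Lemma representation_factorization (Gamma : set G) (N : nat) : (0 < N)%N ->
  exists (Hs : nat -> hilbert R) (e1 : Hs 0%N = H) (eN : Hs N = H)
         (F : forall i, Gamma -> Hs i.+1 -> Hs i),
    factorization f K e1 eN F.
Proof.
move=> N0; have [x [e [[xl el] xb eb fE']]] := normalized_factors.
have [u1 pi1 piM] := hpi.
have piP t : linear (pi t) by case: (u1 t).
(* The spaces at positions 0 and N are H, all others are L. A factor absorbs x or e where it meets
   an end, and both when N = 1. *)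
pose b i := (i == 0%N) || (i == N).
pose inn (c : bool) : side c -> L := if c return side c -> L then e else id.
pose out (c : bool) : L -> side c := if c return L -> side c then x else id.
have innP c : linear (inn c) /\ forall y, rnorm (inn c y) <= rnorm y by case: c.
have outP c : linear (out c) /\ forall y, rnorm (out c y) <= rnorm y by case: c.
have bN : true = b N by rewrite /b eqxx orbT.
(* The equality of spaces is the image of an equality of booleans, which can be eliminated by
   cases. *)
have innN (c : bool) (p : true = c) h :
    inn c (hcast (esym (congr1 side (esym p))) h) = e h by case: c / p.
pose F i (t : Gamma) (y : side (b i.+1)) : side (b i) :=
  out (b i) (pi (val t) (inn (b i.+1) y)).
exists (fun i => side (b i)), erefl, (congr1 side (esym bN)), F.
have FP i t : linear (F i t) /\ forall y, rnorm (F i t y) <= rnorm y.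
  split=> [a v w|y].
    by rewrite /F (proj1 (innP _)) piP (proj1 (outP _)).
  apply: le_trans (proj2 (outP _) _) _; rewrite (unitary_norm hpi).
  exact: (proj2 (innP _)).
have F1 i t y : rnorm (F i t y) <= 1 * rnorm y by rewrite mul1r; exact: (proj2 (FP i t)).
split=> [i t _|t h].
  split; last exact: opnorm_le ler01 (F1 i t).
  by split; [exact: (proj1 (FP i t))|exists 1; exact: F1].
(* Level 0 is excluded because x enters with the first factor. *)
have step k (y : side (b k)) : (0 < k)%N -> (k <= N)%N ->
    @op_prod R Gamma (fun i => side (b i)) F t k y =
    x (pi (\prod_(i < k) val (t i))%g (inn (b k) y)).
  elim: k y => [//|[|k] IH] y _ kN; first by rewrite /= big_ord1.
  rewrite big_ord_recr piM -[LHS]/(op_prod F t (F k.+1 (t k.+1) y)).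
  rewrite IH //; last exact: ltnW.
  congr (x (pi _ _)); rewrite /F.
  have -> : b k.+1 = false by rewrite /b /= ltn_eqF.
  by [].
by rewrite fE' step // innN.
Qed.

End RepresentationToFactorization.

(** * The space spanned by right translates of the coefficients *)

Section OrbitSpace.
Context {R : realType} (G : groupType) (H : hilbert R).

(** Linearity of each f t is bundled with f because the vector space structure on [orbit_space]
    depends on it. *)
Record linear_family := LinearFamily {
  family_fun :> G -> H -> H;
  family_linear : forall t, linear (family_fun t) }.

Variable f : linear_family.

(** Plain sums already form a linear span, since a scalar can be absorbed into the vector of H. *)
Definition orbit_pred : {pred G -> H} := fun phi =>
  `[< exists s : seq (G * H),
        phi = fun x => \sum_(p <- s) f (x * p.1)%g p.2 >].

Lemma orbit_closed : submod_closed orbit_pred.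
Proof.
split=> [|a phi psi /asboolP[s ->] /asboolP[r ->]]; apply/asboolP.
  by exists [::]; apply/funext => x; rewrite big_nil.
exists ([seq (p.1, a *: p.2) | p <- s] ++ r); apply/funext => x.
rewrite big_cat big_map /= !fctE scaler_sumr; congr (_ + _).
by apply: eq_bigr => p _; rewrite linearZ_fun //; exact: family_linear.
Qed.

HB.instance Definition _ := GRing.isSubmodClosed.Build R[i] (G -> H) orbit_pred orbit_closed.

Record orbit_space := OrbitSpace {
  orbit_fun :> G -> H; orbit_funP : orbit_fun \in orbit_pred }.
HB.instance Definition _ := [isSub for orbit_fun].
HB.instance Definition _ := [Choice of orbit_space by <:].
HB.instance Definition _ := [SubChoice_isSubLmodule of orbit_space by <:].

Lemma orbitP (u v : orbit_space) : u =1 v -> u = v.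
Proof. by move=> uv; apply/val_inj/funext. Qed.

Lemma orbit_act_subproof (t : G) (u : orbit_space) :
  (fun x => u (x * t)%g) \in orbit_pred.
Proof.
case: u => u /= /asboolP[s ->]; apply/asboolP.
exists [seq (t * p.1, p.2)%g | p <- s]; apply/funext => x.
by rewrite big_map; apply: eq_bigr => p _; rewrite mulgA.
Qed.

Definition orbit_act t u : orbit_space := OrbitSpace (orbit_act_subproof t u).

Lemma orbit_eta_subproof (h : H) : (fun x => f x h) \in orbit_pred.
Proof.
apply/asboolP; exists [:: (1%g, h)]; apply/funext => x.
by rewrite big_seq1 mulg1.
Qed.

Definition orbit_eta h : orbit_space := OrbitSpace (orbit_eta_subproof h).

Definition orbit_xi (u : orbit_space) : H := u 1%g.

Lemma orbit_act_linear t : linear (orbit_act t).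
Proof. by move=> a u v; apply: orbitP. Qed.

Lemma orbit_act1 u : orbit_act 1%g u = u.
Proof. by apply: orbitP => x /=; rewrite mulg1. Qed.

Lemma orbit_actM s t u : orbit_act (s * t)%g u = orbit_act s (orbit_act t u).
Proof. by apply: orbitP => x /=; rewrite mulgA. Qed.

Lemma orbit_eta_linear : linear orbit_eta.
Proof. by move=> a h k; apply: orbitP => x /=; exact: family_linear. Qed.

Lemma orbit_xi_linear : linear orbit_xi.
Proof. by []. Qed.

Lemma orbit_span u : exists s : seq (G * H),
  u = \sum_(p <- s) orbit_act p.1 (orbit_eta p.2).
Proof.
case: u => u uP; have /asboolP[s E] := uP; exists s; apply: orbitP => x /=.
rewrite E; elim: s {E} => [|p s IH]; first by rewrite !big_nil.
by rewrite !big_cons IH.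
Qed.

Lemma orbit_coefficient t h : orbit_xi (orbit_act t (orbit_eta h)) = f t h.
Proof. by rewrite /orbit_xi /= mul1g. Qed.

End OrbitSpace.

Theorem corollary7p3 (R : realType) (G : groupType) (Gamma : set G)
    (Gamma1 : Gamma 1%g)
    (Gamma_gen : forall g : G, exists s : seq G,
      (forall x, x \in s -> Gamma x) /\ g = (\prod_(x <- s) x)%g)
    (K : R) (K_ge0 : 0 <= K) (H : hilbert R)
    (f : G -> H -> H) (f_bounded : forall t, bounded_op (f t)) :
  [<-> (* (i) *)
       exists (Hpi : hilbert R) (pi : G -> Hpi -> Hpi)
              (xi : Hpi -> H) (eta : H -> Hpi),
         [/\ unitary_rep pi, bounded_op xi, bounded_op eta,
             (forall t h, f t h = xi (pi t (eta h)))
           & opnorm xi * opnorm eta <= K];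
       (* (ii) *)
       cb_extendable Gamma f K;
       (* (iii) *)
       cb_extendable [set: G] f K;
       (* (iv) *)
       forall N : nat, (0 < N)%N ->
         exists (Hs : nat -> hilbert R) (e1 : Hs 0%N = H) (eN : Hs N = H)
                (F : forall i, Gamma -> Hs i.+1 -> Hs i),
           (forall i t, (i < N)%N ->
              bounded_op (F i t) /\ opnorm (F i t) <= 1) /\
           (forall (t : nat -> Gamma) (h : H),
              f (\prod_(i < N) val (t i))%g h =
              K%:C *: hcast e1 (op_prod F t (hcast (esym eN) h)))].
Proof.
pose fl := @LinearFamily R G H f (fun t => proj1 (f_bounded t)).
(* Stated for any generating set with unit, to serve both Gamma and G itself. *)
have dil (S : set G) : S 1%g ->
    (forall g : G, exists s : seq G,
      (forall x, x \in s -> S x) /\ g = (\prod_(x <- s) x)%g) ->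
    (forall l E, adm S (@orbit_act _ _ _ fl) (orbit_eta fl) K l E ->
      \sum_(v <- l) rnorm (orbit_xi v) ^+ 2 <= E) ->
    exists (Hpi : hilbert R) (pi : G -> Hpi -> Hpi) (xi : Hpi -> H) (eta : H -> Hpi),
      [/\ unitary_rep pi, bounded_op xi, bounded_op eta,
          (forall t h, f t h = xi (pi t (eta h))) & opnorm xi * opnorm eta <= K].
  move=> S1 Sgen sound.
  have [Hpi [pi [xi [eta [upi bxi beta E le]]]]] := dilation S1 Sgen
    (@orbit_act_linear _ _ _ fl) (@orbit_act1 _ _ _ fl) (@orbit_actM _ _ _ fl)
    (orbit_eta_linear fl) (@orbit_xi_linear _ _ _ fl) K_ge0 (@orbit_span _ _ _ fl) sound.
  exists Hpi, pi, xi, eta; split=> // t h.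
  by rewrite -E orbit_coefficient.
have cb_rep (S : set G) : S 1%g ->
    (forall g : G, exists s : seq G,
      (forall x, x \in s -> S x) /\ g = (\prod_(x <- s) x)%g) ->
    cb_extendable S f K ->
    exists (Hpi : hilbert R) (pi : G -> Hpi -> Hpi) (xi : Hpi -> H) (eta : H -> Hpi),
      [/\ unitary_rep pi, bounded_op xi, bounded_op eta,
          (forall t h, f t h = xi (pi t (eta h))) & opnorm xi * opnorm eta <= K].
  move=> S1 Sgen cb; apply: (dil _ S1 Sgen) => l E.
  exact: (cb_sound S1 (@orbit_act_linear _ _ _ fl) (@orbit_act1 _ _ _ fl)
    (@orbit_actM _ _ _ fl) (@orbit_xi_linear _ _ _ fl) (@orbit_coefficient _ _ _ fl) cb).
have Tgen (g : G) : exists s : seq G,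
    (forall x, x \in s -> [set: G] x) /\ g = (\prod_(x <- s) x)%g.
  by exists [:: g]; rewrite big_seq1.
tfae.
- move=> [Hpi [pi [xi [eta [upi bxi beta fE le]]]]].
  exact: (representation_cb _ upi bxi beta fE le).
(* This implication and the next pass through (i): the representation lives on all of G, so it
   serves Gamma and G alike. *)
- move=> /(cb_rep _ Gamma1 Gamma_gen)[Hpi [pi [xi [eta [upi bxi beta fE le]]]]].
  exact: (representation_cb _ upi bxi beta fE le).
- move=> /(cb_rep [set: G] I Tgen)[Hpi [pi [xi [eta [upi bxi beta fE le]]]]] N N0.
  exact: representation_factorization upi bxi beta fE le Gamma N N0.
move=> fac; apply: (dil _ Gamma1 Gamma_gen) => l E.
apply: (factorization_sound Gamma1 (@orbit_act_linear _ _ _ fl) (@orbit_act1 _ _ _ fl)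
  (@orbit_actM _ _ _ fl) (@orbit_xi_linear _ _ _ fl) K_ge0 (@orbit_coefficient _ _ _ fl)).
exact: fac.
Qed.
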